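(* Assume the setting of the context, in which the covariance model may be mis-specified ($\boldsymbol\Sigma_0\ne\boldsymbol\Sigma(\boldsymbol\theta_0)$, where $\boldsymbol\theta_0=\arg\inf_{\boldsymbol\theta\in\Theta}L_0(\boldsymbol\theta)$, so $L_0(\boldsymbol\theta_0)\neq0$). Suppose the following conditions hold. (C1) $\lambda_{\min}(\boldsymbol\Sigma(\boldsymbol\theta))>0$ for all $n$ and $\boldsymbol\theta\in\Theta$, and $\limsup_{n\to\infty}\sup_{\boldsymbol\theta\in\Theta}\lambda_{\max}\big(\boldsymbol\Sigma^{-1/2}(\boldsymbol\theta)\boldsymbol\Sigma_0\boldsymbol\Sigma^{-1/2}(\boldsymbol\theta)\big)<\infty$. (C2) For $\alpha\in\mathcal A_n\setminus\mathcal A_n^0$ there exists $\boldsymbol\theta_\alpha\in\Theta$, not depending on $n$, such that $$\sup_{\alpha\in\mathcal A_n\setminus\mathcal A_n^0}\left|\frac{\ell(\alpha;\hat{\boldsymbol\theta}(\alpha))-\ell(\alpha;\boldsymbol\theta_\alpha)}{R(\alpha;\boldsymbol\theta_\alpha)-L_0(\boldsymbol\theta_0)}\right|=o_p(1),\qquad \sup_{\alpha\in\mathcal A_n\setminus\mathcal A_n^0}\left|\frac{L(\alpha;\hat{\boldsymbol\theta}(\alpha))-L(\alpha;\boldsymbol\theta_\alpha)}{R(\alpha;\boldsymbol\theta_\alpha)-L_0(\boldsymbol\theta_0)}\right|=o_p(1);$$ moreover $\sup_{\alpha\in\mathcal A_n^0}|\ell(\alpha;\hat{\boldsymbol\theta}(\alpha))-\ell(\alpha;\boldsymbol\theta_0)|=O_p(1)$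 and $\sup_{\alpha\in\mathcal A_n^0}|L(\alpha;\hat{\boldsymbol\theta}(\alpha))-L(\alpha;\boldsymbol\theta_0)|=O_p(1)$. (C3) With $\boldsymbol\theta_\alpha$ from (C2), $\lim_{n\to\infty}\sum_{\alpha\in\mathcal A_n\setminus\mathcal A_n^0}\frac{1}{(R(\alpha;\boldsymbol\theta_\alpha)-L_0(\boldsymbol\theta_0))^q}=0$ for some $q>0$. (C4$'$) With $\boldsymbol\theta_\alpha$ from (C2), $\lim_{n\to\infty}\sup_{\alpha\in\mathcal A_n\setminus\mathcal A_n^0}\frac{p_n}{R(\alpha;\boldsymbol\theta_\alpha)-L_0(\boldsymbol\theta_0)}=0$. (C5) With $\boldsymbol\theta_\alpha$ from (C2), $\sup_{\alpha\in\mathcal A_n\setminus\mathcal A_n^0}\left|\frac{\operatorname{tr}\left(((\boldsymbol\eta+\boldsymbol\epsilon)(\boldsymbol\eta+\boldsymbol\epsilon)'-\boldsymbol\Sigma_0)(\boldsymbol\Sigma^{-1}(\boldsymbol\theta_\alpha)-\boldsymbol\Sigma^{-1}(\boldsymbol\theta_0))\right)}{R(\alpha;\boldsymbol\theta_\alpha)-L_0(\boldsymbol\theta_0)}\right|=o_p(1)$. Let $\hat\alpha_2$ be the model selected by GIC with $\tau_n=2$. Then: (i) If $|\mathcal A_n^0|\le1$, then $\hat\alpha_2$ is asymptotically loss efficient. If $|\mathcal A_n^0|=1$, then $\hat\alpha_2$ is consistent. (ii) If $|\mathcal A_n^0|\ge2$ for sufficiently large $n$, $|\mathcal A_n^0|^q=o(L_0(\boldsymbol\theta_0))$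 for some $q>0$, and $\lim_{n\to\infty}\frac{p_n}{L_0(\boldsymbol\theta_0)}=0$, then $\hat\alpha_2$ is asymptotically loss efficient.
   Context: Data. For each $n$, data are observed at sites $\mathbf s_i=\mathbf s_{ni}$, $i=1,\dots,n$, in a region $D\subset\mathbb R^d$ (sites and region may vary with $n$; the dependence of all objects on $n$ is mostly suppressed): $Z(\mathbf s_i)=\mu_0(\mathbf s_i)+\eta(\mathbf s_i)+\epsilon(\mathbf s_i)$, where $\mu_0(\cdot)$ is the mean function, $\eta(\cdot)$ is a zero-mean Gaussian spatial process with $\sup_{\mathbf s\in D}\mathrm E(\eta^2(\mathbf s))<\infty$, and $\epsilon(\mathbf s_i)$ are Gaussian white-noise variables, independent of $\eta(\cdot)$. Write $\mathbf Z,\boldsymbol\eta,\boldsymbol\epsilon$ for the corresponding $n$-vectors, $\boldsymbol\mu_0=\mathrm E(\mathbf Z)$, and $\boldsymbol\Sigma_0=\operatorname{var}(\mathbf Z)=\operatorname{var}(\boldsymbol\eta+\boldsymbol\epsilon)$ for the true covariance matrix, so $\mathbf Z\sim N(\boldsymbol\mu_0,\boldsymbol\Sigma_0)$. Models. There are $p_n$ explanatory variables $x_1(\cdot),\dots,x_{p_n}(\cdot)$; $\mathbf X$ is the nonrandom $n\times(p_n+1)$ matrix with rows $(1,x_1(\mathbf s_i),\dots,x_{p_n}(\mathbf s_i))$. $\mathcal A_n\subseteq2^{\{1,\dots,p_n\}}$ is the set of candidate models ($\varnothing$ is the intercept-only model). For $\alpha\in\mathcal A_n$, $p(\alpha)$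 is the number of elements of $\alpha$ and $\mathbf X(\alpha)$ is the $n\times(p(\alpha)+1)$ submatrix of $\mathbf X$ consisting of the column $\mathbf 1$ and the columns indexed by $\alpha$. Model $\alpha$ postulates $\mathbf Z=\mathbf X(\alpha)\boldsymbol\beta(\alpha)+\boldsymbol\eta+\boldsymbol\epsilon$ with covariance matrix $\boldsymbol\Sigma(\boldsymbol\theta)=\boldsymbol\Sigma_\eta+v^2\mathbf I$, where $\boldsymbol\Sigma_\eta$ is the model covariance matrix of $\boldsymbol\eta$, $v^2$ is the model variance of the white noise, and $\boldsymbol\theta\in\Theta$ is the vector of covariance parameters; $\boldsymbol\Sigma(\boldsymbol\theta)$ is continuous in $\boldsymbol\theta\in\Theta$, and $\boldsymbol\Sigma^{-1}(\boldsymbol\theta)$ and $(\mathbf X'\boldsymbol\Sigma^{-1}(\boldsymbol\theta)\mathbf X)^{-1}$ exist for all $\boldsymbol\theta\in\Theta$. The true $\boldsymbol\Sigma_0$ need not belong to $\{\boldsymbol\Sigma(\boldsymbol\theta):\boldsymbol\theta\in\Theta\}$. A model $\alpha$ is correct if $\mu_0(\mathbf s)$ can be written as $\beta_0+\sum_{j\in\alpha}\beta_jx_j(\mathbf s)$ for all $\mathbf s\in D$. $\mathcal A_n^0\subseteq\mathcal A_n$ is the set of correct models and, if it is nonempty, $\alpha_n^0=\arg\min_{\alpha\in\mathcal A_n^0}p(\alpha)$ is the smallest correct model. Likelihood and GIC. $\mathbf M(\alpha;\boldsymbol\theta)=\mathbf X(\alpha)(\mathbf X(\alpha)'\boldsymbol\Sigma^{-1}(\boldsymbol\theta)\mathbf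 X(\alpha))^{-1}\mathbf X(\alpha)'\boldsymbol\Sigma^{-1}(\boldsymbol\theta)$ and $\hat{\boldsymbol\mu}(\alpha;\boldsymbol\theta)=\mathbf M(\alpha;\boldsymbol\theta)\mathbf Z$. The profile log-likelihood is $$\ell(\alpha;\boldsymbol\theta)=-\tfrac n2\log(2\pi)-\tfrac12\log\det\boldsymbol\Sigma(\boldsymbol\theta)-\tfrac12(\mathbf Z-\hat{\boldsymbol\mu}(\alpha;\boldsymbol\theta))'\boldsymbol\Sigma^{-1}(\boldsymbol\theta)(\mathbf Z-\hat{\boldsymbol\mu}(\alpha;\boldsymbol\theta)),$$ and the ML estimate $\hat{\boldsymbol\theta}(\alpha)\in\Theta$ satisfies $\ell(\alpha;\hat{\boldsymbol\theta}(\alpha))=\sup_{\boldsymbol\theta\in\Theta}\ell(\alpha;\boldsymbol\theta)$. For a tuning parameter $\tau_n$, the generalized information criterion (GIC) is $\Gamma_{\tau_n}(\alpha)=-2\ell(\alpha;\hat{\boldsymbol\theta}(\alpha))+\tau_np(\alpha)$, and $\hat\alpha_{\tau_n}=\arg\min_{\alpha\in\mathcal A_n}\Gamma_{\tau_n}(\alpha)$. Losses. $L_0(\boldsymbol\theta)=\tfrac12\{\log\det\boldsymbol\Sigma(\boldsymbol\theta)-\log\det\boldsymbol\Sigma_0+\operatorname{tr}(\boldsymbol\Sigma_0\boldsymbol\Sigma^{-1}(\boldsymbol\theta))-n\}$ and $\boldsymbol\theta_0=\arg\inf_{\boldsymbol\theta\in\Theta}L_0(\boldsymbol\theta)$. The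 Kullback–Leibler loss is $$L(\alpha;\boldsymbol\theta)=L_0(\boldsymbol\theta)+\tfrac12(\hat{\boldsymbol\mu}(\alpha;\boldsymbol\theta)-\boldsymbol\mu_0)'\boldsymbol\Sigma^{-1}(\boldsymbol\theta)(\hat{\boldsymbol\mu}(\alpha;\boldsymbol\theta)-\boldsymbol\mu_0),$$ and for fixed $\boldsymbol\theta$, $R(\alpha;\boldsymbol\theta)=\mathrm E(L(\alpha;\boldsymbol\theta))$. A selection procedure $\hat\alpha$ is consistent if $\lim_{n\to\infty}P\{\hat\alpha=\alpha_n^0\}=1$, and asymptotically loss efficient if $L(\hat\alpha;\hat{\boldsymbol\theta}(\hat\alpha))/\min_{\alpha\in\mathcal A_n}L(\alpha;\hat{\boldsymbol\theta}(\alpha))\to1$ in probability as $n\to\infty$. $\lambda_{\min},\lambda_{\max}$ denote smallest and largest eigenvalues; $|\mathcal B|$ denotes the number of elements of a set $\mathcal B$. *)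

(* Defs.v *)
From HB Require Import structures.
From mathcomp Require Import all_boot all_order all_algebra.
From mathcomp Require Import all_classical all_reals all_analysis.

Set Implicit Arguments.
Unset Strict Implicit.
Unset Printing Implicit Defensive.
Import Order.TTheory GRing.Theory Num.Theory.
Import numFieldNormedType.Exports.
Local Open Scope classical_set_scope.
Local Open Scope ring_scope.

Section matrices.
Context {R : realType}.

Definition qform n (A : 'M[R]_n) (v : 'cV[R]_n) : R := (v^T *m A *m v) 0 0.

Definition psd n (A : 'M[R]_n) : Prop :=
  A^T = A /\ forall v : 'cV[R]_n, 0 <= qform A v.

Definition lambda_max n (A : 'M[R]_n) : R := sup [set a | eigenvalue A a].
Definition lambda_min n (A : 'M[R]_n) : R := inf [set a | eigenvalue A a].

(* the unique psd square root when A is psd (and 0 when there is none) *)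
Definition psd_sqrt n (A : 'M[R]_n) : 'M[R]_n :=
  xget 0 [set B | psd B /\ B *m B = A].

End matrices.

Section probability_notions.
Context {disp : measure_display} {T : measurableType disp} {R : realType}.
Variable P : probability T R.

(* X ~ N(m, s ^ 2); the Dirac case is singled out because the library's
   normal_prob m 0 is not the degenerate Gaussian law *)
Definition gaussian (X : T -> R) (m s : R) : Prop :=
  forall B : set R, measurable B ->
    P (X @^-1` B) = (if s == 0 then \d_m B else normal_prob m s B).

Definition gaussian_process (I : Type) (D : set I) (X : I -> T -> R) : Prop :=
  forall (m : nat) (t : 'I_m -> I) (c : 'I_m -> R), (forall i, D (t i)) ->
    exists mu s : R, gaussian (fun w => \sum_(i < m) c i * X (t i) w) mu s.

Definition sigma_of (I : Type) (D : set I) (X : I -> T -> R) : set (set T) :=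
  <<s [set A | exists i B, [/\ D i, measurable B & A = X i @^-1` B]] >>.

Definition independent_sigma (F G : set (set T)) : Prop :=
  forall A B, F A -> G B -> (P (A `&` B) = P A * P B)%E.

Definition mutually_independent n (X : 'I_n -> T -> R) : Prop :=
  forall B : 'I_n -> set R, (forall i, measurable (B i)) ->
    P [set w | forall i, B i (X i w)] = (\prod_(i < n) P (X i @^-1` B i))%E.

Definition o_p (X : nat -> T -> R) : Prop :=
  forall e : R, 0 < e -> P [set w | e < `|X n w|] @[n --> \oo] --> 0%E.

Definition O_p (X : nat -> T -> R) : Prop :=
  forall e : R, 0 < e -> exists K : R,
    \forall n \near \oo, (P [set w | (K < `|X n w|)%R] <= e%:E)%E.

Definition cvg_in_probability (X : nat -> T -> R) (l : R) : Prop :=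
  o_p (fun n w => X n w - l).

End probability_notions.

Section geostatistical_regression.
Context {disp : measure_display} {T : measurableType disp} {R : realType}.
Variables (P : probability T R) (d k : nat).

(* Data-generating process and postulated models for a sample of size n.
   Models are subsets of 'I_(nvar); the ordinal j stands for the explanatory
   variable number j.+1. *)
Record georeg (n : nat) := GeoReg {
  region : set 'rV[R]_d;
  site : 'I_n -> 'rV[R]_d;
  mean_fun : 'rV[R]_d -> R;
  eta : 'rV[R]_d -> {RV P >-> R};
  noise_sd : R;
  eps : 'I_n -> {RV P >-> R};
  nvar : nat;
  xvar : 'I_nvar -> 'rV[R]_d -> R;
  candidates : {set {set 'I_nvar}};
  Sigma_eta : 'rV[R]_k -> 'M[R]_n;
  model_noise_var : 'rV[R]_k -> R }.

Section objects.
Context {n : nat} (M : georeg n).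
Local Notation model := {set 'I_(nvar M)}.

Definition Zobs (i : 'I_n) (w : T) : R :=
  mean_fun M (site M i) + eta M (site M i) w + eps M i w.
Definition Zvec (w : T) : 'cV[R]_n := \col_i Zobs i w.
Definition errvec (w : T) : 'cV[R]_n := \col_i (eta M (site M i) w + eps M i w).
Definition mu0 : 'cV[R]_n := \col_i mean_fun M (site M i).
Definition Sigma0 : 'M[R]_n :=
  \matrix_(i, j) fine (covariance P (Zobs i) (Zobs j)).

Definition Sigma (th : 'rV[R]_k) : 'M[R]_n :=
  Sigma_eta M th + (model_noise_var M th)%:M.

Definition covariates : 'M[R]_(n, nvar M) :=
  \matrix_(i, j) xvar j (site M i).
Definition Xfull : 'M[R]_(n, 1 + nvar M) := row_mx (const_mx 1) covariates.
Definition Xsub (a : model) : 'M[R]_(n, 1 + #|a|) :=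
  row_mx (const_mx 1) (colsub (fun j : 'I_#|a| => enum_val j) covariates).

Definition Mhat (a : model) (th : 'rV[R]_k) : 'M[R]_n :=
  Xsub a *m invmx ((Xsub a)^T *m invmx (Sigma th) *m Xsub a)
    *m (Xsub a)^T *m invmx (Sigma th).
Definition muhat (a : model) (th : 'rV[R]_k) (w : T) : 'cV[R]_n :=
  Mhat a th *m Zvec w.

Definition loglik (a : model) (th : 'rV[R]_k) (w : T) : R :=
  - (n%:R / 2) * ln (2 * pi) - 2^-1 * ln (\det (Sigma th))
  - 2^-1 * qform (invmx (Sigma th)) (Zvec w - muhat a th w).

Definition L0 (th : 'rV[R]_k) : R :=
  2^-1 * (ln (\det (Sigma th)) - ln (\det Sigma0)
          + \tr (Sigma0 *m invmx (Sigma th)) - n%:R).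

Definition Loss (a : model) (th : 'rV[R]_k) (w : T) : R :=
  L0 th + 2^-1 * qform (invmx (Sigma th)) (muhat a th w - mu0).

Definition Risk (a : model) (th : 'rV[R]_k) : R := fine ('E_P[Loss a th])%E.

Definition correct (a : model) : Prop :=
  exists (b0 : R) (b : 'I_(nvar M) -> R), forall s, region M s ->
    mean_fun M s = b0 + \sum_(j in a) b j * xvar j s.

Definition correct_models : {set model} :=
  [set a in candidates M | `[< correct a >]].
Definition incorrect_models : {set model} := candidates M :\: correct_models.

(* junk value finset.set0 when there is no correct model *)
Definition smallest_correct : model :=
  odflt finset.set0 [pick a in correct_models |
    [forall b in correct_models, (#|a| <= #|b|)%N]].

(* A model as a set of positive integers, i.e. forgetting n: this is the
   argument of a parameter theta_alpha that does not depend on n. *)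
Definition labels (a : model) : set nat :=
  [set m | exists2 j : 'I_(nvar M), j \in a & m = j.+1].

Definition excess (theta_ : set nat -> 'rV[R]_k) (th0 : 'rV[R]_k)
    (a : model) : R :=
  Risk a (theta_ (labels a)) - L0 th0.

Definition GIC (tau : R) (thetahat : model -> T -> 'rV[R]_k) (a : model)
    (w : T) : R :=
  - 2 * loglik a (thetahat a w) w + tau * #|a|%:R.

(* Estimators are Borel measurable, so that the events whose probabilities are
   taken in o_p, O_p and consistent are measurable. *)
Definition is_MLE (Theta : set 'rV[R]_k) (a : model) (th : T -> 'rV[R]_k) :
    Prop :=
  [/\ forall U : set 'rV[R]_k, open U -> measurable (th @^-1` U),
      forall w, Theta (th w) &
      forall w, (loglik a (th w) w)%:E =
        ereal_sup [set (loglik a t w)%:E | t in Theta] ].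

Definition is_GIC_selection (tau : R) (thetahat : model -> T -> 'rV[R]_k)
    (ahat : T -> model) : Prop :=
  [/\ forall a, measurable (ahat @^-1` [set a]),
      forall w, ahat w \in candidates M &
      forall w a, a \in candidates M ->
        GIC tau thetahat (ahat w) w <= GIC tau thetahat a w ].

(* a minimum, since the set of candidate models is finite *)
Definition min_loss (thetahat : model -> T -> 'rV[R]_k) (w : T) : R :=
  inf [set Loss a (thetahat a w) w | a in [set` candidates M]].

Definition is_theta0 (Theta : set 'rV[R]_k) (th0 : 'rV[R]_k) : Prop :=
  Theta th0 /\ forall th, Theta th -> L0 th0 <= L0 th.

(* Standing assumptions. noise_sd = 0 is not excluded; only the nonsingularity
   of var(Z), implicit in the term log det Sigma0 of L0, is required. *)
Record georeg_axioms (Theta : set 'rV[R]_k) : Prop := {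
  site_region : forall i, region M (site M i);
  eta_gaussian : gaussian_process P (region M) (eta M);
  eta_centered : forall s, region M s -> ('E_P[eta M s] = 0)%E;
  eta_var_bounded :
    (ereal_sup [set 'E_P[(fun w => (eta M s w) ^+ 2)%R] | s in region M] < +oo)%E;
  noise_sd_ge0 : 0 <= noise_sd M;
  eps_gaussian : forall i, gaussian P (eps M i) 0 (noise_sd M);
  eps_indep : mutually_independent P (eps M);
  eps_eta_indep :
    independent_sigma P (sigma_of (region M) (eta M)) (sigma_of setT (eps M));
  Sigma0_unit : Sigma0 \in unitmx;
  Sigma_eta_psd : forall th, Theta th -> psd (Sigma_eta M th);
  model_noise_var_ge0 : forall th, Theta th -> 0 <= model_noise_var M th;
  Sigma_continuous : {within Theta, continuous Sigma};
  Sigma_unit : forall th, Theta th -> Sigma th \in unitmx;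
  gram_unit : forall th, Theta th ->
    Xfull^T *m invmx (Sigma th) *m Xfull \in unitmx }.

End objects.

Section selection.
Variable M : forall n, georeg n.

Definition consistent (ahat : forall n, T -> {set 'I_(nvar (M n))}) : Prop :=
  P [set w | ahat n w = smallest_correct (M n)] @[n --> \oo] --> 1%E.

Definition asymptotically_loss_efficient
    (thetahat : forall n, {set 'I_(nvar (M n))} -> T -> 'rV[R]_k)
    (ahat : forall n, T -> {set 'I_(nvar (M n))}) : Prop :=
  cvg_in_probability P
    (fun n w => Loss (ahat n w) (thetahat n (ahat n w) w) w
                / min_loss (thetahat n) w) 1.

End selection.

End geostatistical_regression.

(* Main.v *)
Require Import Defs.
From HB Require Import structures.
From mathcomp Require Import all_boot all_order all_algebra.
From mathcomp Require Import all_classical all_reals all_analysis.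
From mathcomp Require Import measurable_realfun ring lra.
From mathcomp Require Import complex.

Set Implicit Arguments.
Unset Strict Implicit.
Unset Printing Implicit Defensive.
Import Order.TTheory GRing.Theory Num.Theory.
Import numFieldNormedType.Exports.
Local Open Scope classical_set_scope.
Local Open Scope ring_scope.

(** Let [e] be the vector of errors, [W] the inverse of the model covariance and
    [H] the quadratic form of the generalized least squares fit of a model.
    The loss of the model is [L0] plus half of the bias [mu^T (W - H) mu] plus
    half of the fit [e^T H e] ([LossE]), and its negative log-likelihood is

      common constant + loss + mu^T (W - H) e - e^T H e
        + half the trace of (e e^T - Sigma0) W

    ([loglikE]). The criterion with penalty 2 per variable, halved and freed of
    what is common to all the models, is therefore the loss up to the linear
    bias term, the fit, the number of variables, and the difference of the
    covariance terms at the parameter of the model and at [theta0]. The last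
    one is small by assumption. The theorem is that the others are small with
    respect to the loss, uniformly over the models.

    Incorrect models. All the terms are compared to the excess risk, that is,
    the excess of [L0] plus half of the bias plus half of the mean of the fit
    ([RiskE]). The true covariance is at most a constant [c] times every model
    covariance ([covariance_dominated]), so the linear term is Gaussian with
    variance at most [c] times the bias ([bias_variance_le]), and the fit has an
    exponential moment of at most [2 ^+ (1 + nvar)] ([gaussian_quadratic_mgf]).
    Since the dimension is negligible with respect to the excess risk, both have
    tails exponentially small in the excess risk, which beat every inverse
    power of it. Hence the union bound over the incorrect models vanishes as
    soon as one sum of inverse powers does ([bias_vanishing], [fit_vanishing]).

    Correct models. The bias vanishes, and all the fits at [theta0] are
    dominated by the fit of the model with every variable, whose mean is at most
    [c * (1 + nvar)]: Markov's inequality for that fit bounds all of them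
    ([full_fit_tail]).

    Conclusion. Under misspecification [L0 theta0] is positive, because the
    Gaussian divergence vanishes only for equal covariances, and every loss is
    at least [L0 theta0]. When there is no correct model, or when the dimension
    is negligible with respect to [L0 theta0], criterion and loss agree up to
    a small factor, and minimising one nearly minimises the other
    ([criterion_loss_ratio]). When there is exactly one correct model, the
    excess risks of all the others exceed its fluctuations, so that it both
    minimises the criterion and has the least loss
    ([unique_correct_selected]).

    The probabilistic input is the exponential moment of linear forms of [e]
    ([mgf_err]), which follows from the independence of the process and the
    noise, and the measurability of the estimated likelihoods and losses, which
    follows from the continuity of the model covariance. *)

(** * Spectral theorem for real symmetric matrices *)

(** A real symmetric matrix is Hermitian over the complex extension, where it
    is diagonalised with real eigenvalues; being an eigenvalue descends to the
    base field. *)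
Lemma symmetric_eigenvalue (R : rcfType) n (A : 'M[R]_n.+1) :
  A^T = A -> exists a, eigenvalue A a.
Proof.
move=> symA; pose C : numClosedFieldType := complex.complex R.
pose f : {rmorphism R -> C} := complex.real_complex R.
pose B : 'M[C]_n.+1 := map_mx f A.
have fR x : f x \is Num.real by apply/complex.complex_realP; exists x.
have hB : B \is hermsymmx.
  apply: realsym_hermsym.
    by apply/is_hermitianmxP; rewrite expr0 scale1r map_mx_id // /B map_trmx symA.
  by apply/mxOverP => i j; rewrite mxE fR.
have /orthomx_spectralP BE := hermitian_normalmx hB.
have /mxOverP/(_ 0 0) d0R := hermitian_spectral_diag_real hB.
move: BE d0R; set U := spectralmx B; set d := spectral_diag B => BE d0R.
have Uu : U \in unitmx by exact: spectral_unit.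
have [a da] : exists a, d 0 0 = f a by apply/complex.complex_realP.
exists a; rewrite -(eigenvalue_map f) -da.
apply/eigenvalueP; exists (row 0 U).
  rewrite -/B [in LHS]BE -!row_mul !mulmxA mulmxV // mul1mx.
  by apply/rowP => j; rewrite mul_diag_mx !mxE.
apply/eqP => r0; have := mulmxV Uu.
move=> /(congr1 (row 0)); rewrite row_mul r0 mul0mx => /rowP/(_ 0).
by rewrite !mxE eqxx => /eqP; rewrite eq_sym oner_eq0.
Qed.

Lemma row_sqr_gt0 (R : realDomainType) n (v : 'rV[R]_n) :
  v != 0 -> 0 < (v *m v^T) 0 0.
Proof.
move=> v0; have -> : (v *m v^T) 0 0 = \sum_j v 0 j ^+ 2.
  by rewrite mxE; apply: eq_bigr => j _; rewrite mxE expr2.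
rewrite lt_neqAle sumr_ge0 ?andbT => [|j _]; last exact: sqr_ge0.
apply: contra_neq v0 => /esym/psumr_eq0P s0; apply/rowP => j; rewrite mxE.
by apply/eqP; rewrite -sqrf_eq0; apply/eqP/s0 => // i _; exact: sqr_ge0.
Qed.

(** The reflection exchanging the first basis vector with the normalised [v]
    (the identity when they coincide). *)
Lemma orthogonal_with_row (R : rcfType) n (v : 'rV[R]_n.+1) : v != 0 ->
  exists2 U : 'M[R]_n.+1, U *m U^T = 1%:M & exists c, row 0 U = c *: v.
Proof.
move=> v0.
pose nv := (v *m v^T) 0 0.
have nv_gt0 : 0 < nv by exact: row_sqr_gt0.
pose c := (Num.sqrt nv)^-1.
pose e : 'rV[R]_n.+1 := row 0 1%:M.
pose u := c *: v.
have uu : u *m u^T = 1%:M.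
  rewrite /u linearZ /= -scalemxAl -scalemxAr scalerA [v *m _]mx11_scalar.
  rewrite -/nv scale_scalar_mx -expr2 exprVn sqr_sqrtr ?ltW //.
  by rewrite mulVf // gt_eqF.
have ee : e *m e^T = 1%:M.
  rewrite /e tr_row trmx1 -row_mul mul1mx; apply/matrixP => i j.
  by rewrite !ord1 !mxE eqxx.
pose t := (u *m e^T) 0 0.
have ue : u *m e^T = t%:M by rewrite [LHS]mx11_scalar.
have eu : e *m u^T = t%:M by rewrite -tr_scalar_mx -ue trmx_mul trmxK.
pose w := u - e.
have ww : w *m w^T = (2 - 2 * t)%:M.
  rewrite /w raddfB /= mulmxBl !mulmxBr uu ue eu ee.
  by apply/matrixP => i j; rewrite !ord1 !mxE eqxx; ring.
have ew : e *m w^T = (t - 1)%:M.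
  by rewrite /w raddfB /= mulmxBr eu ee -raddfB.
have [t1|t1] := eqVneq (2 - 2 * t) 0.
  exists 1%:M; first by rewrite trmx1 mulmx1.
  exists c; rewrite -/u -/e.
  apply/eqP; rewrite eq_sym -subr_eq0; apply: contraTT isT => w0.
  by have := row_sqr_gt0 w0; rewrite -/e -/u -/w ww t1 mxE mul0rn ltxx.
pose k := 2 / (2 - 2 * t).
pose N := w^T *m w.
have NT : N^T = N by rewrite /N trmx_mul trmxK.
have NN : N *m N = (2 - 2 * t) *: N.
  by rewrite /N !mulmxA -[w^T *m w *m _]mulmxA ww mul_mx_scalar scalemxAl.
exists (1%:M - k *: N).
  have -> : (1%:M - k *: N)^T = 1%:M - k *: N by rewrite linearB /= linearZ /= NT trmx1.
  rewrite mulmxBl mul1mx mulmxBr mulmx1.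
  rewrite -scalemxAl -scalemxAr NN !scalerA.
  rewrite -[RHS]subr0 -!addrA; congr (_ + _); apply/matrixP => i j.
  by rewrite !mxE /k; field.
exists c; rewrite -/u.
rewrite linearB /= linearZ /= -/e row_mul.
have -> : row 0 w^T = (t - 1)%:M.
  by rewrite -ew /e -row_mul mul1mx.
rewrite mul_scalar_mx scalerA.
have -> : k * (t - 1) = -1 by rewrite /k; field.
by rewrite scaleN1r opprK /w addrC subrK.
Qed.

(** In an orthogonal basis that starts with an eigenvector, symmetry kills the
    off-diagonal blocks, and the remaining block is smaller. *)
Theorem symmetric_spectral (R : rcfType) n (A : 'M[R]_n) : A^T = A ->
  exists2 U : 'M[R]_n, U *m U^T = 1%:M &
    exists d : 'rV[R]_n, A = U^T *m diag_mx d *m U.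
Proof.
elim: n A => [|n IHn] A symA.
  by exists 1%:M; [|exists 0]; apply/matrixP => -[].
have [a /eigenvalueP[v va v0]] := symmetric_eigenvalue symA.
have [U UU [c Uc]] := orthogonal_with_row v0.
have [B [AE symB B0]] : exists B : 'M[R]_(1 + n), [/\ A = U^T *m B *m U,
    B^T = B & forall j, B 0 j = a * (0 == j)%:R].
  exists (U *m A *m U^T); split.
  - by rewrite !mulmxA (mulmx1C UU) mul1mx -mulmxA (mulmx1C UU) mulmx1.
  - by rewrite !trmx_mul trmxK symA mulmxA.
  have : row 0 (U *m A *m U^T) = a *: row 0 1%:M.
    rewrite -mulmxA row_mul Uc -scalemxAl mulmxA va -!scalemxAl scalerA.
    by rewrite mulrC -scalerA scalemxAl -Uc -row_mul UU.
  by move=> /rowP rE j; have := rE j; rewrite [in X in X -> _]mxE => ->; rewrite !mxE.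
have Bul : ulsubmx B = a%:M.
  apply/matrixP => i j; rewrite !ord1 !mxE eqxx mulr1n.
  by rewrite (_ : lshift n (0 : 'I_1) = (0 : 'I_n.+1)) ?B0 ?mulr1 //; apply: val_inj.
have Bur : ursubmx B = 0.
  apply/matrixP => i j; rewrite !ord1 !mxE.
  by rewrite (_ : lshift n (0 : 'I_1) = (0 : 'I_n.+1)) ?B0 ?mulr0 //; apply: val_inj.
have Bdl : dlsubmx B = 0 by rewrite -[B]symB -trmx_ursub Bur trmx0.
have symB' : (drsubmx B)^T = drsubmx B by rewrite trmx_drsub symB.
have [V VV [d dE]] := IHn _ symB'.
pose K : 'M[R]_(1 + n) := block_mx 1%:M 0 0 V.
pose D : 'rV[R]_(1 + n) := row_mx a%:M d.
have KK : K *m K^T = 1%:M.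
  rewrite tr_block_mx mulmx_block !trmx0 trmx1 !(mul0mx, mulmx0, addr0, add0r).
  by rewrite mulmx1 VV -scalar_mx_block.
have BE : B = K^T *m diag_mx D *m K.
  rewrite -[LHS]submxK Bul Bur Bdl dE diag_mx_row tr_block_mx !mulmx_block.
  rewrite !trmx0 trmx1 !(mul0mx, mulmx0, addr0, add0r) mul1mx mulmx1.
  by congr block_mx; apply/matrixP => i j; rewrite !ord1 !mxE eqxx.
exists (K *m U); last by exists D; rewrite trmx_mul AE BE !mulmxA.
by rewrite trmx_mul mulmxA -[K *m U *m _]mulmxA UU mulmx1.
Qed.

(** * Quadratic forms and positive matrices *)

Section quadratic_forms.
Context {R : realType}.

Definition posdef n (A : 'M[R]_n) : Prop :=
  A^T = A /\ forall v : 'cV[R]_n, v != 0 -> 0 < qform A v.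

Lemma qform_congr m n (A : 'M[R]_m) (B : 'M[R]_(m, n)) v :
  qform (B^T *m A *m B) v = qform A (B *m v).
Proof. by rewrite /qform trmx_mul !mulmxA. Qed.

Lemma qform_diag n (d : 'rV[R]_n) v :
  qform (diag_mx d) v = \sum_i d 0 i * v i 0 ^+ 2.
Proof.
rewrite /qform -mulmxA mxE; apply: eq_bigr => i _.
by rewrite mul_diag_mx !mxE; ring.
Qed.

Lemma qformDl n (A B : 'M[R]_n) v : qform (A + B) v = qform A v + qform B v.
Proof. by rewrite /qform mulmxDr mulmxDl mxE. Qed.

Lemma qformNl n (A : 'M[R]_n) v : qform (- A) v = - qform A v.
Proof. by rewrite /qform mulmxN mulNmx mxE. Qed.

Lemma qform1_ge0 n (v : 'cV[R]_n) : 0 <= qform 1%:M v.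
Proof.
by rewrite -diag_const_mx qform_diag sumr_ge0 // => i _; rewrite mxE mul1r sqr_ge0.
Qed.

Lemma posdef_psd n (A : 'M[R]_n) : posdef A -> psd A.
Proof.
move=> [sA pA]; split=> // v; have [->|/pA/ltW//] := eqVneq v 0.
by rewrite /qform mulmx0 mxE.
Qed.

Lemma posdef_unit n (A : 'M[R]_n) : posdef A -> A \in unitmx.
Proof.
move=> [sA pA]; rewrite -row_free_unit -kermx_eq0.
apply/eqP/row_matrixP => i; rewrite row0; apply/eqP/negP => /negP k0.
have kA : row i (kermx A) *m A = 0 by apply/sub_kermxP; exact: row_sub.
have := pA (row i (kermx A))^T; rewrite trmx_eq0 => /(_ k0).
by rewrite /qform trmxK kA mul0mx mxE ltxx.
Qed.

Lemma psd_spectrum_ge0 n (U : 'M[R]_n) (d : 'rV[R]_n) : U *m U^T = 1%:M ->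
  psd (U^T *m diag_mx d *m U) -> forall i, 0 <= d 0 i.
Proof.
move=> UU [_ pA] i; have := pA (U^T *m delta_mx i 0).
rewrite qform_congr mulmxA UU mul1mx qform_diag (bigD1 i) //= big1 => [|j ji].
  by rewrite !mxE !eqxx expr1n mulr1 addr0.
by rewrite mxE (negbTE ji) /= expr0n mulr0.
Qed.

(** The spectrum is nonnegative and has a nonzero product. *)
Lemma psd_unit_posdef n (A : 'M[R]_n) : psd A -> A \in unitmx -> posdef A.
Proof.
move=> pA uA; have [sA _] := pA; split=> // v v0.
have [U UU [d AE]] := symmetric_spectral sA.
have d0 i : 0 < d 0 i.
  rewrite lt_neqAle (psd_spectrum_ge0 UU) -?AE // andbT eq_sym.
  move: uA; rewrite AE !unitmx_mul => /andP[/andP[_ +] _].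
  rewrite unitmxE det_diag unitfE prodf_seq_neq0 => /allP/(_ i).
  by rewrite mem_index_enum => /(_ isT).
rewrite AE qform_congr qform_diag lt_neqAle sumr_ge0 ?andbT => [|i _]; last first.
  by rewrite mulr_ge0 ?sqr_ge0 ?ltW.
apply: contra_neq v0 => /esym/psumr_eq0P s0.
rewrite -[v]mul1mx -(mulmx1C UU) -mulmxA.
suff -> : U *m v = 0 by rewrite mulmx0.
apply/colP => i; rewrite [RHS]mxE; apply/eqP; rewrite -sqrf_eq0.
have /eqP := s0 (fun i _ => mulr_ge0 (ltW (d0 i)) (sqr_ge0 _)) i isT.
by rewrite mulf_eq0 gt_eqF.
Qed.

Lemma posdef_inv n (A : 'M[R]_n) : posdef A -> posdef (invmx A).
Proof.
move=> pA; have uA := posdef_unit pA; have [sA gA] := pA.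
split; first by rewrite trmx_inv sA.
move=> v v0; have -> : qform (invmx A) v = qform A (invmx A *m v).
  by rewrite -qform_congr trmx_inv sA mulVmx // mul1mx.
apply: gA; apply: contra_neq v0 => /(congr1 (mulmx A)).
by rewrite mulmxA mulmxV // mul1mx mulmx0.
Qed.

Lemma posdef_congr m n (A : 'M[R]_m) (B : 'M[R]_(m, n)) : posdef A ->
  (forall v : 'cV_n, B *m v = 0 -> v = 0) -> posdef (B^T *m A *m B).
Proof.
move=> [sA pA] Bi; split; first by rewrite !trmx_mul trmxK sA mulmxA.
move=> v v0; rewrite qform_congr; apply: pA.
by apply: contra_neq v0 => /Bi.
Qed.

(** [psd_sqrt] is a choice among the square roots, so that exhibiting one, by
    the square roots of the eigenvalues, is enough. *)
Lemma psd_sqrtP n (A : 'M[R]_n) : psd A ->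
  psd (psd_sqrt A) /\ psd_sqrt A *m psd_sqrt A = A.
Proof.
move=> pA; rewrite /psd_sqrt; have [sA _] := pA.
have [U UU [d AE]] := symmetric_spectral sA.
have d0 : forall i, 0 <= d 0 i by apply: (psd_spectrum_ge0 UU); rewrite -AE.
pose e := \row_i Num.sqrt (d 0 i).
suff : exists B : 'M[R]_n, psd B /\ B *m B = A
  by move=> /(@xgetPex _ 0 [set B | psd B /\ B *m B = A]).
exists (U^T *m diag_mx e *m U); split; last first.
  rewrite [RHS]AE !mulmxA; congr (_ *m _).
  rewrite -!mulmxA; congr (_ *m _); rewrite [U *m _]mulmxA UU mul1mx.
  rewrite mulmx_diag; congr diag_mx; apply/rowP => i.
  by rewrite !mxE -expr2 sqr_sqrtr.
split; first by rewrite !trmx_mul trmxK tr_diag_mx mulmxA.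
move=> v; rewrite qform_congr qform_diag sumr_ge0 // => i _.
by rewrite mulr_ge0 ?sqr_ge0 // mxE sqrtr_ge0.
Qed.

Lemma eigenvalue_diagonalized n (U : 'M[R]_n) (d : 'rV[R]_n) a :
  U *m U^T = 1%:M ->
  eigenvalue (U^T *m diag_mx d *m U) a <-> exists i, a = d 0 i.
Proof.
move=> UU; split=> [/eigenvalueP[v vA v0]|[i ->]].
  have [w w0 wd] : exists2 w : 'rV[R]_n, w != 0 & w *m diag_mx d = a *: w.
    exists (v *m U^T); last by rewrite scalemxAl -vA -!mulmxA UU mulmx1.
    apply: contra_neq v0 => /(congr1 (mulmx^~ U)).
    by rewrite -mulmxA (mulmx1C UU) mulmx1 mul0mx.
  have /rV0Pn[i wi] := w0; exists i.
  apply: (mulIf wi); have /rowP/(_ i) := wd; rewrite mul_mx_diag !mxE => <-; exact: mulrC.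
apply/eigenvalueP; exists (row i U).
  rewrite -row_mul !mulmxA UU mul1mx.
  by apply/rowP => j; rewrite mul_diag_mx !mxE.
apply/eqP => r0; have := UU => /(congr1 (row i)).
rewrite row_mul r0 mul0mx => /rowP/(_ i).
by rewrite !mxE eqxx => /eqP; rewrite eq_sym oner_eq0.
Qed.

(** In an eigenbasis the form is a weighted sum of squares. That [lambda_max]
    is the supremum of a bounded set comes from the same diagonalisation. *)
Lemma qform_le_lambda_max n (A : 'M[R]_n) v : A^T = A ->
  qform A v <= lambda_max A * qform 1%:M v.
Proof.
move=> sA; have [U UU [d AE]] := symmetric_spectral sA.
have dle i : d 0 i <= lambda_max A.
  apply: ub_le_sup; last by rewrite /= {1}AE eigenvalue_diagonalized //; exists i.
  exists (\sum_i `|d 0 i|) => a /=; rewrite AE eigenvalue_diagonalized // => -[j ->].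
  rewrite (bigD1 j) //= (le_trans (ler_norm _)) // lerDl.
  by rewrite sumr_ge0.
have -> : qform 1%:M v = qform 1%:M (U *m v).
  by rewrite -qform_congr mulmx1 (mulmx1C UU).
rewrite {1}AE qform_congr -diag_const_mx !qform_diag mulr_sumr ler_sum // => i _.
by rewrite [const_mx _ _ _]mxE mul1r ler_wpM2r ?sqr_ge0.
Qed.

End quadratic_forms.

(** * Comparison of covariance matrices and Gaussian divergence *)

Section covariance_comparison.
Context {R : realType} {n : nat}.
Variables (Sig S : 'M[R]_n).
Hypotheses (pSig : posdef Sig) (pS : psd S).
Local Notation Q := (psd_sqrt (invmx Sig)).

Lemma inv_sqrt_congr : [/\ Q^T = Q, Q *m Q = invmx Sig & Q *m Sig *m Q = 1%:M].
Proof.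
have [[sQ _] QQ] := psd_sqrtP (posdef_psd (posdef_inv pSig)); split=> //.
by apply: mulmx1C; rewrite mulmxA QQ mulVmx // posdef_unit.
Qed.

(** Turns a spectral bound into a comparison of quadratic forms, by writing
    [u] as [Q *m v]; only this comparison is used in the probability
    estimates. *)
Lemma whitened_dominates c (u : 'cV[R]_n) :
  lambda_max (Q *m S *m Q) <= c -> qform S u <= c * qform Sig u.
Proof.
move=> lc; have [sQ QQ QSQ] := inv_sqrt_congr; have [sS _] := pS.
have [v ->] : exists v, u = Q *m v.
  by exists (Sig *m Q *m u); rewrite mulmxA [Q *m _]mulmxA QSQ mul1mx.
rewrite -!qform_congr sQ QSQ.
apply: le_trans (_ : lambda_max (Q *m S *m Q) * qform 1%:M v <= _).
  by apply: qform_le_lambda_max; rewrite !trmx_mul sQ sS mulmxA.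
by rewrite ler_wpM2r ?qform1_ge0.
Qed.

End covariance_comparison.

Lemma posdef_det_gt0 (R : realType) n (A : 'M[R]_n) : posdef A -> 0 < \det A.
Proof.
move=> pA; have [sA _] := pA; have uA := posdef_unit pA.
have [U UU [d AE]] := symmetric_spectral sA.
have dA : \det A = \prod_i d 0 i.
  rewrite AE !det_mulmx det_diag mulrC mulrA -det_mulmx UU det1 mul1r //.
rewrite dA prodr_gt0 // => i _; rewrite lt_neqAle.
rewrite (psd_spectrum_ge0 UU) -?AE ?andbT; last exact: posdef_psd.
apply: contraTneq uA => d0; rewrite unitmxE dA unitfE negbK.
by rewrite (bigD1 i) //= -d0 mul0r.
Qed.

Lemma ln_prod (R : realType) (I : finType) (d : I -> R) : (forall i, 0 < d i) ->
  ln (\prod_i d i) = \sum_i ln (d i).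
Proof.
move=> d0; rewrite -[RHS]expRK expR_sum; congr ln.
by apply: eq_bigr => i _; rewrite lnK // posrE.
Qed.

Lemma ln_lt_subr1 (R : realType) (x : R) : 0 < x -> x != 1 -> ln x < x - 1.
Proof.
move=> x0 x1; rewrite ltrBrDl -{2}[x]lnK ?posrE //.
by apply: expR_gt1Dx; rewrite ln_eq0.
Qed.

Section gaussian_divergence.
Context {R : realType} {n : nat}.
Variables (Sig S : 'M[R]_n).
Hypotheses (pSig : posdef Sig) (pS : posdef S).

Let div := ln (\det Sig) - ln (\det S) + \tr (S *m invmx Sig) - n%:R.

(** Twice the Kullback-Leibler divergence between centered normal laws depends
    only on the spectrum of the whitened covariance, and is a sum of
    nonnegative terms [x - 1 - ln x] that vanish at [x = 1] only. *)
Lemma gaussian_divergence_diag : exists U : 'M[R]_n, exists d : 'rV[R]_n,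
  [/\ U *m U^T = 1%:M, forall i, 0 < d 0 i,
      psd_sqrt (invmx Sig) *m S *m psd_sqrt (invmx Sig) =
        U^T *m diag_mx d *m U &
      div = \sum_i (d 0 i - 1 - ln (d 0 i))].
Proof.
have [sQ QQ QSQ] := inv_sqrt_congr pSig.
move: sQ QQ QSQ; set Q := psd_sqrt _ => sQ QQ QSQ.
have uQ : Q \in unitmx.
  by have := unitmx1 R n; rewrite -QSQ !unitmx_mul => /andP[].
have pB : posdef (Q *m S *m Q).
  rewrite -{1}sQ; apply: posdef_congr => // v /(congr1 (mulmx (invmx Q))).
  by rewrite mulmxA mulVmx // mul1mx mulmx0.
have [sB _] := pB; have [U UU [d BE]] := symmetric_spectral sB.
have detB : \det (Q *m S *m Q) = \prod_i d 0 i.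
  by rewrite BE !det_mulmx det_diag mulrC mulrA -det_mulmx UU det1 mul1r.
have d0 i : 0 < d 0 i.
  rewrite lt_neqAle (psd_spectrum_ge0 UU) -?BE ?andbT; last exact: posdef_psd.
  apply: contraTneq (posdef_det_gt0 pB) => di0.
  by rewrite detB (bigD1 i) //= -di0 mul0r ltxx.
exists U, d; split=> //.
have dS := posdef_det_gt0 pS; have dSig := posdef_det_gt0 pSig.
have lnd : ln (\det S) - ln (\det Sig) = \sum_i ln (d 0 i).
  rewrite -ln_prod // -detB -ln_div ?posrE //; congr ln.
  have := congr1 determinant QSQ; rewrite !det_mulmx det1 => QE.
  have Q0 : \det Q != 0 by move: uQ; rewrite unitmxE unitfE.
  by rewrite -[LHS]mulr1 -QE; field; rewrite gt_eqF.
have trd : \tr (S *m invmx Sig) = \sum_i d 0 i.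
  rewrite -QQ mulmxA mxtrace_mulC mulmxA BE mxtrace_mulC mulmxA UU mul1mx.
  by rewrite mxtrace_diag.
rewrite /div trd !sumrB -lnd sumr_const card_ord.
by ring.
Qed.

Lemma gaussian_divergence_ge0 : 0 <= div.
Proof.
have [U [d [_ d0 _ ->]]] := gaussian_divergence_diag.
rewrite sumr_ge0 // => i _; rewrite subr_ge0.
by have [->|/(ln_lt_subr1 (d0 i))/ltW//] := eqVneq (d 0 i) 1; rewrite ln1 subrr.
Qed.

Lemma gaussian_divergence_eq0 : div = 0 -> S = Sig.
Proof.
have [U [d [UU d0 BE ->]]] := gaussian_divergence_diag.
move=> /psumr_eq0P s0.
have d1 i : d 0 i = 1.
  apply/eqP; apply: contraT => /(ln_lt_subr1 (d0 i)); rewrite -subr_gt0 s0 ?ltxx //.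
  move=> j _; rewrite subr_ge0.
  by have [->|/(ln_lt_subr1 (d0 j))/ltW//] := eqVneq (d 0 j) 1; rewrite ln1 subrr.
have [sQ QQ QSQ] := inv_sqrt_congr pSig.
have dE : diag_mx d = 1%:M.
  by rewrite -diag_const_mx; congr diag_mx; apply/rowP => j; rewrite d1 mxE.
move: BE; rewrite dE mulmx1 (mulmx1C UU) -QSQ.
have uQ : psd_sqrt (invmx Sig) \in unitmx.
  by have := unitmx1 R n; rewrite -QSQ !unitmx_mul => /andP[].
by move/(can_inj (mulmxK uQ))/(can_inj (mulKmx uQ)).
Qed.

End gaussian_divergence.

(** * Generalized least squares *)

Section generalized_least_squares.
Context {R : realType}.

(** The projector onto the columns of [X] that is orthogonal for the scalar
    product of matrix [W]; [W *m gls_proj W X] is then the quadratic form of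
    the fit, and [W - W *m gls_proj W X] that of the residual. *)
Definition gls_proj n r (W : 'M[R]_n) (X : 'M[R]_(n, r)) : 'M[R]_n :=
  X *m invmx (X^T *m W *m X) *m X^T *m W.

Lemma qformD n (A : 'M[R]_n) (u v : 'cV[R]_n) : A^T = A ->
  qform A (u + v) = qform A u + 2 * (u^T *m A *m v) 0 0 + qform A v.
Proof.
move=> sA; rewrite /qform.
have -> : (u + v)^T *m A *m (u + v) =
    u^T *m A *m u + (u^T *m A *m v + (u^T *m A *m v)^T) + v^T *m A *m v.
  rewrite !trmx_mul trmxK sA [(u + v)^T]linearD /= mulmxDl mulmxDl !mulmxDr.
  by rewrite !mulmxA !addrA.
rewrite 3![(_ + _ : 'M[R]_1) 0 0]mxE [(_^T) 0 0]mxE.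
by rewrite -mulr2n mulr_natl.
Qed.

Lemma qformN n (A : 'M[R]_n) (v : 'cV[R]_n) : qform A (- v) = qform A v.
Proof. by rewrite /qform [(- v)^T]linearN /= !mulNmx mulmxN opprK. Qed.

Section fixed_design.
Context {n r : nat}.
Variables (W : 'M[R]_n) (X : 'M[R]_(n, r)).
Hypotheses (pW : posdef W) (uN : X^T *m W *m X \in unitmx).
Local Notation M := (gls_proj W X).
Local Notation H := (W *m gls_proj W X).

Lemma gls_projX : M *m X = X.
Proof. by rewrite /gls_proj -!mulmxA [X^T *m _]mulmxA mulVmx ?mulmx1. Qed.

Lemma gls_proj_idem : M *m M = M.
Proof. by rewrite {2 3}/gls_proj !mulmxA gls_projX. Qed.

Lemma tr_gls_hat : H^T = H.
Proof.
have [sW _] := pW.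
by rewrite /gls_proj !trmx_mul trmx_inv !trmx_mul !trmxK sW !mulmxA.
Qed.

Lemma tr_gls_projW : M^T *m W = H.
Proof. by have [sW _] := pW; rewrite -[RHS]tr_gls_hat [RHS]trmx_mul sW. Qed.

Lemma gls_hat_proj : H *m M = H.
Proof. by rewrite -mulmxA gls_proj_idem. Qed.

Lemma qform_gls_fit v : qform W (M *m v) = qform H v.
Proof. by rewrite -qform_congr tr_gls_projW gls_hat_proj. Qed.

Lemma gls_resid_congr : (1%:M - M)^T *m W *m (1%:M - M) = W - H.
Proof.
rewrite [(_ - _)^T]linearB /= trmx1 !mulmxBl mul1mx tr_gls_projW !mulmxBr !mulmx1.
by rewrite gls_hat_proj subrr subr0.
Qed.

Lemma qform_gls_resid v : qform W (v - M *m v) = qform (W - H) v.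
Proof. by rewrite -gls_resid_congr qform_congr mulmxBl mul1mx. Qed.

Lemma gls_resid_sym : (W - H)^T = W - H.
Proof. by have [sW _] := pW; rewrite [LHS]linearB /= tr_gls_hat sW. Qed.

(** This is what bounds the variance of the linear term of the likelihood by
    the bias: under the covariance [invmx W], the linear form of coefficients
    [(W - H) *m mu] has variance [qform (W - H) mu]. *)
Lemma gls_resid_sandwich :
  (W - H)^T *m invmx W *m (W - H) = W - H.
Proof.
have uW := posdef_unit pW.
have -> : (W - H)^T *m invmx W = 1%:M - M^T.
  by rewrite gls_resid_sym mulmxBl mulmxV // -tr_gls_projW mulmxK.
rewrite mulmxBl mul1mx mulmxBr [M^T *m (W *m _)]mulmxA tr_gls_projW.
by rewrite gls_hat_proj subrr subr0.
Qed.

(** The fitted noise is [W]-orthogonal to the bias of the fit. *)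
Lemma gls_loss_split (mu e : 'cV[R]_n) :
  qform W (M *m (mu + e) - mu) = qform (W - H) mu + qform H e.
Proof.
have [sW _] := pW.
have -> : M *m (mu + e) - mu = M *m e - (mu - M *m mu).
  by rewrite mulmxDr opprB addrA [M *m mu + _]addrC.
rewrite qformD // qformN -qform_gls_resid -qform_gls_fit.
have -> : (M *m e)^T *m W *m - (mu - M *m mu) = 0; last by rewrite mxE mulr0 addr0 addrC.
have H0 : H *m (mu - M *m mu) = 0.
  by rewrite mulmxBr [H *m (_ *m _)]mulmxA gls_hat_proj subrr.
by rewrite trmx_mul -[_ *m M^T *m W]mulmxA tr_gls_projW mulmxN -mulmxA H0 mulmx0 oppr0.
Qed.

Lemma gls_rss_split (mu e : 'cV[R]_n) :
  qform W ((mu + e) - M *m (mu + e)) =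
  qform (W - H) mu + 2 * (mu^T *m (W - H) *m e) 0 0 + qform W e - qform H e.
Proof.
rewrite qform_gls_resid qformD ?gls_resid_sym //.
by rewrite [qform _ e]qformDl qformNl addrA.
Qed.

Lemma gls_resid_eq0 (b : 'cV[R]_r) : (W - H) *m (X *m b) = 0.
Proof. by rewrite mulmxA mulmxBl -[W *m M *m X]mulmxA gls_projX subrr mul0mx. Qed.

Lemma gls_resid_psd : psd (W - H).
Proof.
split=> [|v]; first exact: gls_resid_sym.
by rewrite -qform_gls_resid; have [_ ->] := posdef_psd pW.
Qed.

(** The symmetric square root of the inverse Gram matrix turns the fit into
    an isometric projection; rotating it diagonalises [S] as well. For a noise
    of covariance [S], the fit becomes a weighted sum of squares of
    uncorrelated variables, with weights [d]. *)
Lemma gls_hat_diagonalize (S : 'M[R]_n) : posdef S ->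
  exists G : 'M[R]_(r, n), exists d : 'rV[R]_r,
  [/\ H = G^T *m G, G *m invmx W *m G^T = 1%:M, G *m S *m G^T = diag_mx d &
      forall i, 0 < d 0 i].
Proof.
move=> pS; have [sW _] := pW; have [sS _] := pS; have uW := posdef_unit pW.
pose N := X^T *m W *m X.
have pN : posdef N.
  apply: psd_unit_posdef => //; split=> [|v].
    by rewrite /N !trmx_mul trmxK sW mulmxA.
  by rewrite qform_congr; have [_ ->] := posdef_psd pW.
have [sK KK KNK] := inv_sqrt_congr pN.
move: sK KK KNK; set K := psd_sqrt _ => sK KK KNK.
pose G0 := K *m X^T *m W.
have HG0 : H = G0^T *m G0.
  by rewrite /G0 !trmx_mul sW sK trmxK /gls_proj -/N -KK !mulmxA.
have G01 : G0 *m invmx W *m G0^T = 1%:M.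
  by rewrite /G0 mulmxK // !trmx_mul sW sK trmxK -KNK /N !mulmxA.
have sB : (G0 *m S *m G0^T)^T = G0 *m S *m G0^T.
  by rewrite [LHS]trmx_mul trmxK [(G0 *m S)^T]trmx_mul sS mulmxA.
have [U UU [d BE]] := symmetric_spectral sB.
have UG Y : (U *m G0) *m Y *m (U *m G0)^T = U *m (G0 *m Y *m G0^T) *m U^T.
  by rewrite [(U *m G0)^T]trmx_mul !mulmxA.
have G1 : (U *m G0) *m invmx W *m (U *m G0)^T = 1%:M by rewrite UG G01 mulmx1.
have GS : (U *m G0) *m S *m (U *m G0)^T = diag_mx d.
  by rewrite UG BE !mulmxA UU mul1mx -mulmxA UU mulmx1.
exists (U *m G0), d; split=> // [|i].
  have -> : (U *m G0)^T *m (U *m G0) = G0^T *m (U^T *m U) *m G0.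
    by rewrite [(U *m G0)^T]trmx_mul !mulmxA.
  by rewrite (mulmx1C UU) mulmx1.
move: G1 GS; set G := U *m G0 => G1 GS.
have := pS.2 (G^T *m delta_mx i 0); rewrite -qform_congr trmxK GS qform_diag.
rewrite (bigD1 i) //= big1 => [|j ji]; last first.
  by rewrite mxE (negbTE ji) expr0n mulr0.
rewrite mxE !eqxx expr1n mulr1 addr0; apply.
apply/eqP => /(congr1 (mulmx (G *m invmx W))).
rewrite mulmxA G1 mul1mx mulmx0 => /colP/(_ i).
by rewrite !mxE !eqxx => /eqP; rewrite oner_eq0.
Qed.

End fixed_design.

(** The projectors onto nested column spaces compose to the smaller one, and
    their difference is orthogonal to it: Pythagoras applies. *)
Lemma gls_hat_mono n r r' (W : 'M[R]_n) (X : 'M[R]_(n, r)) (E : 'M[R]_(r, r')) e :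
  posdef W -> X^T *m W *m X \in unitmx ->
  (X *m E)^T *m W *m (X *m E) \in unitmx ->
  qform (W *m gls_proj W (X *m E)) e <= qform (W *m gls_proj W X) e.
Proof.
move=> pW u1 u2; have [sW _] := pW.
have t1 := tr_gls_hat X pW; have t2 := tr_gls_hat (X *m E) pW.
have w2 := tr_gls_projW (X *m E) pW.
rewrite -!qform_gls_fit //.
have M12 : gls_proj W X *m gls_proj W (X *m E) = gls_proj W (X *m E).
  have [Y ->] : exists Y, gls_proj W (X *m E) = X *m Y.
    by rewrite /gls_proj -!mulmxA; eexists.
  by rewrite mulmxA gls_projX.
have H2M1 : W *m gls_proj W (X *m E) *m gls_proj W X = W *m gls_proj W (X *m E).
  rewrite -[LHS]trmxK trmx_mul t2 mulmxA tr_gls_projW //.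
  by rewrite -[W *m _ *m _]mulmxA M12 t2.
move: t1 t2 w2 M12 H2M1; set M1 := gls_proj W X; set M2 := gls_proj W (X *m E).
move=> t1 t2 w2 M12 H2M1.
have -> : M1 *m e = M2 *m e + (M1 *m e - M2 *m e) by rewrite addrC subrK.
rewrite qformD // (_ : _ *m W *m _ = 0).
  by rewrite mxE mulr0 addr0 lerDl; have [_ ->] := posdef_psd pW.
have H0 : W *m M2 *m (M1 *m e - M2 *m e) = 0.
  rewrite mulmxBr ![W *m M2 *m (_ *m e)]mulmxA H2M1 -[W *m M2 *m M2]mulmxA.
  by rewrite gls_proj_idem ?subrr.
by rewrite trmx_mul -[_ *m M2^T *m W]mulmxA w2 -mulmxA H0 mulmx0.
Qed.

(** Evaluating the domination at the rows of the diagonalising matrix, which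
    are orthonormal for [invmx W], bounds each diagonal entry. *)
Lemma gls_hat_diag_dominated n r (W S : 'M[R]_n) (X : 'M[R]_(n, r)) c :
  posdef W -> X^T *m W *m X \in unitmx -> posdef S ->
  (forall u : 'cV[R]_n, qform S u <= c * qform (invmx W) u) ->
  exists G : 'M[R]_(r, n), exists dg : 'rV[R]_r,
  [/\ W *m gls_proj W X = G^T *m G, G *m S *m G^T = diag_mx dg,
      forall i, 0 < dg 0 i & forall i, dg 0 i <= c].
Proof.
move=> pW uN pS dom.
have [G [dg [HG G1 GS dg0]]] := gls_hat_diagonalize pW uN pS.
exists G, dg; split=> // i.
have := dom (G^T *m delta_mx i 0).
rewrite -!qform_congr trmxK GS G1 -diag_const_mx !qform_diag.
rewrite (bigD1 i) //= big1 => [|j ji]; last by rewrite mxE (negbTE ji) expr0n mulr0.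
rewrite (bigD1 i) //= big1 => [|j ji]; last first.
  by rewrite [delta_mx _ _ _ _]mxE (negbTE ji) expr0n mulr0.
by rewrite !mxE !eqxx /= expr1n !mulr1 !addr0 mulr1.
Qed.

Lemma gls_hat_trace_le n r (W S : 'M[R]_n) (X : 'M[R]_(n, r)) c :
  posdef W -> X^T *m W *m X \in unitmx -> posdef S ->
  (forall u : 'cV[R]_n, qform S u <= c * qform (invmx W) u) ->
  \tr (W *m gls_proj W X *m S) <= c * r%:R.
Proof.
move=> pW uN pS dom.
have [G [dg [HG GS dg0 dgc]]] := gls_hat_diag_dominated pW uN pS dom.
rewrite HG -mulmxA mxtrace_mulC GS mxtrace_diag mulr_natr.
rewrite -[X in _ *+ X]card_ord -sumr_const; apply: ler_sum => i _; exact: dgc.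
Qed.

Lemma gls_hat_trace_gt0 n r (W S : 'M[R]_n) (X : 'M[R]_(n, r.+1)) :
  posdef W -> X^T *m W *m X \in unitmx -> posdef S ->
  0 < \tr (W *m gls_proj W X *m S).
Proof.
move=> pW uN pS; have [G [dg [HG _ GS dg0]]] := gls_hat_diagonalize pW uN pS.
rewrite HG -mulmxA mxtrace_mulC GS mxtrace_diag.
by rewrite big_ord_recl ltr_pwDl // sumr_ge0 // => i _; exact: ltW.
Qed.

End generalized_least_squares.

(** * Integration against a weighted measure *)

Section weighted_integral.
Local Open Scope ereal_scope.
Context d1 d2 (T1 : measurableType d1) (T2 : measurableType d2) (R : realType).
Variables (mu : {measure set T1 -> \bar R}) (nu : {measure set T2 -> \bar R}).
Variables (w : T1 -> R) (X : T1 -> T2).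
Hypotheses (w0 : forall x, (0 <= w x)%R) (mw : measurable_fun setT w).
Hypothesis mX : measurable_fun setT X.
Hypothesis nuE : forall B, measurable B ->
  \int[mu]_x ((w x)%:E * (\1_B (X x))%:E) = nu B.

Let mwf (f : T2 -> \bar R) : measurable_fun setT f ->
  measurable_fun setT (fun x => (w x)%:E * f (X x)).
Proof.
move=> mf; apply: emeasurable_funM; first exact/measurable_EFinP.
exact: (measurableT_comp mf mX).
Qed.

Import HBNNSimple.

Let weight_nnsfun (h : {nnsfun T2 >-> R}) :
  \int[mu]_x ((w x)%:E * (h (X x))%:E) = \int[nu]_x (h x)%:E.
Proof.
have mi r : measurable_fun setT (fun x => (r * \1_(h @^-1` [set r]) x)%:E).
  by apply/measurable_EFinP; do 2 apply/measurableT_comp => //.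
under [RHS]eq_integral do rewrite fimfunE -fsumEFin//.
rewrite [RHS]ge0_integral_fsum//; last first.
  by move=> n x _; rewrite EFinM nnfun_muleindic_ge0.
under [LHS]eq_integral.
  move=> x _; rewrite fimfunE -fsumEFin// ge0_mule_fsumr; last first.
    by move=> r; rewrite EFinM nnfun_muleindic_ge0.
  over.
rewrite [LHS]ge0_integral_fsum//; last 2 first.
  - by move=> r; exact: (mwf (mi r)).
  - move=> n x _; rewrite mule_ge0 ?lee_fin ?w0//.
    by have := nnfun_muleindic_ge0 h n (X x); rewrite -EFinM lee_fin.
apply: eq_fsbigr => r /[!inE] -[y _ hy].
rewrite integralZl_indic_nnsfun//= integral_indic// setIT.
rewrite -nuE; last exact: measurable_funPTI.
rewrite -ge0_integralZl//.
- by apply: eq_integral => x _; rewrite EFinM muleCA.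
- by apply: (mwf (f := fun y => (\1_(h @^-1` [set r]) y)%:E));
    exact/measurable_EFinP/measurable_indic.
- by move=> x _; rewrite mule_ge0 ?lee_fin ?w0.
- by rewrite lee_fin -hy.
Qed.

(** The hypothesis passes from indicators to simple functions by linearity,
    and to the limit by monotone convergence. One statement covers densities
    ([X] the identity), image laws ([w] constant) and independence ([nu] a
    multiple of the law of [X]). *)
Lemma ge0_integral_weight (f : T2 -> \bar R) :
  measurable_fun setT f -> (forall y, 0 <= f y) ->
  \int[mu]_x ((w x)%:E * f (X x)) = \int[nu]_y f y.
Proof.
move=> mf f0; pose f_ := nnsfun_approx measurableT mf.
transitivity (lim (\int[nu]_x (f_ n x)%:E @[n --> \oo])); last first.
  rewrite -monotone_convergence//=.
  - apply: eq_integral => ? /[!inE] xD; apply/cvg_lim => //=.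
    exact: cvg_nnsfun_approx.
  - by move=> n; exact/measurable_EFinP/measurable_funTS.
  - by move=> n ? _; rewrite lee_fin.
  - by move=> ? _ ? ? mn; rewrite lee_fin; exact/lefP/nd_nnsfun_approx.
transitivity (lim (\int[mu]_x ((w x)%:E * (f_ n (X x))%:E) @[n --> \oo])).
  rewrite -monotone_convergence//=.
  - apply: eq_integral => x _; apply/esym/cvg_lim => //=.
    by apply: cvgeZl => //; exact: cvg_nnsfun_approx.
  - move=> n; apply: (mwf (f := fun y => (f_ n y)%:E)).
    exact/measurable_EFinP/measurable_funTS.
  - by move=> n ? _; rewrite mule_ge0 ?lee_fin.
  - move=> x _ ? ? mn; rewrite lee_wpmul2l ?lee_fin ?w0//.
    exact/lefP/nd_nnsfun_approx.
by apply: congr_lim; apply/funext => n /=; exact: weight_nnsfun.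
Qed.

End weighted_integral.

(** * Exponential moments of normal laws *)

Section gaussian_mgf.
Context {R : realType}.
Local Notation leb := (@lebesgue_measure R).

Lemma ge0_integral_normal_prob (m s : R) (f : R -> \bar R) :
  measurable_fun setT f -> (forall y, 0 <= f y)%E ->
  (\int[normal_prob m s]_x f x = \int[leb]_x ((normal_pdf m s x)%:E * f x))%E.
Proof.
move=> mf f0; apply/esym.
apply: (@ge0_integral_weight _ _ _ _ _ leb (normal_prob m s) (normal_pdf m s) id) => //.
- by move=> x; exact: normal_pdf_ge0.
- exact: measurable_normal_pdf.
move=> B mB; rewrite /= /normal_prob [RHS]integral_mkcond/=.
apply: eq_integral => x _; rewrite patchE indicE.
by case: ifPn => xB; rewrite ?mule1 ?mule0.
Qed.

(** Completing the square shows a multiple of the normal density of mean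
    [m + t * s ^+ 2]. *)
Lemma normal_prob_mgf (m s t : R) : s != 0 ->
  (\int[normal_prob m s]_x (expR (t * x))%:E =
   (expR (t * m + t ^+ 2 * s ^+ 2 / 2))%:E)%E.
Proof.
move=> s0; rewrite ge0_integral_normal_prob; last 2 first.
- by apply/measurable_EFinP; apply: measurableT_comp => //.
- by move=> x; rewrite lee_fin expR_ge0.
rewrite (eq_integral (fun x : measurableTypeR R => (expR (t * m + t ^+ 2 * s ^+ 2 / 2))%:E *
    (normal_pdf (m + t * s ^+ 2) s x)%:E)%E); last first.
  move=> x _; rewrite -!EFinM; congr EFin.
  rewrite !normal_pdfE // /normal_fun [RHS]mulrCA -[LHS]mulrA; congr (_ * _).
  by rewrite -[LHS]expRD -[RHS]expRD; congr expR; field.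
rewrite ge0_integralZl//.
- by rewrite integral_normal_pdf mule1.
- by apply/measurable_EFinP; exact: measurable_normal_pdf.
- by move=> x _; rewrite lee_fin normal_pdf_ge0.
Qed.

(** Against the standard normal density, [expR (3 / 8 * x ^+ 2)] is twice
    the density of the normal law of standard deviation 2. *)
Lemma standard_normal_exp_sqr :
  (\int[normal_prob (0 : R) 1]_x (expR (3 / 8 * x ^+ 2))%:E = 2%:E)%E.
Proof.
rewrite ge0_integral_normal_prob; last 2 first.
- apply/measurable_EFinP; apply: measurableT_comp => //.
  by apply: measurable_funM => //; exact: measurable_funX.
- by move=> x; rewrite lee_fin expR_ge0.
rewrite (eq_integral
    (fun x : measurableTypeR R => 2%:E * (normal_pdf (0 : R) 2 x)%:E)%E); last first.
  move=> x _; rewrite -!EFinM; congr EFin.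
  rewrite !normal_pdfE ?oner_eq0 // /normal_fun.
  have -> : @normal_peak R 1 = 2 * normal_peak 2.
    rewrite /normal_peak expr1n mul1r expr2 -mulrA -mulrnAr sqrtrM //.
    rewrite -mulrnAr sqrtrM // mulrA -expr2 sqr_sqrtr // invfM mulrA.
    by rewrite divff // mul1r.
  rewrite -!mulrA; congr (_ * (_ * _)).
  by rewrite -[LHS]expRD; congr expR; field.
rewrite ge0_integralZl//.
- by rewrite integral_normal_pdf mule1.
- by apply/measurable_EFinP; exact: measurable_normal_pdf.
- by move=> x _; rewrite lee_fin normal_pdf_ge0.
Qed.

End gaussian_mgf.

(** * Moments from the moment generating function *)

Section exponential_moments.
Context d (T : measurableType d) (R : realType) (P : probability T R).
Implicit Types (X f g : T -> R).

Definition Rintegrable f := P.-integrable setT (EFin \o f).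

Lemma RintegrableD f g :
  Rintegrable f -> Rintegrable g -> Rintegrable (fun w => f w + g w).
Proof. by move=> fi gi; apply: (integrableD _ fi gi). Qed.

Lemma RintegrableZ c f : Rintegrable f -> Rintegrable (fun w => c * f w).
Proof. by move=> fi; apply: (integrableZl _ c fi). Qed.

Lemma Rintegrable_le f g : measurable_fun setT f ->
  (forall w, `|f w| <= g w) -> Rintegrable g -> Rintegrable f.
Proof.
move=> mf fg; apply: le_integrable => //; first exact/measurable_EFinP.
move=> w _; rewrite /= lee_fin (le_trans (fg w)) //.
exact: ler_norm.
Qed.

Lemma le_RintegralT f g : Rintegrable f -> Rintegrable g ->
  (forall w, f w <= g w) -> \int[P]_w f w <= \int[P]_w g w.
Proof. by move=> fi gi fg; apply: le_Rintegral. Qed.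

Lemma Rintegrable_cst c : Rintegrable (fun=> c).
Proof. exact: finite_measure_integrable_cst. Qed.

Lemma Rintegral_cstT c : \int[P]_w c = c.
Proof. by rewrite Rintegral_cst //; have /= -> := @probability_setT _ _ _ P; rewrite mulr1. Qed.

Lemma Rintegrable_of_fin f : measurable_fun setT f -> (forall w, 0 <= f w) ->
  (\int[P]_w (f w)%:E < +oo)%E -> Rintegrable f.
Proof.
move=> mf f0 foo; apply/integrableP; split; first exact/measurable_EFinP.
rewrite (eq_integral (fun w => (f w)%:E)) // => w _ /=.
by rewrite ger0_norm.
Qed.

Variables (X : T -> R) (v : R).
Hypothesis mX : measurable_fun setT X.
Hypothesis mgfX : forall t,
  (\int[P]_w (expR (t * X w))%:E = (expR (t ^+ 2 * v / 2))%:E)%E.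

Let mexp a : measurable_fun setT (fun w => expR (a * X w)).
Proof.
by apply: measurableT_comp => //; apply: measurable_funM.
Qed.

Let mnorm : measurable_fun setT (fun w => `|X w|).
Proof. exact: measurableT_comp. Qed.

Lemma mgf_Rintegrable t : Rintegrable (fun w => expR (t * X w)).
Proof.
by apply: Rintegrable_of_fin => //; rewrite mgfX ltry.
Qed.

Lemma mgf_Rintegral t : \int[P]_w expR (t * X w) = expR (t ^+ 2 * v / 2).
Proof. by rewrite /Rintegral mgfX. Qed.

Lemma expR_norm_le (y : R) : expR `|y| <= expR y + expR (- y).
Proof.
by case: (ger0P y) => y0; rewrite ?lerDl ?lerDr expR_ge0.
Qed.

(** A power is bounded by a factorial times an exponential, and the
    exponential of an absolute value by the sum of two exponentials. *)
Lemma norm_pow_expR_Rintegrable k a : 0 <= a ->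
  Rintegrable (fun w => `|X w| ^+ k * expR (a * `|X w|)).
Proof.
move=> a0.
have e1 b : 0 <= b -> Rintegrable (fun w => expR (b * `|X w|)).
  move=> b0; apply: (@Rintegrable_le _ (fun w => expR (b * X w) + expR ((- b) * X w))).
  - by apply: measurableT_comp => //; apply: measurable_funM.
  - move=> w; rewrite ger0_norm ?expR_ge0 // mulNr.
    by have := expR_norm_le (b * X w); rewrite normrM (ger0_norm b0).
  - by apply: RintegrableD; exact: mgf_Rintegrable.
apply: (@Rintegrable_le _ (fun w => k`!%:R * expR ((1 + a) * `|X w|))).
- apply: measurable_funM; first exact: measurable_funX.
  by apply: measurableT_comp => //; apply: measurable_funM.
- move=> w; rewrite ger0_norm ?mulr_ge0 ?exprn_ge0 ?expR_ge0 //.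
  rewrite mulrDl mul1r expRD mulrA ler_pM2r ?expR_gt0 //.
  case: k => [|k]; first by rewrite expr0 fact0 mul1r -expR0 ler_expR.
  have := @expR_ge1Dxn R `|X w| k (normr_ge0 _).
  move=> /(le_trans _) -/(_ (`|X w| ^+ k.+1 / k.+1`!%:R)); rewrite lerDr ler01.
  by move=> /(_ isT); rewrite ler_pdivrMr ?ltr0n ?fact_gt0 // mulrC.
by apply: RintegrableZ; apply: e1; rewrite addr_ge0.
Qed.

Lemma norm_pow_Rintegrable k : Rintegrable (fun w => `|X w| ^+ k).
Proof.
have := @norm_pow_expR_Rintegrable k 0 (lexx _).
by congr Rintegrable; apply/funext => w; rewrite mul0r expR0 mulr1.
Qed.

Lemma mgf_Rintegrable1 : Rintegrable X.
Proof.
apply: Rintegrable_le (norm_pow_Rintegrable 1) => // w; exact: lexx.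
Qed.

Lemma mgf_Rintegrable2 : Rintegrable (fun w => X w ^+ 2).
Proof.
have := norm_pow_Rintegrable 2.
by congr Rintegrable; apply/funext => w; rewrite real_normK ?num_real.
Qed.

(** Inequalities between moments are obtained up to a factor [t], and this is
    how [t] tends to 0. *)
Lemma le0_small (a c : R) : (forall t, 0 < t -> t <= 1 -> a <= t * c) -> a <= 0.
Proof.
move=> h; rewrite leNgt; apply/negP => a0.
have c0 : 0 < c by have := h 1 ltr01 (lexx _); rewrite mul1r; exact: lt_le_trans.
have /h : 0 < Num.min 1 (a / (2 * c)) by rewrite lt_min ltr01 divr_gt0 // mulr_gt0.
rewrite ge_min lexx => /(_ isT); apply/negP; rewrite -ltNge.
apply: (@le_lt_trans _ _ (a / (2 * c) * c)).
  by rewrite ler_pM2r // ge_min lexx orbT.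
have -> : a / (2 * c) * c = a / 2 by field; rewrite gt_eqF.
by rewrite ltr_pdivrMr // ltr_pMr // ltr1n.
Qed.

Lemma expRB1_le (z : R) : expR z - 1 <= z * expR z.
Proof.
have := expR_ge1Dx (- z); rewrite expRN => h.
have e0 := expR_gt0 z; move: h; rewrite -(ler_pM2r e0) mulVf ?gt_eqF //.
by move=> h; lra.
Qed.

Lemma expR_sqr_le (t a : R) : 0 < t -> t <= 1 ->
  expR (t ^+ 2 * a / 2) - 1 <= t ^+ 2 * (`|a / 2| * expR `|a / 2|).
Proof.
move=> t0 t1; rewrite -[t ^+ 2 * a / 2]mulrA; move: (a / 2) => b.
apply: le_trans (expRB1_le _) _; rewrite -mulrA ler_pM2l ?exprn_gt0 //.
have tt : t ^+ 2 <= 1 by rewrite exprn_ile1 // ltW.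
apply: (@le_trans _ _ (`|b| * expR (t ^+ 2 * b))).
  by rewrite ler_wpM2r ?expR_ge0 // ler_norm.
rewrite ler_wpM2l // ler_expR; apply: (@le_trans _ _ (t ^+ 2 * `|b|)).
  by rewrite ler_wpM2l ?sqr_ge0 // ler_norm.
by rewrite ler_piMl.
Qed.

(** From [t * x <= expR (t * x) - 1], the mean times [t] is at most a multiple
    of [t ^+ 2] for both signs of [t]. *)
Lemma mgf_mean : \int[P]_w X w = 0.
Proof.
have i1 := mgf_Rintegrable1.
have key t : t * \int[P]_w X w <= expR (t ^+ 2 * v / 2) - 1.
  rewrite -mgf_Rintegral -RintegralZl // lerBrDl -[X in X + _]Rintegral_cstT.
  rewrite -RintegralD //; last 2 first.
  - exact: Rintegrable_cst.
  - exact: RintegrableZ.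
  apply: le_RintegralT.
  - by apply: RintegrableD; [exact: Rintegrable_cst|exact: RintegrableZ].
  - exact: mgf_Rintegrable.
  by move=> w; exact: expR_ge1Dx.
pose c := `|v / 2| * expR `|v / 2|.
have bnd t : 0 < t -> t <= 1 -> expR (t ^+ 2 * v / 2) - 1 <= t ^+ 2 * c.
  exact: expR_sqr_le.
apply/eqP; rewrite eq_le; apply/andP; split; last rewrite -oppr_le0.
- apply: (@le0_small _ c) => t t0 t1; rewrite -(ler_pM2l t0) mulrA -expr2.
  exact: le_trans (key t) (bnd t t0 t1).
- apply: (@le0_small _ c) => t t0 t1; rewrite -(ler_pM2l t0) mulrA -expr2.
  have := key (- t); rewrite mulNr -mulrN sqrrN => /le_trans; apply.
  exact: bnd.
Qed.

(** [expR y + expR (- y) - 2] is [expR (- `|y|) * (expR `|y| - 1) ^+ 2], hence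
    lies between [y ^+ 2 * expR (- `|y|)] and [y ^+ 2 * expR `|y|]. *)
Lemma expR_second_difference (y : R) :
  y ^+ 2 * (1 - `|y|) <= expR y + expR (- y) - 2 <= y ^+ 2 * (1 + `|y| * expR `|y|).
Proof.
have -> : expR y + expR (- y) = expR `|y| + expR (- `|y|).
  by case: (ger0P y) => //; rewrite opprK addrC.
rewrite -(real_normK (num_real y)); move: `|y| (normr_ge0 y) => z z0.
have ez := expR_gt0 z.
have E : expR z + expR (- z) - 2 = expR (- z) * (expR z - 1) ^+ 2.
  by rewrite expRN; field; rewrite gt_eqF.
have E' : expR z + expR (- z) - 2 = expR z * (1 - expR (- z)) ^+ 2.
  by rewrite expRN; field; rewrite gt_eqF.
have h1 := expR_ge1Dx z; have h2 := expR_ge1Dx (- z); have h3 := expRB1_le z.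
apply/andP; split.
  rewrite E; apply: (@le_trans _ _ (z ^+ 2 * expR (- z))).
    by rewrite ler_wpM2l ?sqr_ge0.
  rewrite mulrC ler_wpM2l ?expR_ge0 // lerXn2r ?nnegrE //.
    by rewrite subr_ge0 -expR0 ler_expR.
  by rewrite lerBrDl.
rewrite E'; apply: (@le_trans _ _ (expR z * z ^+ 2)).
  rewrite ler_wpM2l ?expR_ge0 // lerXn2r ?nnegrE //.
    by rewrite subr_ge0 -[leRHS]expR0 ler_expR oppr_le0.
  by rewrite lerBlDr addrC -lerBlDr.
rewrite mulrC ler_wpM2l ?sqr_ge0 //.
by rewrite -lerBlDl.
Qed.

Hypothesis v0 : 0 <= v.

(** The second difference at 0 of the moment generating function, divided by
    [t ^+ 2], is within [O(t)] of the second moment on one side, and of [v] on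
    the other. *)
Lemma mgf_variance : \int[P]_w (X w ^+ 2) = v.
Proof.
have i2 := mgf_Rintegrable2.
set V := \int[P]_w (X w ^+ 2).
pose K3 := \int[P]_w (`|X w| ^+ 3 * expR (0 * `|X w|)).
pose K := \int[P]_w (`|X w| ^+ 3 * expR (1 * `|X w|)).
have iK3 := @norm_pow_expR_Rintegrable 3 0 (lexx _).
have iK := @norm_pow_expR_Rintegrable 3 1 ler01.
pose c := `|v / 2| * expR `|v / 2|.
have iD t : Rintegrable (fun w => expR (t * X w) + expR ((- t) * X w) + (- 2)).
  apply: RintegrableD; last exact: Rintegrable_cst.
  by apply: RintegrableD; exact: mgf_Rintegrable.
have ED t : \int[P]_w (expR (t * X w) + expR ((- t) * X w) + (- 2)) =
    2 * (expR (t ^+ 2 * v / 2) - 1).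
  rewrite RintegralD //; last 2 first.
  - by apply: RintegrableD; exact: mgf_Rintegrable.
  - exact: Rintegrable_cst.
  rewrite RintegralD ?mgf_Rintegral ?Rintegral_cstT ?sqrrN //.
  - by ring.
  - exact: mgf_Rintegrable.
  - exact: mgf_Rintegrable.
have low t : 0 < t -> t <= 1 ->
    t ^+ 2 * (V - t * K3) <= 2 * (expR (t ^+ 2 * v / 2) - 1).
  move=> t0 t1; rewrite -ED.
  have -> : t ^+ 2 * (V - t * K3) = \int[P]_w (t ^+ 2 * X w ^+ 2 +
      (- t ^+ 3) * (`|X w| ^+ 3 * expR (0 * `|X w|))).
    rewrite RintegralD ?RintegralZl //; first by rewrite /V /K3; ring.
    - exact: RintegrableZ.
    - exact: RintegrableZ.
  apply: le_RintegralT => // [|w].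
    by apply: RintegrableD; exact: RintegrableZ.
  have /andP[h _] := expR_second_difference (t * X w).
  rewrite !mulNr; apply: le_trans h.
  rewrite mul0r expR0 normrM (gtr0_norm t0) exprMn.
  by rewrite -(real_normK (num_real (X w))) le_eqVlt; apply/orP; left; apply/eqP; ring.
have up t : 0 < t -> t <= 1 ->
    2 * (expR (t ^+ 2 * v / 2) - 1) <= t ^+ 2 * (V + t * K).
  move=> t0 t1; rewrite -ED.
  have -> : t ^+ 2 * (V + t * K) = \int[P]_w (t ^+ 2 * X w ^+ 2 +
      t ^+ 3 * (`|X w| ^+ 3 * expR (1 * `|X w|))).
    rewrite RintegralD ?RintegralZl //; first by rewrite /V /K; ring.
    - exact: RintegrableZ.
    - exact: RintegrableZ.
  apply: le_RintegralT => // [|w].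
    by apply: RintegrableD; exact: RintegrableZ.
  have /andP[_] := expR_second_difference (t * X w).
  rewrite mulNr => /le_trans; apply.
  rewrite mul1r normrM (gtr0_norm t0) exprMn.
  rewrite -(real_normK (num_real (X w))); move: `|X w| (normr_ge0 (X w)) => x x0.
  apply: (@le_trans _ _ (t ^+ 2 * x ^+ 2 * (1 + t * x * expR x))).
    have tx2 : 0 <= t ^+ 2 * x ^+ 2 by rewrite mulr_ge0 // sqr_ge0.
    have tx : 0 <= t * x by rewrite mulr_ge0 // ltW.
    apply: (ler_wpM2l tx2); rewrite lerD2l; apply: (ler_wpM2l tx).
    by rewrite ler_expR ler_piMl.
  by rewrite le_eqVlt; apply/orP; left; apply/eqP; ring.
have vlow t : t ^+ 2 * v <= 2 * (expR (t ^+ 2 * v / 2) - 1).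
  by have := expR_ge1Dx (t ^+ 2 * v / 2); lra.
have vup t : 0 < t -> t <= 1 ->
    2 * (expR (t ^+ 2 * v / 2) - 1) <= t ^+ 2 * (v + t * (v * c)).
  move=> t0 t1; have b := @expR_sqr_le t v t0 t1.
  have := expRB1_le (t ^+ 2 * v / 2); rewrite -/c in b.
  have z0 : 0 <= t ^+ 2 * v / 2 by rewrite divr_ge0 // mulr_ge0 // sqr_ge0.
  have tt : t ^+ 2 <= t by rewrite expr2 ler_piMl // ltW.
  have c0 : 0 <= c by rewrite mulr_ge0 ?expR_ge0.
  have b' : expR (t ^+ 2 * v / 2) - 1 <= t * c.
    by apply: (le_trans b); rewrite ler_wpM2r.
  have := ler_wpM2l z0 b'.
  move: (expR _) => e h1 h2; have : e - 1 <= t ^+ 2 * v / 2 + t ^+ 2 * v / 2 * (t * c).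
    by lra.
  move=> h3; have -> : t ^+ 2 * (v + t * (v * c)) =
    2 * (t ^+ 2 * v / 2 + t ^+ 2 * v / 2 * (t * c)) by field.
  by rewrite ler_pM2l.
apply/eqP; rewrite eq_le -subr_le0 -[v <= V]subr_le0; apply/andP; split.
- apply: (@le0_small _ (K3 + v * c)) => t t0 t1.
  have t2 : 0 < t ^+ 2 by rewrite exprn_gt0.
  have := le_trans (low t t0 t1) (vup t t0 t1); rewrite ler_pM2l //; lra.
- apply: (@le0_small _ K) => t t0 t1.
  have t2 : 0 < t ^+ 2 by rewrite exprn_gt0.
  have := le_trans (vlow t) (up t t0 t1); rewrite ler_pM2l //; lra.
Qed.

End exponential_moments.

(** * Exponential moments of Gaussian quadratic forms *)

Lemma markov_ge0 d (T : measurableType d) (R : realType) (P : probability T R)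
    (f : T -> R) (b c : R) : measurable_fun setT f -> (forall w, 0 <= f w) ->
  0 < c -> (\int[P]_w (f w)%:E <= b%:E)%E ->
  (P [set w | (c <= f w)%R] <= (b / c)%:E)%E.
Proof.
move=> mf f0 c0 fb.
set A := [set w | (c <= f w)%R].
have mA : measurable A.
  have -> : A = setT `&` f @^-1` `[c, +oo[%classic.
    by rewrite setTI; apply/seteqP; split=> x /=; rewrite in_itv /= andbT.
  exact: mf.
rewrite EFinM lee_pdivlMr //; apply: le_trans fb.
have -> : (P A * c%:E = \int[P]_w (c * \1_A w)%:E)%E.
  under eq_integral do rewrite EFinM.
  rewrite ge0_integralZl_EFin ?ltW // ?integral_indic ?setIT 1?muleC //.
  exact/measurable_EFinP/measurable_indic.
apply: ge0_le_integral => //.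
- by move=> w _; rewrite lee_fin mulr_ge0 // ltW.
- by apply/measurable_EFinP; apply: measurable_funM => //; exact: measurable_indic.
- exact/measurable_EFinP.
move=> w _; rewrite lee_fin indicE; case: (boolP (w \in A)) => [|_]; rewrite ?mulr0 ?mulr1 //.
by rewrite inE.
Qed.

Section gaussian_quadratic.
Context d (T : measurableType d) (R : realType) (P : probability T R) (n : nat).
Variables (e : T -> 'cV[R]_n) (S : 'M[R]_n).
Hypothesis me : forall i, measurable_fun setT (fun w => e w i 0).
Hypothesis symS : S^T = S.
Hypothesis mgf_e : forall u : 'cV[R]_n,
  (\int[P]_w (expR ((u^T *m e w) 0 0))%:E = (expR (qform S u / 2))%:E)%E.

Lemma measurable_lin (u : 'rV[R]_n) :
  measurable_fun setT (fun w => (u *m e w) 0 0).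
Proof.
under eq_fun do rewrite mxE.
by apply: measurable_sum => i; apply: measurable_funM.
Qed.

(** Gaussian linearisation: [expR (s * y ^+ 2)] is the mean of
    [expR (Num.sqrt (2 * s) * x * y)] over a standard normal [x], which turns
    the squares into linear terms one at a time. Distinct rows of [G] are
    uncorrelated under [S], so that the linear term of one row does not interact
    with those of the others, and each contributes the mean of
    [expR (s * dg 0 i * x ^+ 2)]; the bound [3 / 8] makes it at most 2. *)
Lemma gaussian_quadratic_mgf r (G : 'M[R]_(r, n)) (dg : 'rV[R]_r) (s : R) :
  G *m S *m G^T = diag_mx dg -> 0 <= s -> (forall i, s * dg 0 i <= 3 / 8) ->
  (\int[P]_w (expR (s * qform 1%:M (G *m e w)))%:E <= (2 ^+ r)%:E)%E.
Proof.
move=> GSG s0 sd.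
pose c := Num.sqrt (2 * s).
have cc : c ^+ 2 = 2 * s by rewrite sqr_sqrtr // mulr_ge0.
have mG i : measurable_fun setT (fun w => (G *m e w) i 0).
  under eq_fun do rewrite mxE.
  by apply: measurable_sum => j; apply: measurable_funM.
(* the vector u collects the linear terms due to the rows already treated *)
have key (js : seq 'I_r) (u : 'cV[R]_n) : uniq js ->
    (forall j, j \in js -> (G *m S *m u) j 0 = 0) ->
    (\int[P]_w (expR ((u^T *m e w) 0 0 + \sum_(j <- js) s * (G *m e w) j 0 ^+ 2))%:E
     <= (2 ^+ size js * expR (qform S u / 2))%:E)%E.
  elim: js u => [|i js IH] u.
    move=> _ _; under eq_integral do rewrite big_nil addr0.
    by rewrite mgf_e expr0 mul1r.
  move=> /= /andP[ijs ujs] Gu.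
  pose F (z : T * R) := expR ((u^T *m e z.1) 0 0 + \sum_(j <- js) s * (G *m e z.1) j 0 ^+ 2
     + c * (G *m e z.1) i 0 * z.2).
  have mF : measurable_fun setT F.
    apply: measurableT_comp => //; apply: measurable_funD.
      apply: measurable_funD.
        exact: (measurableT_comp (measurable_lin u^T) measurable_fst).
      apply: measurable_sum => j; apply: measurable_funM => //.
      apply: measurable_funX.
      exact: (measurableT_comp (mG j) measurable_fst).
    apply: measurable_funM => //; apply: measurable_funM => //.
    exact: (measurableT_comp (mG i) measurable_fst).
  pose N := normal_prob (0 : R) 1.
  have -> : (\int[P]_w (expR ((u^T *m e w) 0 0 +
      \sum_(j <- i :: js) s * (G *m e w) j 0 ^+ 2))%:E =
      \int[P]_w \int[N]_x (F (w, x))%:E)%E.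
    apply: eq_integral => w _; rewrite /F /=.
    under [RHS]eq_integral do rewrite expRD EFinM.
    rewrite ge0_integralZl //.
    - rewrite normal_prob_mgf ?oner_eq0 // -EFinM -expRD; congr (expR _)%:E.
      by rewrite big_cons mulr0 add0r expr1n mulr1 exprMn cc; field.
    - apply/measurable_EFinP; apply: measurableT_comp => //.
  rewrite (@fubini_tonelli _ _ _ _ _ P N (EFin \o F)) /=; last 2 first.
  - exact/measurable_EFinP.
  - by move=> z; rewrite lee_fin expR_ge0.
  pose g := (row i G)^T.
  have GSg j : (G *m S *m g) j 0 = dg 0 i * (i == j)%:R.
    have -> : G *m S *m g = col i (G *m S *m G^T).
      by apply/colP => l; rewrite /g tr_row !mxE; apply: eq_bigr => l' _; rewrite !mxE.
    by rewrite GSG !mxE eq_sym; case: eqP => [->|]; rewrite ?mulr1 ?mulr0.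
  have gSg : qform S g = dg 0 i.
    rewrite /qform trmxK -!row_mul mxE GSg eqxx mulr1 //.
  have uSg : (u^T *m S *m g) 0 0 = 0.
    have -> : u^T *m S *m g = (row i (G *m S *m u))^T.
      by rewrite -mulmxA row_mul trmx_mul row_mul trmx_mul symS mulmxA.
    by rewrite mxE mxE Gu // mem_head.
  pose ui x := u + (c * x) *: g.
  have qui x : qform S (ui x) / 2 = qform S u / 2 + s * dg 0 i * x ^+ 2.
    rewrite qformD // -scalemxAr mxE uSg mulr0 mulr0 addr0.
    have -> : qform S ((c * x) *: g) = (c * x) ^+ 2 * qform S g.
      rewrite /qform [((c * x) *: g)^T]linearZ /= -!scalemxAl -scalemxAr scalerA mxE //.
    by rewrite gSg exprMn cc; field.
  have ui_lin x w : ((ui x)^T *m e w) 0 0 =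
      (u^T *m e w) 0 0 + c * (G *m e w) i 0 * x.
    rewrite /ui [(u + _)^T]linearD /= linearZ /= trmxK mulmxDl -scalemxAl -row_mul.
    rewrite [(_ + _ : 'M[R]_1) 0 0]mxE; congr (_ + _); rewrite [LHS]mxE [X in _ * X]mxE.
    by ring.
  have mexp : measurable_fun setT (fun x : R => expR (3 / 8 * x ^+ 2)).
    by apply: measurableT_comp => //; apply: measurable_funM.
  apply: (@le_trans _ _ (\int[N]_x ((2 ^+ size js * expR (qform S u / 2))%:E
     * (expR (3 / 8 * x ^+ 2))%:E))%E).
    apply: ge0_le_integral => //.
    - by move=> x _; apply: integral_ge0 => w _; rewrite lee_fin expR_ge0.
    - apply: (@measurable_fun_fubini_tonelli_G _ _ _ _ _ P (EFin \o F)) => //.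
        exact/measurable_EFinP.
      by move=> z; rewrite lee_fin expR_ge0.
    - by apply: emeasurable_funM => //; exact/measurable_EFinP.
    move=> x _; apply: (@le_trans _ _ (2 ^+ size js * expR (qform S (ui x) / 2))%:E).
      under eq_integral do rewrite /F /= addrAC -ui_lin.
      apply: IH => // j jjs; rewrite /ui mulmxDr -scalemxAr mxE Gu; last first.
        by rewrite in_cons jjs orbT.
      rewrite mxE GSg; have [ij|_] := eqVneq i j; last by rewrite !mulr0 addr0.
      by rewrite ij jjs in ijs.
    rewrite -EFinM lee_fin -[leRHS]mulrA -expRD qui ler_wpM2l ?exprn_ge0 // ler_expR.
    by rewrite lerD2l ler_wpM2r // sqr_ge0.
  rewrite ge0_integralZl //.
  - by rewrite standard_normal_exp_sqr -EFinM lee_fin exprS; lra.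
  - exact/measurable_EFinP.
have := key (enum 'I_r) 0 (enum_uniq _).
have -> : qform S 0 = 0 by rewrite /qform mulmx0 mxE.
rewrite size_enum_ord mul0r expR0 mulr1 => /(_ _)/(le_trans _); apply; last first.
  by move=> j _; rewrite mulmx0 mxE.
rewrite le_eqVlt; apply/orP; left; apply/eqP; apply: eq_integral => w _.
congr (expR _)%:E; rewrite trmx0 mul0mx mxE add0r big_enum /= -/(qform _ _).
rewrite -diag_const_mx qform_diag mulr_sumr; apply: eq_bigr => j _.
by rewrite [const_mx _ _ _]mxE mul1r.
Qed.

End gaussian_quadratic.

(** * Independence *)

Section independence.
Context d (T : measurableType d) (R : realType) (P : probability T R).

Lemma ge0_integral_eq_law d2 (T2 : measurableType d2) (X : T -> T2)
    (nu : {measure set T2 -> \bar R}) (f : T2 -> \bar R) : measurable_fun setT X ->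
  (forall B, measurable B -> P (X @^-1` B) = nu B) ->
  measurable_fun setT f -> (forall x, 0 <= f x)%E ->
  (\int[P]_w f (X w) = \int[nu]_x f x)%E.
Proof.
move=> mX XB mf f0; rewrite -(@ge0_integral_weight _ _ _ _ _ P nu (fun=> 1) X) //.
  by apply: eq_integral => w _; rewrite mul1e.
move=> B mB; under eq_integral do rewrite mul1e.
rewrite -XB // (eq_integral (EFin \o \1_(X @^-1` B))) //.
rewrite integral_indic ?setIT // -[X @^-1` B]setTI; exact: mX.
Qed.

Lemma gaussian_mgf (X : T -> R) (m s t : R) : measurable_fun setT X ->
  gaussian P X m s ->
  (\int[P]_w (expR (t * X w))%:E = (expR (t * m + t ^+ 2 * s ^+ 2 / 2))%:E)%E.
Proof.
move=> mX gX.
have mf : measurable_fun setT (fun x : R => (expR (t * x))%:E).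
  by apply/measurable_EFinP; apply: measurableT_comp => //; exact: measurable_funM.
have f0 (x : R) : (0 <= (expR (t * x))%:E)%E by rewrite lee_fin expR_ge0.
have [s0|s0] := eqVneq s 0.
  rewrite (@ge0_integral_eq_law _ _ X (dirac m) (fun x => (expR (t * x))%:E)) //.
    by rewrite integral_dirac // diracT mul1e s0 expr0n mulr0 mul0r addr0.
  by move=> B mB; rewrite gX // s0 eqxx.
rewrite (@ge0_integral_eq_law _ (measurableTypeR R) X (normal_prob m s)
  (fun x => (expR (t * x))%:E)) //.
  exact: normal_prob_mgf.
by move=> B mB; rewrite gX // (negbTE s0).
Qed.

(** The law of [X] under the measure of density [w] is [c] times its law under
    [P]. *)
Lemma ge0_integral_indep (w : T -> R) (X : T -> R) (c : R) (f : R -> \bar R) :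
  (forall x, 0 <= w x) -> measurable_fun setT w -> measurable_fun setT X ->
  0 <= c ->
  (forall B, measurable B ->
    \int[P]_x (w x * \1_B (X x))%:E = c%:E * P (X @^-1` B))%E ->
  measurable_fun setT f -> (forall x, 0 <= f x)%E ->
  (\int[P]_x ((w x)%:E * f (X x)) = c%:E * \int[P]_x f (X x))%E.
Proof.
move=> w0 mw mX c0 wX mf f0.
pose X' : {mfun T >-> R} := HB.pack X (@isMeasurableFun.Build _ _ _ _ X mX).
pose nu := mscale (NngNum c0) (distribution P X').
rewrite (@ge0_integral_weight _ _ _ _ _ P nu w X) //.
rewrite ge0_integral_mscale //; congr (_ * _)%E.
by rewrite -(@ge0_integral_eq_law _ _ X).
Qed.

Lemma indep_expectationM (X Y : T -> R) :
  measurable_fun setT X -> measurable_fun setT Y ->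
  (forall w, 0 <= X w) -> (forall w, 0 <= Y w) ->
  (\int[P]_w (X w)%:E < +oo)%E ->
  (forall B C, measurable B -> measurable C ->
     P (X @^-1` B `&` Y @^-1` C) = P (X @^-1` B) * P (Y @^-1` C))%E ->
  (\int[P]_w (X w * Y w)%:E = (\int[P]_w (X w)%:E) * \int[P]_w (Y w)%:E)%E.
Proof.
move=> mX mY X0 Y0 Xoo ind.
have mXB B : measurable B -> measurable (X @^-1` B).
  by move=> mB; rewrite -[X @^-1` B]setTI; exact: mX.
have mYB B : measurable B -> measurable (Y @^-1` B).
  by move=> mB; rewrite -[Y @^-1` B]setTI; exact: mY.
have Xfin : (\int[P]_w (X w)%:E)%E \is a fin_num.
  by rewrite ge0_fin_numE // integral_ge0 // => w _; rewrite lee_fin.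
have stepX C : measurable C ->
    (\int[P]_w (X w * \1_C (Y w))%:E = (\int[P]_w (X w)%:E) * P (Y @^-1` C))%E.
  move=> mC.
  have mIC : measurable_fun setT (fun w => \1_C (Y w) : R).
    by apply: measurableT_comp => //; exact: measurable_indic.
  have PC : P (Y @^-1` C) \is a fin_num by apply: fin_num_measure; exact: mYB.
  under [LHS]eq_integral => w _.
    rewrite mulrC EFinM -[X w](ger0_norm (X0 w)); over.
  rewrite (@ge0_integral_indep _ X (fine (P (Y @^-1` C))) (fun x => (`|x|)%:E)) //.
  - by rewrite fineK // muleC; congr (_ * _)%E; apply: eq_integral => w _; rewrite ger0_norm.
  - by rewrite fine_ge0.
  - move=> B mB; rewrite fineK // muleC -ind //.
    under eq_integral => w _.
      rewrite mulrC (_ : _ * _ = \1_(X @^-1` B `&` Y @^-1` C) w); last first.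
        by rewrite indicI.
      over.
    rewrite integral_indic ?setIT //; apply: measurableI; [exact: mXB|exact: mYB].
  - by apply/measurable_EFinP; exact: normr_measurable.
under [LHS]eq_integral => w _ do rewrite EFinM -[Y w](ger0_norm (Y0 w)).
rewrite (@ge0_integral_indep X Y (fine (\int[P]_w (X w)%:E)%E) (fun x => (`|x|)%:E)) //.
- by rewrite fineK //; congr (_ * _)%E; apply: eq_integral => w _; rewrite ger0_norm.
- by rewrite fine_ge0 // integral_ge0 // => w _; rewrite lee_fin.
- by move=> C mC; rewrite fineK // stepX.
- by apply/measurable_EFinP; exact: normr_measurable.
Qed.

(** Independence is the case where every factor is an indicator; the
    indicators are replaced by the functions [f i] one at a time, each time by
    [ge0_integral_indep] with the product of the other factors as weight. *)
Lemma mutual_indep_expectation n (X : 'I_n -> T -> R) (f : 'I_n -> R -> R)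
    (c : 'I_n -> R) :
  mutually_independent P X -> (forall i, measurable_fun setT (X i)) ->
  (forall i, measurable_fun setT (f i)) -> (forall i x, 0 <= f i x) ->
  (forall i, (\int[P]_w (f i (X i w))%:E)%E = (c i)%:E) ->
  (\int[P]_w (\prod_i f i (X i w))%:E = (\prod_i c i)%:E)%E.
Proof.
move=> ind mX mf f0 fc.
have c0 i : 0 <= c i.
  by rewrite -lee_fin -fc integral_ge0 // => w _; rewrite lee_fin.
have mXB i B : measurable B -> measurable (X i @^-1` B).
  by move=> mB; rewrite -[X i @^-1` B]setTI; exact: mX.
have PB i B : measurable B -> P (X i @^-1` B) \is a fin_num.
  by move=> mB; apply: fin_num_measure; exact: mXB.
(* the first k factors are the f i, the others indicators *)
pose F k (B : 'I_n -> set R) (i : 'I_n) (x : R) := if (i < k)%N then f i x else \1_(B i) x.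
pose C k (B : 'I_n -> set R) (i : 'I_n) :=
  if (i < k)%N then c i else fine (P (X i @^-1` B i)).
have mF k B i : (forall i, measurable (B i)) -> measurable_fun setT (fun w => F k B i (X i w)).
  move=> mB; apply: measurableT_comp => //; rewrite /F; case: (i < k)%N => //.
  exact: measurable_indic.
have F0 k B i x : 0 <= F k B i x by rewrite /F; case: (i < k)%N.
have C0 k B i : 0 <= C k B i by rewrite /C; case: (i < k)%N => //; rewrite fine_ge0.
have key k : (k <= n)%N -> forall B, (forall i, measurable (B i)) ->
    (\int[P]_w (\prod_i F k B i (X i w))%:E = (\prod_i C k B i)%:E)%E.
  elim: k => [|k IH] kn B mB.
    have -> : (\prod_i C 0 B i)%:E = P [set w | forall i, B i (X i w)].
      rewrite ind // /C -prodEFin; apply: eq_bigr => i _; by rewrite fineK // PB.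
    rewrite -(setIT [set w | _]) -integral_indic //.
      apply: eq_integral => w _; congr EFin; rewrite indicE.
      have [/= wB|wB] := boolP (w \in [set w | forall i, B i (X i w)]).
        by rewrite inE in wB; rewrite big1 // => i _; rewrite /F /= indicE mem_set.
      rewrite notin_setE /= -existsNE in wB; case: wB => i wBi.
      by rewrite (bigD1 i) //= /F /= indicE memNset // mul0r.
    have -> : [set w | forall i, B i (X i w)] = \bigcap_(i in [set: 'I_n]) X i @^-1` B i.
      by apply/seteqP; split => [w h i _|w h i]; [exact: h|exact: (h i)].
    by apply: fin_bigcap_measurable => // i _; exact: mXB.
  pose i0 := Ordinal kn.
  pose w_ w := \prod_(i | i != i0) F k B i (X i w).
  pose cc := \prod_(i | i != i0) C k B i.
  have FE i x : i != i0 -> F k.+1 B i x = F k B i x.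
    move=> ii0; rewrite /F ltnS leq_eqVlt; case: eqP => //= ik.
    by case/eqP: ii0; apply: val_inj.
  have CE i : i != i0 -> C k.+1 B i = C k B i.
    move=> ii0; rewrite /C ltnS leq_eqVlt; case: eqP => //= ik.
    by case/eqP: ii0; apply: val_inj.
  have -> : \prod_i C k.+1 B i = cc * c i0.
    rewrite (bigD1 i0) //= mulrC {2}/C ltnS leqnn; congr (_ * _).
    by apply: eq_bigr => i; exact: CE.
  under eq_integral => w _.
    rewrite (bigD1 i0) //= mulrC {2}/F ltnS leqnn (eq_bigr (fun i => F k B i (X i w))); last first.
      by move=> i; exact: FE.
    rewrite EFinM; over.
  rewrite (@ge0_integral_indep w_ (X i0) cc (EFin \o f i0)) //=.
  - by rewrite fc.
  - by move=> w; rewrite prodr_ge0.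
  - rewrite /w_; under eq_fun do rewrite big_mkcond.
    by apply: measurable_prod => i _; case: (i != i0) => //; exact: mF.
  - by rewrite prodr_ge0.
  move=> B0 mB0; pose B' i := if i == i0 then B0 else B i.
  have mB' i : measurable (B' i) by rewrite /B'; case: ifP.
  have := IH (ltnW kn) B' mB'.
  under eq_integral => w _.
    rewrite (bigD1 i0) //= {1}/F /= ltnn mulrC {2}/B' eqxx
      (eq_bigr (fun i => F k B i (X i w))); last first.
      by move=> i /negbTE ii0; rewrite /F /B' ii0.
    over.
  move=> ->; rewrite (bigD1 i0) //= {1}/C /= ltnn {1}/B' eqxx mulrC EFinM fineK ?PB //.
    by congr (_%:E * _)%E; apply: eq_bigr => i /negbTE ii0; rewrite /C /B' ii0.
    exact/measurable_EFinP.
  by move=> x; rewrite lee_fin.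
have := key n (leqnn n) (fun=> setT) (fun=> measurableT).
under eq_integral do (under eq_bigr do rewrite /F ltn_ord).
by move=> ->; congr EFin; apply: eq_bigr => i _; rewrite /C ltn_ord.
Qed.

End independence.

(** * Law of the observation errors *)

Section gaussian_moments.
Context d (T : measurableType d) (R : realType) (P : probability T R).

Lemma gaussian_mean (X : T -> R) (m s : R) : measurable_fun setT X ->
  gaussian P X m s -> Rintegrable P X /\ \int[P]_w X w = m.
Proof.
move=> mX gX; pose Y w := X w - m.
have mY : measurable_fun setT Y by apply: measurable_funB.
have mgfY t : (\int[P]_w (expR (t * Y w))%:E = (expR (t ^+ 2 * s ^+ 2 / 2))%:E)%E.
  under eq_integral => w _ do rewrite mulrBr expRD mulrC EFinM.
  rewrite ge0_integralZl_EFin //.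
  - by rewrite (gaussian_mgf _ mX gX) -EFinM -expRD; congr (expR _)%:E; ring.
  - by apply/measurable_EFinP; apply: measurableT_comp => //; exact: measurable_funM.
have iY := mgf_Rintegrable1 mY mgfY.
have XE : X = fun w => Y w + m by apply/funext => w; rewrite subrK.
split; first by rewrite XE; apply: RintegrableD => //; exact: Rintegrable_cst.
rewrite XE RintegralD //; last exact: Rintegrable_cst.
by rewrite (mgf_mean mY mgfY) Rintegral_cstT add0r.
Qed.

Lemma Rintegral_sumr (I : Type) (r : seq I) (f : I -> T -> R) :
  (forall i, Rintegrable P (f i)) ->
  Rintegrable P (fun w => \sum_(i <- r) f i w) /\
  \int[P]_w (\sum_(i <- r) f i w) = \sum_(i <- r) \int[P]_w f i w.
Proof.
move=> fi; elim: r => [|i r [IH1 IH2]].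
  under eq_fun do rewrite big_nil; split; first exact: Rintegrable_cst.
  by rewrite Rintegral_cstT big_nil.
under eq_fun do rewrite big_cons; split; first exact: RintegrableD.
by rewrite (RintegralD measurableT (fi i) IH1) IH2 big_cons.
Qed.

Lemma sigma_of_lin (I : Type) (D : set I) (X : I -> T -> R) n (t : 'I_n -> I)
    (c : 'I_n -> R) (f : R -> R) (B : set R) :
  (forall i, D (t i)) -> measurable_fun setT f -> measurable B ->
  sigma_of D X ((fun w => f (\sum_i c i * X (t i) w)) @^-1` B).
Proof.
move=> Dt mf mB; rewrite /sigma_of.
set G := [set A | _].
have mX i : @measurable_fun _ _ (g_sigma_algebraType G) R setT (X (t i)).
  move=> _ C mC; rewrite setTI; apply: sub_sigma_algebra.
  by exists (t i), C; split.
have mg : @measurable_fun _ _ (g_sigma_algebraType G) R setT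
    (fun w => f (\sum_i c i * X (t i) w)).
  apply: measurableT_comp => //; apply: measurable_sum => i.
  exact: measurable_funM.
by have := mg measurableT B mB; rewrite setTI.
Qed.

End gaussian_moments.

Section model.
Context {disp : measure_display} {T : measurableType disp} {R : realType}.
Variables (P : probability T R) (d k n : nat) (M : georeg P d k n).
Variable (Theta : set 'rV[R]_k).
Hypothesis ax : georeg_axioms M Theta.
Local Notation e := (errvec M).

Let He i w : (e w) i 0 = Defs.eta M (site M i) w + eps M i w.
Proof. by rewrite mxE. Qed.

Lemma measurable_err i : measurable_fun setT (fun w => (e w) i 0).
Proof. by under eq_fun do rewrite He; apply: measurable_funD. Qed.

Let linE (c : 'cV[R]_n) w : (c^T *m e w) 0 0 =
  \sum_i c i 0 * Defs.eta M (site M i) w + \sum_i c i 0 * eps M i w.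
Proof.
rewrite mxE -big_split /=; apply: eq_bigr => i _.
by rewrite [_^T _ _]mxE He mulrDr.
Qed.

(** The contributions of the process and of the noise are centered Gaussian and
    independent, so their exponential moments multiply. The variance is identified only
    afterwards, by [err_lin_variance], once second moments are known to be
    finite. *)
Lemma err_lin_mgf (c : 'cV[R]_n) : exists2 v, 0 <= v & forall t,
  (\int[P]_w (expR (t * (c^T *m e w) 0 0))%:E = (expR (t ^+ 2 * v / 2))%:E)%E.
Proof.
pose A w := \sum_i c i 0 * Defs.eta M (site M i) w.
pose B w := \sum_i c i 0 * eps M i w.
have mA : measurable_fun setT A.
  by apply: measurable_sum => i; apply: measurable_funM.
have mB : measurable_fun setT B.
  by apply: measurable_sum => i; apply: measurable_funM.
have mexp (X : T -> R) t : measurable_fun setT X ->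
    measurable_fun setT (fun w => expR (t * X w)).
  by move=> mX; apply: measurableT_comp => //; exact: measurable_funM.
have eta0 i : Rintegrable P (Defs.eta M (site M i)) /\ \int[P]_w (Defs.eta M (site M i) w) = 0.
  have [mu [s g1]] := eta_gaussian ax (t := fun _ : 'I_1 => site M i) (fun _ => 1)
    (fun _ => site_region ax i).
  have gi : gaussian P (Defs.eta M (site M i)) mu s.
    rewrite (_ : (Defs.eta M (site M i) : T -> R) =
      fun w => \sum_(j < 1) 1 * Defs.eta M (site M i) w) //.
    by apply/funext => w; rewrite big_ord1 mul1r.
  have [ii mi] := gaussian_mean (@measurable_funPT _ _ _ _ _) gi; split=> //.
  by have := eta_centered ax (site_region ax i); rewrite unlock /Rintegral => ->.
have [mu [s gA]] := eta_gaussian ax (t := site M) (fun i => c i 0) (site_region ax).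
have mu0 : mu = 0.
  have [_ <-] := gaussian_mean mA gA.
  have [_ ->] := @Rintegral_sumr _ _ _ P _ (index_enum 'I_n)
    (fun i w => c i 0 * Defs.eta M (site M i) w) (fun i => RintegrableZ (c i 0) (eta0 i).1).
  by rewrite big1 // => i _; rewrite RintegralZl ?(eta0 i).2 ?mulr0 //; exact: (eta0 i).1.
exists (s ^+ 2 + noise_sd M ^+ 2 * \sum_i c i 0 ^+ 2).
  by rewrite addr_ge0 ?sqr_ge0 // mulr_ge0 ?sqr_ge0 // sumr_ge0 // => i _; exact: sqr_ge0.
move=> t.
have EA : (\int[P]_w (expR (t * A w))%:E = (expR (t ^+ 2 * s ^+ 2 / 2))%:E)%E.
  by rewrite (gaussian_mgf _ mA gA) mu0 mulr0 add0r.
have EB : (\int[P]_w (expR (t * B w))%:E =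
    (expR (t ^+ 2 * (noise_sd M ^+ 2 * \sum_i c i 0 ^+ 2) / 2))%:E)%E.
  under eq_integral => w _ do rewrite /B mulr_sumr expR_sum.
  rewrite (@mutual_indep_expectation _ _ _ P n (fun i => eps M i)
    (fun i x => expR (t * (c i 0 * x)))
    (fun i => expR ((t * c i 0) ^+ 2 * noise_sd M ^+ 2 / 2))).
  - rewrite -expR_sum; congr (expR _)%:E.
    rewrite mulr_sumr mulr_sumr mulr_suml; apply: eq_bigr => i _; ring.
  - exact: eps_indep ax.
  - by [].
  - by move=> i; apply: measurableT_comp => //; do 2 apply: measurable_funM => //.
  - by move=> i x; exact: expR_ge0.
  - move=> i; under eq_integral do rewrite mulrA.
    by rewrite (gaussian_mgf _ _ (eps_gaussian ax i)) // mulr0 add0r.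
under eq_integral => w _ do rewrite linE mulrDr expRD.
rewrite (@indep_expectationM _ _ _ P (fun w => expR (t * A w)) (fun w => expR (t * B w))).
- by rewrite EA EB -EFinM -expRD; congr (expR _)%:E; field.
- exact: mexp.
- exact: mexp.
- by move=> w; exact: expR_ge0.
- by move=> w; exact: expR_ge0.
- by rewrite EA ltry.
move=> C D mC mD; apply: (eps_eta_indep ax).
  apply: (@sigma_of_lin _ _ _ _ _ _ n (site M) (fun i => c i 0) (fun x => expR (t * x))) => //.
    exact: site_region ax.
  by apply: measurableT_comp => //; exact: measurable_funM.
apply: (@sigma_of_lin _ _ _ 'I_n setT _ n id (fun i => c i 0) (fun x => expR (t * x))) => //.
by apply: measurableT_comp => //; exact: measurable_funM.
Qed.

Let e_lin i w : (e w) i 0 = ((delta_mx i 0 : 'cV[R]_n)^T *m e w) 0 0.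
Proof. by rewrite trmx_delta -rowE [RHS]mxE. Qed.

Lemma err_mean i : Rintegrable P (fun w => (e w) i 0) /\
  \int[P]_w (e w) i 0 = 0.
Proof.
have [v v0 mgf] := err_lin_mgf (delta_mx i 0 : 'cV[R]_n).
have mX := measurable_err i; have -> : (fun w => (e w) i 0) =
  (fun w => ((delta_mx i 0 : 'cV[R]_n)^T *m e w) 0 0) by apply/funext => w; exact: e_lin.
have mX' : measurable_fun setT (fun w => ((delta_mx i 0 : 'cV[R]_n)^T *m e w) 0 0).
  by under eq_fun do rewrite -e_lin.
split; first exact: (mgf_Rintegrable1 mX' mgf).
exact: (mgf_mean mX' mgf).
Qed.

Lemma err_prod_Rintegrable i j : Rintegrable P (fun w => (e w) i 0 * (e w) j 0).
Proof.
have sq l : Rintegrable P (fun w => (e w) l 0 ^+ 2).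
  have [v v0 mgf] := err_lin_mgf (delta_mx l 0 : 'cV[R]_n).
  under eq_fun do rewrite e_lin.
  apply: (mgf_Rintegrable2 _ mgf).
  by under eq_fun do rewrite -e_lin; exact: measurable_err.
apply: (Rintegrable_le _ _ (RintegrableD (sq i) (sq j))).
  by apply: measurable_funM; exact: measurable_err.
move=> w; rewrite normrM -(real_normK (num_real (e w i 0))) -(real_normK (num_real (e w j 0))).
move: `|e w i 0| `|e w j 0| (normr_ge0 (e w i 0)) (normr_ge0 (e w j 0)) => a b a0 b0.
by have := sqr_ge0 (a - b); have := mulr_ge0 a0 b0; nra.
Qed.

(** The mean function cancels in the covariance of the observations. *)
Lemma Sigma0E i j : Sigma0 M i j = \int[P]_w ((e w) i 0 * (e w) j 0).
Proof.
have EZ l : fine ('E_P[Zobs M l]) = mean_fun M (site M l).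
  have [il ml] := err_mean l.
  have ZE : Zobs M l = fun w => (e w) l 0 + mean_fun M (site M l).
    by apply/funext => w; rewrite He /Zobs; ring.
  rewrite unlock -/(Rintegral _ _ _) ZE RintegralD //; last exact: Rintegrable_cst.
  by rewrite ml Rintegral_cstT add0r.
rewrite mxE covariance.unlock !EZ unlock /Rintegral; congr fine.
apply: eq_integral => w _; congr EFin; rewrite !He /Zobs /=.
rewrite [LHS](_ : _ =
  (mean_fun M (site M i) + Defs.eta M (site M i) w + eps M i w - mean_fun M (site M i))
  * (mean_fun M (site M j) + Defs.eta M (site M j) w + eps M j w - mean_fun M (site M j))) //.
by ring.
Qed.

Lemma Rintegrable_qform (A : 'M[R]_n) : Rintegrable P (fun w => qform A (e w)) /\
  \int[P]_w qform A (e w) = \tr (A *m Sigma0 M).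
Proof.
have qE w : qform A (e w) = \sum_i \sum_j A i j * ((e w) i 0 * (e w) j 0).
  rewrite /qform -mulmxA mxE; apply: eq_bigr => i _.
  rewrite !mxE mulr_sumr; apply: eq_bigr => j _; ring.
have -> : (fun w => qform A (e w)) = fun w =>
    \sum_i \sum_j A i j * ((e w) i 0 * (e w) j 0) by apply/funext.
have hj i := @Rintegral_sumr _ _ _ P _ (index_enum 'I_n)
   (fun j w => A i j * ((e w) i 0 * (e w) j 0))
   (fun j => RintegrableZ (A i j) (err_prod_Rintegrable i j)).
have [h1 h2] := @Rintegral_sumr _ _ _ P _ (index_enum 'I_n) _ (fun i => (hj i).1).
split=> //; rewrite h2 /mxtrace; apply: eq_bigr => i _; rewrite (hj i).2 mxE.
apply: eq_bigr => j _; rewrite RintegralZl //; last exact: err_prod_Rintegrable.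
by rewrite Sigma0E; under eq_Rintegral do rewrite mulrC.
Qed.

Lemma err_lin_variance (c : 'cV[R]_n) :
  \int[P]_w ((c^T *m e w) 0 0 ^+ 2) = qform (Sigma0 M) c.
Proof.
have -> : (fun w => (c^T *m e w) 0 0 ^+ 2) = fun w => qform (c *m c^T) (e w).
  apply/funext => w; rewrite /qform.
  have -> : (e w)^T *m (c *m c^T) *m e w = (c^T *m e w)^T *m (c^T *m e w).
    by rewrite [(c^T *m e w)^T]trmx_mul trmxK !mulmxA.
  by rewrite [RHS]mxE big_ord1 [(c^T *m e w)^T _ _]mxE expr2.
have [_ ->] := Rintegrable_qform (c *m c^T).
by rewrite -mulmxA mxtrace_mulC trace_mx11.
Qed.

Lemma mgf_err (u : 'cV[R]_n) :
  (\int[P]_w (expR ((u^T *m e w) 0 0))%:E = (expR (qform (Sigma0 M) u / 2))%:E)%E.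
Proof.
have [v v0 mgf] := err_lin_mgf u.
have mX : measurable_fun setT (fun w => (u^T *m e w) 0 0).
  exact: (measurable_lin measurable_err).
rewrite -err_lin_variance (mgf_variance mX mgf v0).
by have := mgf 1; under eq_integral do rewrite mul1r; rewrite expr1n mul1r.
Qed.

Lemma Sigma0_posdef : posdef (Sigma0 M).
Proof.
apply: psd_unit_posdef (Sigma0_unit ax); split.
  by apply/matrixP => i j; rewrite mxE !Sigma0E; under eq_Rintegral do rewrite mulrC.
by move=> v; rewrite -err_lin_variance; apply: Rintegral_ge0 => w _; exact: sqr_ge0.
Qed.

End model.

(** * Loss, likelihood and risk of one model *)

Lemma exponential_markov d (T : measurableType d) (R : realType)
    (P : probability T R) (f : T -> R) (b s t : R) :
  0 < s -> measurable_fun setT f -> (\int[P]_w (expR (s * f w))%:E <= b%:E)%E ->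
  measurable [set w | t <= f w] /\
  (P [set w | (t <= f w)%R] <= (b * expR (- (s * t)))%:E)%E.
Proof.
move=> s0 mf fb; split.
  have -> : [set w | t <= f w] = setT `&` f @^-1` `[t, +oo[%classic.
    by rewrite setTI; apply/seteqP; split=> x /=; rewrite in_itv /= andbT.
  exact: mf.
have -> : [set w | t <= f w] = [set w | expR (s * t) <= expR (s * f w)].
  by apply/seteqP; split => w /=; rewrite ler_expR ler_pM2l.
rewrite expRN; apply: (@markov_ge0 _ _ _ P (fun w => expR (s * f w))) => //.
- by apply: measurableT_comp => //; exact: measurable_funM.
- exact: expR_gt0.
Qed.

Section fixed_model.
Context {disp : measure_display} {T : measurableType disp} {R : realType}.
Variables (P : probability T R) (d k n : nat) (M : georeg P d k n).
Variable (Theta : set 'rV[R]_k).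
Hypothesis ax : georeg_axioms M Theta.
Hypothesis n_gt0 : (0 < n)%N.
Local Notation e := (errvec M).
Local Notation W th := (invmx (Sigma M th)).
Local Notation hat a th := (invmx (Sigma M th) *m Mhat a th).
Local Notation S0 := (Sigma0 M).
Local Notation mu := (mu0 M).
Implicit Types (a : {set 'I_(nvar M)}) (th : 'rV[R]_k).

Lemma Sigma_posdef th : Theta th -> posdef (Sigma M th).
Proof.
move=> tth; have [sS pS] := Sigma_eta_psd ax tth.
apply: psd_unit_posdef (Sigma_unit ax tth); split.
  by rewrite /Sigma [LHS]linearD /= sS tr_scalar_mx.
move=> v; rewrite /Sigma qformDl addr_ge0 // -scalemx1.
rewrite /qform -scalemxAr -scalemxAl mxE mulr_ge0 //.
  exact: (model_noise_var_ge0 ax tth).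
exact: qform1_ge0.
Qed.

Definition select_cols a : 'M[R]_(1 + nvar M, 1 + #|a|) :=
  block_mx 1%:M 0 0 (colsub (fun j : 'I_#|a| => enum_val j) 1%:M).

Lemma XsubE a : Xsub a = Xfull M *m select_cols a.
Proof.
rewrite /Xsub /Xfull mul_row_block mulmx1 !mulmx0 addr0 add0r.
by rewrite mulmx_colsub mulmx1.
Qed.

Lemma select_cols_inj a (v : 'cV[R]_(1 + #|a|)) : select_cols a *m v = 0 -> v = 0.
Proof.
rewrite -[v]vsubmxK mul_block_col !mul0mx addr0 add0r mul1mx -col_mx0.
move=> /eq_col_mx[-> v0]; rewrite -[RHS]col_mx0; congr col_mx; apply/colP => j.
move/colP/(_ (enum_val j)) : v0; rewrite !mxE => <-.
rewrite (bigD1 j) //= !mxE eqxx mul1r big1 ?addr0 // => i ij.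
by rewrite !mxE (inj_eq enum_val_inj) eq_sym (negbTE ij) mul0r.
Qed.

Lemma gram_unit_sub a th : Theta th ->
  (Xsub a)^T *m W th *m Xsub a \in unitmx.
Proof.
move=> tth; apply/posdef_unit/posdef_congr.
  exact/posdef_inv/Sigma_posdef.
move=> v; rewrite XsubE -mulmxA => Xv0; apply: (@select_cols_inj a).
have := mulVmx (gram_unit ax tth).
move=> /(congr1 (mulmx^~ (select_cols a *m v))); rewrite mul1mx => <-.
by rewrite -!mulmxA Xv0 !mulmx0.
Qed.

Section at_theta.
Variables (a : {set 'I_(nvar M)}) (th : 'rV[R]_k).
Hypothesis tth : Theta th.
Let pW : posdef (W th) := posdef_inv (Sigma_posdef tth).
Let uN := gram_unit_sub a tth.

Lemma ZvecE w : Zvec M w = mu + e w.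
Proof. by apply/colP => i; rewrite !mxE /Zobs addrA. Qed.

Lemma LossE w : Loss a th w =
  L0 M th + 2^-1 * (qform (W th - hat a th) mu + qform (hat a th) (e w)).
Proof. by rewrite /Loss /muhat ZvecE (gls_loss_split pW uN). Qed.

(** The negative likelihood fluctuates around the loss by a Gaussian term due to
    the bias of the model, by the fit of the errors, and by a term that does not
    depend on the model when [th] does not. *)
Lemma loglikE w : - loglik a th w =
  n%:R / 2 * ln (2 * pi) + 2^-1 * ln (\det S0) + n%:R / 2
  + Loss a th w + (mu^T *m (W th - hat a th) *m e w) 0 0 - qform (hat a th) (e w)
  + 2^-1 * \tr ((e w *m (e w)^T - S0) *m W th).
Proof.
rewrite /loglik /muhat ZvecE (gls_rss_split pW uN) LossE /L0.
have -> : \tr ((e w *m (e w)^T - S0) *m W th) =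
    qform (W th) (e w) - \tr (S0 *m W th).
  by rewrite mulmxBl linearB /= -mulmxA mxtrace_mulC trace_mx11.
by field.
Qed.

Lemma L0_le_Loss w : L0 M th <= Loss a th w.
Proof.
rewrite /Loss lerDl mulr_ge0 ?invr_ge0 //.
by have [_ ->] := posdef_psd pW.
Qed.

Lemma RiskE : Risk a th =
  L0 M th + 2^-1 * (qform (W th - hat a th) mu + \tr (hat a th *m S0)).
Proof.
have [iH EH] := Rintegrable_qform ax (hat a th).
rewrite /Risk unlock -/(Rintegral _ _ _).
have -> : Loss a th = fun w => (L0 M th + 2^-1 * qform (W th - hat a th) mu) +
    2^-1 * qform (hat a th) (e w).
  by apply/funext => w; rewrite LossE mulrDr addrA.
rewrite RintegralD //; last 2 first.
- exact: Rintegrable_cst.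
- exact: RintegrableZ.
by rewrite Rintegral_cstT RintegralZl // EH mulrDr addrA.
Qed.

Lemma correct_bias_eq0 : correct a -> (W th - hat a th) *m mu = 0.
Proof.
move=> [b0 [b be]].
have -> : mu = Xsub a *m col_mx (const_mx b0 : 'cV_1) (\col_j b (enum_val j)).
  rewrite /Xsub mul_row_col; apply/colP => i.
  rewrite !mxE be; last exact: site_region ax i.
  rewrite big_ord1 !mxE mul1r; congr (_ + _).
  rewrite [LHS]big_enum_val /=; apply: eq_bigr => j _.
  by rewrite !mxE mulrC.
exact: gls_resid_eq0.
Qed.

Lemma fit_ge0 v : 0 <= qform (hat a th) v.
Proof. by rewrite -(qform_gls_fit pW uN); have [_ ->] := posdef_psd pW. Qed.

Lemma bias_ge0 : 0 <= qform (W th - hat a th) mu.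
Proof. by have [_ ->] := gls_resid_psd pW uN. Qed.

Variable c : R.
Hypothesis dom : forall u : 'cV[R]_n, qform S0 u <= c * qform (Sigma M th) u.

Let c_ge0 : 0 <= c.
Proof.
have i : 'I_n by exact: (Ordinal n_gt0).
have nz : delta_mx i 0 != 0 :> 'cV[R]_n.
  by apply/eqP => /colP/(_ i); rewrite !mxE !eqxx => /eqP; rewrite oner_eq0.
have := dom (delta_mx i 0); have := (Sigma0_posdef ax).2 _ nz.
have := (Sigma_posdef tth).2 _ nz => h1 h2 h3.
by have := lt_le_trans h2 h3; rewrite pmulr_lgt0 // => /ltW.
Qed.

(** The left-hand side is the variance of the linear term of the likelihood:
    under the model covariance it would be the bias itself, and the true
    covariance is at most [c] times larger. *)
Lemma bias_variance_le :
  qform S0 ((W th - hat a th) *m mu) <= c * qform (W th - hat a th) mu.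
Proof.
apply: le_trans (dom _) _; rewrite ler_wpM2l //.
have := gls_resid_sandwich pW uN; rewrite invmxK -qform_congr => ->.
exact: lexx.
Qed.

Let dom' (u : 'cV[R]_n) : qform S0 u <= c * qform (invmx (W th)) u.
Proof. by rewrite invmxK. Qed.

Lemma trace_fit_gt0 : 0 < \tr (hat a th *m S0).
Proof. exact: gls_hat_trace_gt0 pW uN (Sigma0_posdef ax). Qed.

Lemma trace_fit_le : \tr (hat a th *m S0) <= c * (1 + nvar M)%:R.
Proof.
apply: le_trans (gls_hat_trace_le pW uN (Sigma0_posdef ax) dom') _.
rewrite ler_wpM2l // ler_nat leq_add2l.
by rewrite -[leqRHS]card_ord max_card.
Qed.

(** Diagonalised, the fit is a sum of at most [1 + nvar M] independent squares
    of variance at most [c]. *)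
Lemma fit_exp_tail s t : 0 < s -> s * c <= 3 / 8 ->
  measurable [set w | t <= qform (hat a th) (e w)] /\
  (P [set w | (t <= qform (hat a th) (e w))%R] <=
   (2 ^+ (1 + nvar M) * expR (- (s * t)))%:E)%E.
Proof.
move=> s0 sc; have [G [dg [HG GS dg0 dgc]]] :=
  gls_hat_diag_dominated pW uN (Sigma0_posdef ax) dom'.
have HE w : qform (hat a th) (e w) = qform 1%:M (G *m e w).
  by rewrite HG -qform_congr mulmx1.
apply: exponential_markov => //.
  by apply/measurable_EFinP; exact: (measurable_int P (Rintegrable_qform ax _).1).
under eq_integral do rewrite HE.
have [symS _] := Sigma0_posdef ax.
apply: le_trans (gaussian_quadratic_mgf (measurable_err M) symS (mgf_err ax) GS (ltW s0) _) _.
  by move=> i; apply: le_trans sc; rewrite ler_pM2l.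
rewrite lee_fin ler_weXn2l ?ler1n // leq_add2l.
by rewrite -[leqRHS]card_ord max_card.
Qed.

(** All the fits at the same [th] are dominated by the fit of the model with
    every explanatory variable, so one tail bound serves for all of them. *)
Lemma full_fit_tail K : 0 < K -> exists B, [/\ measurable B,
  (P B <= (c / K)%:E)%E &
  forall w, ~ B w -> forall b : {set 'I_(nvar M)}, qform (hat b th) (e w) <= K * (1 + nvar M)%:R].
Proof.
move=> K0; set H := W th *m gls_proj (W th) (Xfull M).
have uX := gram_unit ax tth.
have r0 : (0 : R) < (1 + nvar M)%:R by rewrite ltr0n.
have [iH EH] := Rintegrable_qform ax H.
have mH : measurable_fun setT (fun w => qform H (e w)).
  by apply/measurable_EFinP; exact: (measurable_int P iH).
exists [set w | K * (1 + nvar M)%:R <= qform H (e w)]; split.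
- have -> : [set w | K * (1 + nvar M)%:R <= qform H (e w)] =
      setT `&` (fun w => qform H (e w)) @^-1` `[K * (1 + nvar M)%:R, +oo[%classic.
    by rewrite setTI; apply/seteqP; split=> x /=; rewrite in_itv /= andbT.
  exact: mH.
- apply: le_trans (markov_ge0 (b := c * (1 + nvar M)%:R) mH _ _ _) _.
  + by move=> w; rewrite -(qform_gls_fit pW uX); have [_ ->] := posdef_psd pW.
  + by rewrite mulr_gt0.
  + have := gls_hat_trace_le pW uX (Sigma0_posdef ax) dom'.
    rewrite -EH -lee_fin /Rintegral fineK //; exact: integrable_fin_num.
  + by rewrite lee_fin le_eqVlt; apply/orP; left; apply/eqP; field; rewrite !gt_eqF.
move=> w /= /negP; rewrite -ltNge => /ltW Hw b; apply: le_trans Hw.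
have := @gls_hat_mono _ _ _ _ (W th) (Xfull M) (select_cols b) (e w) pW uX.
by rewrite -XsubE => /(_ (gram_unit_sub b tth)).
Qed.

End at_theta.

(** The Chernoff bound for both signs, at the exponent [s = dl / (2 * c)] that
    minimises [s ^+ 2 * (2 * c * x) / 2 - s * (dl * x)]. *)
Lemma err_gaussian_tail (u : 'cV[R]_n) (c x dl : R) : 0 < c -> 0 < dl ->
  qform S0 u <= 2 * c * x ->
  measurable [set w | dl * x <= `|(u^T *m e w) 0 0|] /\
  (P [set w | (dl * x <= `|(u^T *m e w) 0 0|)%R] <=
     (2 * expR (- (dl ^+ 2 / (4 * c) * x)))%:E)%E.
Proof.
move=> c0 dl0 qx; pose s := dl / (2 * c).
have s0 : 0 < s by rewrite divr_gt0 // mulr_gt0.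
have mX (v : 'cV[R]_n) : measurable_fun setT (fun w => (v^T *m e w) 0 0).
  exact: (measurable_lin (measurable_err M)).
have tail v : qform S0 v <= 2 * c * x ->
    measurable [set w | dl * x <= (v^T *m e w) 0 0] /\
    (P [set w | (dl * x <= (v^T *m e w) 0 0)%R] <=
     (expR (- (dl ^+ 2 / (4 * c) * x)))%:E)%E.
  move=> qv; have := @exponential_markov _ _ _ P (fun w => (v^T *m e w) 0 0)
    (expR (dl ^+ 2 / (4 * c) * x)) s (dl * x) s0 (mX v).
  rewrite -expRD (_ : _ + _ = - (dl ^+ 2 / (4 * c) * x)); last first.
    by rewrite /s; field; rewrite gt_eqF.
  apply; have := mgf_err ax (s *: v).
  under eq_integral do rewrite [(s *: v)^T]linearZ /= -scalemxAl mxE.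
  move=> ->; rewrite lee_fin ler_expR.
  have -> : qform S0 (s *: v) = s ^+ 2 * qform S0 v.
    by rewrite /qform [(s *: v)^T]linearZ /= -!scalemxAl -scalemxAr scalerA mxE.
  have -> : dl ^+ 2 / (4 * c) * x = s ^+ 2 * (2 * c * x) / 2.
    by rewrite /s; field; rewrite gt_eqF.
  by rewrite ler_pM2r ?invr_gt0 // ler_pM2l // exprn_gt0.
have [m1 h1] := tail u qx.
have [m2 h2] : measurable [set w | dl * x <= ((- u)^T *m e w) 0 0] /\
    (P [set w | (dl * x <= ((- u)^T *m e w) 0 0)%R] <=
     (expR (- (dl ^+ 2 / (4 * c) * x)))%:E)%E.
  by apply: tail; rewrite qformN.
have -> : [set w | dl * x <= `|(u^T *m e w) 0 0|] =
  [set w | dl * x <= (u^T *m e w) 0 0] `|` [set w | dl * x <= ((- u)^T *m e w) 0 0].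
  apply/seteqP; split=> w /=; rewrite [(- u)^T]linearN /= mulNmx [(- _ : 'M[R]_1) _ _]mxE.
    by rewrite ler_normr => /orP.
  by rewrite ler_normr => /orP.
split; first exact: measurableU.
apply: le_trans (measureU2 _ m1 m2) _; apply: le_trans (leeD h1 h2) _.
by rewrite -EFinD lee_fin [leRHS]mulr_natl mulr2n.
Qed.

End fixed_model.

(** * Measurability of estimated quantities *)

Section matrix_measurability.
Context d (T : measurableType d) (R : realType).

Lemma measurable_funV (f : T -> R) : measurable_fun setT f ->
  measurable_fun setT (fun w => (f w)^-1).
Proof.
move=> mf; have -> : (fun w => (f w)^-1) = fun w => f w * ((f w ^+ 2) `^ (- 1)).
  apply/funext => w; rewrite powR_inv1 ?sqr_ge0 // expr2.
  have [->|f0] := eqVneq (f w) 0; first by rewrite mul0r invr0.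
  by field.
apply: measurable_funM => //.
have mf2 : measurable_fun setT (fun w => f w ^+ 2) by exact: measurable_funX.
by have := measurableT_comp (measurable_powR (- 1)) mf2.
Qed.

Definition measurable_mx m n (A : T -> 'M[R]_(m, n)) :=
  forall i j, measurable_fun setT (fun w => A w i j).

Lemma measurable_mxM m n p (A : T -> 'M[R]_(m, n)) (B : T -> 'M[R]_(n, p)) :
  measurable_mx A -> measurable_mx B -> measurable_mx (fun w => A w *m B w).
Proof.
move=> mA mB i j; under eq_fun do rewrite mxE.
by apply: measurable_sum => l; apply: measurable_funM.
Qed.

Lemma measurable_mxB m n (A B : T -> 'M[R]_(m, n)) :
  measurable_mx A -> measurable_mx B -> measurable_mx (fun w => A w - B w).
Proof.
by move=> mA mB i j; under eq_fun do rewrite !mxE; apply: measurable_funB.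
Qed.

Lemma measurable_mxT m n (A : T -> 'M[R]_(m, n)) :
  measurable_mx A -> measurable_mx (fun w => (A w)^T).
Proof. by move=> mA i j; under eq_fun do rewrite mxE; exact: mA. Qed.

Lemma measurable_det n (A : T -> 'M[R]_n) : measurable_mx A ->
  measurable_fun setT (fun w => \det (A w)).
Proof.
move=> mA; rewrite /determinant; apply: measurable_sum => s.
by apply: measurable_funM => //; apply: measurable_prod => i _; exact: mA.
Qed.

Lemma measurable_trace n (A : T -> 'M[R]_n) : measurable_mx A ->
  measurable_fun setT (fun w => \tr (A w)).
Proof. by move=> mA; apply: measurable_sum => i; exact: mA. Qed.

Lemma measurable_qform n (A : T -> 'M[R]_n) (v : T -> 'cV[R]_n) :
  measurable_mx A -> measurable_mx v ->
  measurable_fun setT (fun w => qform (A w) (v w)).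
Proof.
by move=> mA mv; apply: measurable_mxM => //; apply: measurable_mxM => //; exact: measurable_mxT.
Qed.

Lemma measurable_invmx n (A : T -> 'M[R]_n) : (forall w, A w \in unitmx) ->
  measurable_mx A -> measurable_mx (fun w => invmx (A w)).
Proof.
move=> uA mA i j.
have -> : (fun w => invmx (A w) i j) = fun w => (\det (A w))^-1 * cofactor (A w) j i.
  by apply/funext => w; rewrite /invmx uA !mxE.
apply: measurable_funM; first exact/measurable_funV/measurable_det.
apply: measurable_funM => //; apply: measurable_det => i' j'.
by under eq_fun do rewrite !mxE; exact: mA.
Qed.

Lemma measurable_bigmax (I : Type) (r : seq I) (p : pred I) (f : I -> T -> R) :
  (forall i, p i -> measurable_fun setT (f i)) ->
  measurable_fun setT (fun w => \big[Order.max/0]_(i <- r | p i) f i w).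
Proof.
move=> mf; elim: r => [|i r IH]; first by under eq_fun do rewrite big_nil; exact: measurable_cst.
under eq_fun do rewrite big_cons; case: (boolP (p i)) => // pi.
by apply: measurable_maxr => //; exact: mf.
Qed.

Lemma measurable_bigmin (I : Type) (r : seq I) (p : pred I) (f : I -> T -> R)
    (g : T -> R) : measurable_fun setT g ->
  (forall i, p i -> measurable_fun setT (f i)) ->
  measurable_fun setT (fun w => \big[Order.min/g w]_(i <- r | p i) f i w).
Proof.
move=> mg mf; elim: r => [|i r IH]; first by under eq_fun do rewrite big_nil; exact: mg.
under eq_fun do rewrite big_cons; case: (boolP (p i)) => // pi.
by apply: measurable_minr => //; exact: mf.
Qed.

End matrix_measurability.

Section estimator_measurability.
Context {disp : measure_display} {T : measurableType disp} {R : realType}.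
Variables (P : probability T R) (d k n : nat) (M : georeg P d k n).
Variable (Theta : set 'rV[R]_k).
Hypothesis ax : georeg_axioms M Theta.
Variable th : T -> 'rV[R]_k.
Hypothesis mth : forall U : set 'rV[R]_k, open U -> measurable (th @^-1` U).
Hypothesis tth : forall w, Theta (th w).

(** Continuity is assumed within [Theta] only, which is enough because the
    estimator stays in [Theta]: the preimage of an open set is cut out on
    [Theta] by an open set. *)
Lemma measurable_Sigma_estimator : measurable_mx (fun w => Sigma M (th w)).
Proof.
move=> i j _; apply: (measurability _ (RGenOpens.measurableE R)).
move=> _ [_ [a [b ->] <-]]; rewrite setTI.
have oU : open ((fun A : 'M[R]_n => A i j) @^-1` `]a, b[).
  have /continuousP := @coord_continuous R n n i j.
  by apply; exact: interval_open.
have /continuousP/(_ _ oU) := Sigma_continuous ax.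
move=> /open_subspaceP[V oV VU].
rewrite (_ : _ @^-1` _ = th @^-1` V); first exact: mth.
apply/seteqP; split=> w /= hw.
  by have [] : (V `&` Theta) (th w) by rewrite VU.
have [] : (((fun A : 'M[R]_n => A i j) @^-1` `]a, b[ \o Sigma M) `&` Theta) (th w) by rewrite -VU.
by [].
exact: measurableT.
Qed.

Lemma measurable_invSigma_estimator : measurable_mx (fun w => invmx (Sigma M (th w))).
Proof.
apply: measurable_invmx measurable_Sigma_estimator => w.
exact: (Sigma_unit ax (tth w)).
Qed.

Lemma measurable_Zvec : measurable_mx (Zvec M).
Proof.
move=> i j; under eq_fun do rewrite mxE.
by apply: measurable_funD => //; apply: measurable_funD.
Qed.

Lemma measurable_muhat (a : {set 'I_(nvar M)}) : measurable_mx (fun w => muhat a (th w) w).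
Proof.
have mS := measurable_invSigma_estimator.
apply: measurable_mxM measurable_Zvec; apply: measurable_mxM => //.
apply: measurable_mxM => //; apply: measurable_mxM => //.
apply: measurable_invmx; last first.
  by apply: measurable_mxM => //; apply: measurable_mxM.
by move=> w; exact: (gram_unit_sub ax a (tth w)).
Qed.

Lemma measurable_loglik (a : {set 'I_(nvar M)}) : measurable_fun setT (fun w => loglik a (th w) w).
Proof.
apply: measurable_funB.
  apply: measurable_funB => //; apply: measurable_funM => //.
  apply: (measurableT_comp (@measurable_ln R)).
  exact/measurable_det/measurable_Sigma_estimator.
apply: measurable_funM => //; apply: measurable_qform.
  exact: measurable_invSigma_estimator.
apply: measurable_mxB; [exact: measurable_Zvec|exact: measurable_muhat].
Qed.

Lemma measurable_Loss (a : {set 'I_(nvar M)}) : measurable_fun setT (fun w => Loss a (th w) w).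
Proof.
apply: measurable_funD.
  apply: measurable_funM => //; apply: measurable_funB => //; apply: measurable_funD.
    apply: measurable_funB => //; apply: (measurableT_comp (@measurable_ln R)).
    exact/measurable_det/measurable_Sigma_estimator.
  apply: measurable_trace; apply: measurable_mxM => //.
  exact: measurable_invSigma_estimator.
apply: measurable_funM => //; apply: measurable_qform.
  exact: measurable_invSigma_estimator.
by apply: measurable_mxB => //; exact: measurable_muhat.
Qed.

End estimator_measurability.

(** * Events of vanishing probability *)

Section vanishing_events.
Context d (T : measurableType d) (R : realType) (P : probability T R).

(** Outer probabilities tending to 0: the events of the argument need not be
    measurable one by one. *)
Definition vanishing (A : nat -> set T) := forall ep : R, 0 < ep ->
  \forall n \near \oo, exists B,
    [/\ measurable B, A n `<=` B & (P B <= ep%:E)%E].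

Lemma vanishing_sub (A B : nat -> set T) : vanishing B ->
  (\forall n \near \oo, A n `<=` B n) -> vanishing A.
Proof.
move=> vB AB ep ep0; near=> n.
have [C [mC BC PC]] : exists C, [/\ measurable C, B n `<=` C & (P C <= ep%:E)%E].
  by near: n; exact: vB.
exists C; split=> //; apply: subset_trans BC; near: n; exact: AB.
Unshelve. all: by end_near. Qed.

Lemma vanishingU (A B : nat -> set T) : vanishing A -> vanishing B ->
  vanishing (fun n => A n `|` B n).
Proof.
move=> vA vB ep ep0; have e2 : 0 < ep / 2 by rewrite divr_gt0.
near=> n.
have [C [mC AC PC]] : exists C, [/\ measurable C, A n `<=` C & (P C <= (ep / 2)%:E)%E].
  by near: n; exact: vA.
have [D [mD BD PD]] : exists C, [/\ measurable C, B n `<=` C & (P C <= (ep / 2)%:E)%E].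
  by near: n; exact: vB.
exists (C `|` D); split; [exact: measurableU|exact: setUSS|].
apply: le_trans (measureU2 _ mC mD) _; apply: le_trans (leeD PC PD) _.
by rewrite -EFinD lee_fin -splitr.
Unshelve. all: by end_near. Qed.

Lemma o_p_vanishing (X : nat -> T -> R) (dl : R) : o_p P X -> 0 < dl ->
  (\forall n \near \oo, measurable_fun setT (X n)) ->
  vanishing (fun n => [set w | dl < `|X n w|]).
Proof.
move=> oX dl0 mX ep ep0; near=> n; exists [set w | dl < `|X n w|]; split=> //.
  have mXn : measurable_fun setT (X n) by near: n.
  have -> : [set w | dl < `|X n w|] = setT `&` (fun w => `|X n w|) @^-1` `]dl, +oo[%classic.
    by rewrite setTI; apply/seteqP; split=> x /=; rewrite in_itv /= andbT.
  have mN : measurable_fun setT (fun w => `|X n w|) by exact: measurableT_comp.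
  exact: mN.
have fP : P [set w | dl < `|X n w|] \is a fin_num.
  by near: n; have /fine_cvgP[] := oX dl dl0.
rewrite -(fineK fP) lee_fin; apply: le_trans (ler_norm _) _; near: n.
by have /fine_cvgP[_ /cvgr0Pnorm_le] := oX dl dl0; apply.
Unshelve. all: by end_near. Qed.

Lemma vanishing_cvg0 (A : nat -> set T) : vanishing A ->
  (\forall n \near \oo, measurable (A n)) -> P (A n) @[n --> \oo] --> 0%E.
Proof.
move=> vA mA.
apply/fine_cvgP; split.
  by near=> n; apply: fin_num_measure; near: n.
apply/cvgr0Pnorm_le => ep ep0; near=> n.
have mAn : measurable (A n) by near: n.
have [B [mB AB PB]] : exists B, [/\ measurable B, A n `<=` B & (P B <= ep%:E)%E].
  by near: n; exact: vA.
rewrite /= ger0_norm ?fine_ge0 // -lee_fin fineK ?fin_num_measure //.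
by apply: le_trans PB; apply: le_measure; rewrite ?inE.
Unshelve. all: by end_near. Qed.

Lemma Boole_finite (I : finType) (A : {set I}) (E : I -> set T) (b : I -> R) :
  (forall i, i \in A -> measurable (E i) /\ (P (E i) <= (b i)%:E)%E) ->
  exists B, [/\ measurable B, [set w | exists2 i, i \in A & E i w] `<=` B &
    (P B <= (\sum_(i in A) b i)%:E)%E].
Proof.
move=> hE; rewrite -big_enum /=.
have : forall i, i \in enum A -> measurable (E i) /\ (P (E i) <= (b i)%:E)%E.
  by move=> i; rewrite mem_enum; exact: hE.
have sub : [set w | exists2 i, i \in A & E i w] `<=` [set w | exists2 i, i \in enum A & E i w].
  by move=> w [i iA Ei]; exists i => //; rewrite mem_enum.
move=> {}hE; suff [B [mB AB PB]] : exists B, [/\ measurable B,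
    [set w | exists2 i, i \in enum A & E i w] `<=` B &
    (P B <= (\sum_(i <- enum A) b i)%:E)%E].
  by exists B; split=> //; exact: subset_trans AB.
elim: (enum A) hE => [|i s IH] hE.
  by exists set0; split=> // [w []//|]; rewrite measure0 big_nil.
have [|B [mB AB PB]] := IH; first by move=> j js; apply: hE; rewrite in_cons js orbT.
have [mE PE] := hE i (mem_head _ _).
exists (E i `|` B); split; first exact: measurableU.
  move=> w [j]; rewrite in_cons => /predU1P[->|js] Ej; [by left|right].
  by apply: AB; exists j.
apply: le_trans (measureU2 _ mE mB) _; apply: le_trans (leeD PE PB) _.
by rewrite big_cons EFinD.
Qed.

Lemma vanishing_exists (I : nat -> finType) (A : forall n, {set I n})
    (E : forall n, I n -> set T) (b : forall n, I n -> R) :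
  (\forall n \near \oo, forall i, i \in A n ->
    measurable (E n i) /\ (P (E n i) <= (b n i)%:E)%E) ->
  (\sum_(i in A n) b n i) @[n --> \oo] --> 0 ->
  vanishing (fun n => [set w | exists2 i, i \in A n & E n i w]).
Proof.
move=> hE b0 ep ep0; near=> n.
have hEn : forall i, i \in A n -> measurable (E n i) /\ (P (E n i) <= (b n i)%:E)%E.
  by near: n.
have [B [mB AB PB]] := Boole_finite hEn.
exists B; split=> //; apply: le_trans PB _; rewrite lee_fin.
apply: le_trans (ler_norm _) _; near: n.
by move/cvgr0Pnorm_le : b0; apply.
Unshelve. all: by end_near. Qed.

End vanishing_events.

(** * Criterion against loss *)

(** From [ln y < y] at [y = c * x / q]. *)
Lemma expRN_le_powR (R : realType) (c q : R) : 0 < c -> 0 < q ->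
  exists2 K, 0 < K & forall x, 0 < x -> expR (- (c * x)) <= K * (x `^ q)^-1.
Proof.
move=> c0 q0; pose y := c / q; have y0 : 0 < y by rewrite divr_gt0.
exists (expR (- (q * ln y))); first exact: expR_gt0.
move=> x x0; rewrite /powR gt_eqF // -expRN -expRD ler_expR.
have xy0 : 0 < y * x by rewrite mulr_gt0.
have := ltW (ln_sublinear xy0); rewrite lnM ?posrE //.
rewrite -(ler_pM2l q0) => h.
have -> : c * x = q * (y * x) by rewrite /y; field; rewrite gt_eqF.
lra.
Qed.

(** The two-sided relative error is used at [i], where the criterion bounds the
    loss from above, and at the minimiser of the loss, where it bounds it from
    below: the ratio is at most [(1 + eta) / (1 - eta)]. *)
Lemma criterion_loss_ratio (R : realType) (I : finType) (A : {set I}) (i : I)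
    (G L : I -> R) (eta : R) :
  0 <= eta -> eta <= 2^-1 -> i \in A -> (forall j, j \in A -> 0 < L j) ->
  (forall j, j \in A -> `|G j - L j| <= eta * L j) ->
  (forall j, j \in A -> G i <= G j) ->
  `|L i / inf [set L j | j in [set` A]] - 1| <= 4 * eta.
Proof.
move=> e0 e1 iA L0 GL Gi.
case: (arg_minP L iA) => m mA mmin.
have -> : inf [set L j | j in [set` A]] = L m.
  apply/eqP; rewrite eq_le; apply/andP; split.
    apply: ge_inf; last by exists m.
    by exists (L m) => _ [j jA <-]; exact: mmin.
  apply: lb_le_inf; first by exists (L m), m.
  by move=> _ [j jA <-]; exact: mmin.
have Lm := L0 _ mA.
have := GL _ iA; rewrite ler_norml => /andP[h1 h2].
have := GL _ mA; rewrite ler_norml => /andP[h3 h4].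
have := Gi _ mA; have := mmin _ iA => h5 h6.
rewrite ger0_norm; last by rewrite subr_ge0 ler_pdivlMr // mul1r.
rewrite lerBlDr ler_pdivrMr //.
have h7 : L i * (1 - eta) <= (1 + eta) * L m by lra.
have Li := L0 _ iA.
have : L i <= 2 * ((1 + eta) * L m) by nra.
nra.
Qed.

(** A finite upper limit gives one constant beyond some rank, and the spectral
    bound is a comparison of forms by [whitened_dominates]. *)
Lemma covariance_dominated (disp : measure_display) (T : measurableType disp)
    (R : realType) (P : probability T R) (d k : nat) (Theta : set 'rV[R]_k)
    (M : forall n : nat, georeg P d k n) :
  (forall n, (0 < n)%N -> georeg_axioms (M n) Theta) ->
  (limn_esup (fun n => ereal_sup
     [set (lambda_max (psd_sqrt (invmx (Sigma (M n) th)) *m Sigma0 (M n)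
             *m psd_sqrt (invmx (Sigma (M n) th))))%:E | th in Theta])
     < +oo)%E ->
  exists2 c : R, 0 < c & \forall n \near \oo, forall th, Theta th ->
    forall u : 'cV[R]_n, qform (Sigma0 (M n)) u <= c * qform (Sigma (M n) th) u.
Proof.
move=> ax; rewrite /limn_esup limf_esupE => /ereal_inf_lt[_ [V Voo <-]].
set s := ereal_sup _ => soo.
have [c c0 sc] : exists2 c : R, 0 < c & (s <= c%:E)%E.
  move: soo; case: s => [r _| |_] //.
    by exists (Num.max 1 r); rewrite ?lt_max ?ltr01 // lee_fin le_max lexx orbT.
  by exists 1; rewrite ?ltr01 // leNye.
exists c => //; near=> n => th tth u.
have n0 : (0 < n)%N by near: n; exact: nbhs_infty_gt.
have Vn : V n by near: n.
apply: whitened_dominates.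
- exact: (Sigma_posdef (ax n n0) tth).
- exact/posdef_psd/(Sigma0_posdef (ax n n0)).
rewrite -lee_fin; apply: le_trans sc.
apply: (@le_trans _ _ (ereal_sup
     [set (lambda_max (psd_sqrt (invmx (Sigma (M n) th)) *m Sigma0 (M n)
             *m psd_sqrt (invmx (Sigma (M n) th))))%:E | th in Theta])).
  by apply: ereal_sup_ubound; exists th.
by apply: ereal_sup_ubound; exists n.
Unshelve. all: by end_near. Qed.

Section criterion_vs_loss.
Context {disp : measure_display} {T : measurableType disp} {R : realType}.
Variables (P : probability T R) (d k n : nat) (M : georeg P d k n).
Variable (Theta : set 'rV[R]_k).
Hypothesis ax : georeg_axioms M Theta.
Hypothesis n_gt0 : (0 < n)%N.
Local Notation e := (errvec M).
Local Notation W th := (invmx (Sigma M th)).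
Local Notation hat a th := (invmx (Sigma M th) *m Mhat a th).
Local Notation S0 := (Sigma0 M).
Local Notation mu := (mu0 M).
Variable th0 : 'rV[R]_k.
Hypothesis th0P : is_theta0 M Theta th0.
Implicit Types (a : {set 'I_(nvar M)}) (th : 'rV[R]_k).

(** The part of half the criterion that is common to all the models. *)
Definition common_deviance w : R :=
  n%:R / 2 * ln (2 * pi) + 2^-1 * ln (\det S0) + n%:R / 2
  + 2^-1 * \tr ((e w *m (e w)^T - S0) *m W th0).

(** The excess risk is the excess of [L0] plus half of the bias and half of the
    mean of the fit. The bias and the fit are therefore controlled by it, and
    the mean of the fit is positive because of the intercept. *)
Lemma risk_excess a th : Theta th -> 0 < Risk a th - L0 M th0 /\
  qform (W th - hat a th) mu <= 2 * (Risk a th - L0 M th0).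
Proof.
move=> tth; have tr0 := trace_fit_gt0 ax a tth; have b0 := bias_ge0 ax a tth.
have l0 := th0P.2 _ tth; rewrite (RiskE ax a tth); split; lra.
Qed.

Lemma L0_ge0 th : Theta th -> 0 <= L0 M th.
Proof.
move=> tth; rewrite /L0 mulr_ge0 ?invr_ge0 //.
exact: gaussian_divergence_ge0 (Sigma_posdef ax tth) (Sigma0_posdef ax).
Qed.

Lemma L0_gt0 th : Theta th -> S0 <> Sigma M th -> 0 < L0 M th.
Proof.
move=> tth neq; rewrite lt_neqAle L0_ge0 // andbT eq_sym; apply/eqP => L00.
apply: neq; apply: gaussian_divergence_eq0 (Sigma_posdef ax tth) (Sigma0_posdef ax) _.
by move: L00; rewrite /L0 => /eqP; rewrite mulf_eq0 invr_eq0 pnatr_eq0 /= => /eqP.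
Qed.

(** Up to [common_deviance], the criterion differs from the loss by the linear
    bias term, the fit, the dimension penalty, and the covariance term, each
    assumed to be at most [dl] times the excess risk. *)
Lemma incorrect_criterion a th (l L dl : R) w (x := Risk a th - L0 M th0) :
  Theta th ->
  `|l - loglik a th w| <= dl * x -> `|L - Loss a th w| <= dl * x ->
  `|(mu^T *m (W th - hat a th) *m e w) 0 0| <= dl * x ->
  qform (hat a th) (e w) <= dl * x ->
  `|\tr ((e w *m (e w)^T - S0) *m (W th - W th0))| <= dl * x ->
  \tr (hat a th *m S0) <= dl * x -> #|a|%:R <= dl * x ->
  `|(- l + #|a|%:R - common_deviance w) - L| <= 6 * dl * x /\
  `|L - L0 M th0 - x| <= 2 * dl * x.
Proof.
move=> tth.
have h := loglikE ax a tth w; have hL := LossE ax a tth w.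
have hR := RiskE ax a tth.
have trE : \tr ((e w *m (e w)^T - S0) *m (W th - W th0)) =
  \tr ((e w *m (e w)^T - S0) *m W th) - \tr ((e w *m (e w)^T - S0) *m W th0).
  by rewrite mulmxBr linearB.
have f0 := fit_ge0 ax a tth (e w); have t0 := trace_fit_gt0 ax a tth.
have c0 : 0 <= #|a|%:R :> R by rewrite ler0n.
rewrite /common_deviance trE; move: h hL hR f0 t0 c0.
rewrite {}/x.
move: (\tr ((e w *m (e w)^T - S0) *m W th)) => t1.
move: (\tr ((e w *m (e w)^T - S0) *m W th0)) => t2.
move: ((mu^T *m (W th - hat a th) *m e w) 0 0) => b.
move: (qform (hat a th) (e w)) (\tr (hat a th *m S0)) (Risk a th)
  (L0 M th) (L0 M th0) (Loss a th w) (loglik a th w)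
  (#|a|%:R : R) (qform (W th - hat a th) mu) => f t r l0 l00 ls ll p qa.
move: (n%:R / 2 * ln _) => k1; move: (2^-1 * ln _) => k2; move: (n%:R / 2) => k3.
move=> h hL hR f0 t0 c0.
rewrite !ler_norml => /andP[? ?] /andP[? ?] /andP[? ?] ? /andP[? ?] ? ?.
by split; apply/andP; split; lra.
Qed.

(** A correct model has no bias, and the covariance term at [th0] belongs to
    the common part: only the fit, the penalty and the two errors of estimation
    remain. *)
Lemma correct_criterion a (l L K : R) w (m := (1 + nvar M)%:R) :
  correct a -> 0 <= K ->
  `|l - loglik a th0 w| <= K -> `|L - Loss a th0 w| <= K ->
  qform (hat a th0) (e w) <= K * m ->
  `|(- l + #|a|%:R - common_deviance w) - L| <= (3 * K + 1) * m /\
  `|L - L0 M th0| <= (3 * K + 1) * m.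
Proof.
move=> ca K0; have tth := th0P.1.
have h := loglikE ax a tth w; have hL := LossE ax a tth w.
have b0 := correct_bias_eq0 ax tth ca.
have qb : qform (W th0 - hat a th0) mu = 0 by rewrite /qform -mulmxA b0 mulmx0 mxE.
have sym := gls_resid_sym (Xsub a) (posdef_inv (Sigma_posdef ax tth)).
have bb : (mu^T *m (W th0 - hat a th0) *m e w) 0 0 = 0.
  by rewrite -sym -trmx_mul b0 trmx0 mul0mx mxE.
have f0 := fit_ge0 ax a tth (e w).
have c0 : 0 <= #|a|%:R :> R by rewrite ler0n.
have m1 : 1 <= m by rewrite ler1n.
have cm : #|a|%:R <= m.
  by rewrite ler_nat (leq_trans (max_card _)) // card_ord leq_addl.
have Km : K <= K * m by rewrite ler_peMr.
rewrite /common_deviance; move: h hL f0 c0 m1 cm Km.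
rewrite qb bb.
move: (\tr ((e w *m (e w)^T - S0) *m W th0)) => t1.
move: (qform (hat a th0) (e w)) (L0 M th0)
  (Loss a th0 w) (loglik a th0 w) (#|a|%:R : R) => f l00 ls ll p.
move: (n%:R / 2 * ln _) => k1; move: (2^-1 * ln _) => k2; move: (n%:R / 2) m => k3 m.
move=> h hL f0 c0 m1 cm Km.
rewrite !ler_norml => /andP[? ?] /andP[? ?] ?.
by split; apply/andP; split; lra.
Qed.

End criterion_vs_loss.

(** * Selection by the criterion *)

Section gic_selection.
Context {disp : measure_display} {T : measurableType disp} {R : realType}.
Variables (P : probability T R) (d k : nat) (Theta : set 'rV[R]_k).
Variable M : forall n : nat, georeg P d k n.
Variable thetahat : forall n : nat, {set 'I_(nvar (M n))} -> T -> 'rV[R]_k.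
Variable ahat : forall n : nat, T -> {set 'I_(nvar (M n))}.
Variables (theta0 : nat -> 'rV[R]_k) (theta_ : set nat -> 'rV[R]_k).
Hypothesis ax : forall n, (0 < n)%N -> georeg_axioms (M n) Theta.
Hypothesis HMLE : forall n, (0 < n)%N -> forall a, a \in candidates (M n) ->
  is_MLE Theta a (thetahat a).
Hypothesis HGIC : forall n, (0 < n)%N -> is_GIC_selection 2 (@thetahat n) (ahat n).
Hypothesis Htheta0 : forall n, (0 < n)%N -> is_theta0 (M n) Theta (theta0 n).
Hypothesis Hmis : forall n, (0 < n)%N -> Sigma0 (M n) <> Sigma (M n) (theta0 n).
Local Notation inc n := (incorrect_models (M n)).
Local Notation cor n := (correct_models (M n)).
Local Notation exc n a := (excess theta_ (theta0 n) a).
Local Notation tha a := (theta_ (labels a)).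
Local Notation e n := (errvec (M n)).
Local Notation W n th := (invmx (Sigma (M n) th)).
Local Notation hat n a th := (invmx (Sigma (M n) th) *m Mhat a th).
Local Notation bias n a w :=
  (((mu0 (M n))^T *m (W n (tha a) - hat n a (tha a)) *m e n w) 0 0).
Local Notation dim n := ((1 + nvar (M n))%:R : R).
Local Notation LL n a w := (Loss a (thetahat a w) w).
Local Notation GG n a w := (- loglik a (thetahat a w) w + #|a|%:R
  - common_deviance (M n) (theta0 n) w).
Hypothesis C2_theta : forall n, (0 < n)%N -> forall a, a \in inc n -> Theta (tha a).
Variable c : R.
Hypothesis c_gt0 : 0 < c.
Hypothesis dom : \forall n \near \oo, forall th, Theta th ->
  forall u : 'cV[R]_n, qform (Sigma0 (M n)) u <= c * qform (Sigma (M n) th) u.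
Hypothesis C2_loglik : o_p P (fun n w =>
  \big[Order.max/0]_(a in inc n)
    `|(loglik a (thetahat a w) w - loglik a (tha a) w) / exc n a|).
Hypothesis C2_Loss : o_p P (fun n w =>
  \big[Order.max/0]_(a in inc n)
    `|(Loss a (thetahat a w) w - Loss a (tha a) w) / exc n a|).
Hypothesis C2_loglik_correct : O_p P (fun n w =>
  \big[Order.max/0]_(a in cor n)
    `|loglik a (thetahat a w) w - loglik a (theta0 n) w|).
Hypothesis C2_Loss_correct : O_p P (fun n w =>
  \big[Order.max/0]_(a in cor n)
    `|Loss a (thetahat a w) w - Loss a (theta0 n) w|).
Variable q : R.
Hypothesis q_gt0 : 0 < q.
Hypothesis C3 : (\sum_(a in inc n) (exc n a `^ q)^-1) @[n --> \oo] --> (0 : R).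
Hypothesis C4' : (\big[Order.max/0]_(a in inc n)
  ((nvar (M n))%:R / exc n a)) @[n --> \oo] --> (0 : R).
Hypothesis C5 : o_p P (fun n w =>
  \big[Order.max/0]_(a in inc n)
    `|\tr ((e n w *m (e n w)^T - Sigma0 (M n)) *m (W n (tha a) - W n (theta0 n)))
      / exc n a|).

Lemma inc_candidate n a : a \in inc n -> a \in candidates (M n).
Proof. by rewrite /incorrect_models finset.in_setD => /andP[]. Qed.

Lemma cor_candidate n a : a \in cor n -> a \in candidates (M n) /\ correct a.
Proof. by rewrite /correct_models finset.inE => /andP[-> /asboolP]. Qed.

Lemma candidateP n a : a \in candidates (M n) -> a \in cor n \/ a \in inc n.
Proof.
move=> ac; case: (boolP (a \in cor n)) => h; [by left|right].
by rewrite /incorrect_models finset.in_setD h.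
Qed.

Lemma exc_gt0 n a : (0 < n)%N -> a \in inc n -> 0 < exc n a.
Proof.
move=> n0 ai.
by have [] := risk_excess (ax n0) (Htheta0 n0) a (C2_theta n0 ai).
Qed.

(** Each excess risk is one term of a vanishing sum of inverse powers. *)
Lemma excess_large K : 0 < K ->
  \forall n \near \oo, forall a, a \in inc n -> K <= exc n a.
Proof.
move=> K0; have K1 : 0 < (K `^ q)^-1 by rewrite invr_gt0 powR_gt0.
near=> n => a ai.
have n0 : (0 < n)%N by near: n; exact: nbhs_infty_gt.
have x0 := exc_gt0 n0 ai.
have sK : \sum_(a in inc n) (exc n a `^ q)^-1 <= (K `^ q)^-1.
  apply: le_trans (ler_norm _) _; near: n.
  by move/cvgr0Pnorm_le : C3; apply.
have : (exc n a `^ q)^-1 <= (K `^ q)^-1.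
  apply: le_trans sK; rewrite (bigD1 a) //= lerDl sumr_ge0 // => b _.
  by rewrite invr_ge0 powR_ge0.
rewrite lef_pV2 ?posrE ?powR_gt0 // => Kx.
rewrite leNgt; apply/negP => xK; move: Kx; apply/negP; rewrite -ltNge.
by apply: gt0_ltr_powR => //; rewrite nnegrE ltW.
Unshelve. all: by end_near. Qed.

Lemma dim_small dl : 0 < dl ->
  \forall n \near \oo, forall a, a \in inc n -> dim n <= dl * exc n a.
Proof.
move=> dl0; have d2 : 0 < dl / 2 by rewrite divr_gt0.
near=> n => a ai.
have n0 : (0 < n)%N by near: n; exact: nbhs_infty_gt.
have x0 := exc_gt0 n0 ai.
have h1 : 2 / dl <= exc n a.
  by move: a ai {x0}; near: n; apply: excess_large; rewrite divr_gt0.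
have h2 : (nvar (M n))%:R / exc n a <= dl / 2.
  apply: (@le_trans _ _ (\big[Order.max/0]_(a in inc n) ((nvar (M n))%:R / exc n a))).
    exact: (le_bigmax_cond _ (fun a => (nvar (M n))%:R / exc n a) ai).
  apply: le_trans (ler_norm _) _; near: n.
  by move/cvgr0Pnorm_le : C4'; apply.
rewrite natrD; move: h1 h2; rewrite !ler_pdivrMr // => h1 h2; lra.
Unshelve. all: by end_near. Qed.

(** The tails are exponentially small in the excess risk, hence summable
    against its inverse power: a union bound over the models suffices. *)
Lemma bias_vanishing dl : 0 < dl ->
  vanishing P (fun n => [set w | exists2 a, a \in inc n & dl * exc n a <= `|bias n a w|]).
Proof.
move=> dl0.
have [K K0 Kp] := @expRN_le_powR R (dl ^+ 2 / (4 * c)) q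
  (divr_gt0 (exprn_gt0 2 dl0) (mulr_gt0 (ltr0n _ 4) c_gt0)) q_gt0.
apply: (@vanishing_exists _ _ _ P (fun n => {set 'I_(nvar (M n))}) (fun n => inc n)
  (fun n a => [set w | dl * exc n a <= `|bias n a w|])
  (fun n a => 2 * K * (exc n a `^ q)^-1)).
  near=> n => a ai.
  have n0 : (0 < n)%N by near: n; exact: nbhs_infty_gt.
  have x0 := exc_gt0 n0 ai; have tth := C2_theta n0 ai.
  have [_ bx] := risk_excess (ax n0) (Htheta0 n0) a tth.
  have domn : forall th, Theta th -> forall u : 'cV[R]_n,
     qform (Sigma0 (M n)) u <= c * qform (Sigma (M n) th) u by near: n.
  have bv := bias_variance_le (ax n0) n0 a tth (domn _ tth).
  set u := (W n (tha a) - hat n a (tha a)) *m mu0 (M n) in bv.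
  have qx : qform (Sigma0 (M n)) u <= 2 * c * exc n a.
    apply: le_trans bv _; rewrite (_ : 2 * c * exc n a = c * (2 * exc n a)); last by ring.
    by rewrite ler_pM2l.
  have [mE PE] := err_gaussian_tail (ax n0) c_gt0 dl0 qx.
  have biasE w : bias n a w = (u^T *m e n w) 0 0.
    rewrite /u trmx_mul.
    by rewrite (gls_resid_sym (Xsub a) (posdef_inv (Sigma_posdef (ax n0) tth))).
  under eq_set do rewrite biasE.
  split=> //; apply: le_trans PE _; rewrite lee_fin -[leRHS]mulrA ler_pM2l //.
  exact: Kp.
under eq_fun do rewrite -mulr_sumr.
have : (fun n => 2 * K * \sum_(a in inc n) (exc n a `^ q)^-1) @ \oo --> (2 * K * 0 : R).
  by apply: cvgM; [exact: cvg_cst|exact: C3].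
by rewrite mulr0.
Unshelve. all: by end_near. Qed.

(** As for the bias term; the factor [2 ^+ (1 + nvar)] of the exponential
    moment is absorbed because the dimension is negligible with respect to the
    excess risk. *)
Lemma fit_vanishing dl : 0 < dl ->
  vanishing P (fun n => [set w | exists2 a, a \in inc n &
    dl * exc n a <= qform (hat n a (tha a)) (e n w)]).
Proof.
(* the exponent for which s * c = 3 / 8, the largest that fit_exp_tail allows *)
move=> dl0; pose s := 3 / (8 * c).
have s0 : 0 < s by rewrite divr_gt0 // mulr_gt0.
have sd0 : 0 < s * dl / 2 by rewrite divr_gt0 // mulr_gt0.
have [K K0 Kp] := @expRN_le_powR R (s * dl / 2) q sd0 q_gt0.
apply: (@vanishing_exists _ _ _ P (fun n => {set 'I_(nvar (M n))}) (fun n => inc n)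
  (fun n a => [set w | dl * exc n a <= qform (hat n a (tha a)) (e n w)])
  (fun n a => K * (exc n a `^ q)^-1)).
  near=> n => a ai.
  have n0 : (0 < n)%N by near: n; exact: nbhs_infty_gt.
  have x0 := exc_gt0 n0 ai; have tth := C2_theta n0 ai.
  have domn : forall th, Theta th -> forall u : 'cV[R]_n,
     qform (Sigma0 (M n)) u <= c * qform (Sigma (M n) th) u by near: n.
  have dimn : dim n <= s * dl / 2 * exc n a.
    by move: a ai {x0 tth}; near: n; exact: dim_small.
  have sc : s * c <= 3 / 8.
    by rewrite /s le_eqVlt; apply/orP; left; apply/eqP; field; rewrite gt_eqF.
  have [mE PE] := fit_exp_tail (ax n0) a tth (domn _ tth) (dl * exc n a) s0 sc.
  split=> //; apply: le_trans PE _; rewrite lee_fin.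
  apply: le_trans (Kp _ x0).
  have -> : - (s * dl / 2 * exc n a) = s * dl / 2 * exc n a - s * (dl * exc n a) by field.
  (* half of the exponent s * dl * x pays for 2 ^+ dim, by 2 <= expR 1 *)
  rewrite expRD ler_pM2r ?expR_gt0 //.
  apply: (@le_trans _ _ (expR 1 ^+ (1 + nvar (M n)))).
    by rewrite lerXn2r ?nnegrE ?expR_ge0 //; have := @expR_ge1Dx R 1.
  by rewrite -expRM_natl mulr1 ler_expR.
under eq_fun do rewrite -mulr_sumr.
have : (fun n => K * \sum_(a in inc n) (exc n a `^ q)^-1) @ \oo --> (K * 0 : R).
  by apply: cvgM; [exact: cvg_cst|exact: C3].
by rewrite mulr0.
Unshelve. all: by end_near. Qed.

Lemma measurable_preimage_cst (t : 'rV[R]_k) (U : set 'rV[R]_k) :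
  measurable ((fun _ : T => t) @^-1` U).
Proof.
have [Ut|nUt] := pselect (U t).
  rewrite (_ : _ @^-1` _ = setT); first exact: measurableT.
  by apply/seteqP; split.
rewrite (_ : _ @^-1` _ = set0); first exact: measurable0.
by apply/seteqP; split.
Qed.

Section measurability.
Variables (n : nat) (n0 : (0 < n)%N) (a : {set 'I_(nvar (M n))}).

Lemma measurable_loglik_hat : a \in candidates (M n) ->
  measurable_fun setT (fun w => loglik a (thetahat a w) w).
Proof. by move=> /(HMLE n0)[m t _]; exact: (measurable_loglik (ax n0) m t). Qed.

Lemma measurable_Loss_hat : a \in candidates (M n) ->
  measurable_fun setT (fun w => Loss a (thetahat a w) w).
Proof. by move=> /(HMLE n0)[m t _]; exact: (measurable_Loss (ax n0) m t). Qed.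

Lemma measurable_loglik_fixed th : Theta th -> measurable_fun setT (loglik a th).
Proof.
move=> t; exact: (measurable_loglik (ax n0) (fun U _ => measurable_preimage_cst th U)
  (fun _ => t)).
Qed.

Lemma measurable_Loss_fixed th : Theta th -> measurable_fun setT (Loss a th).
Proof.
move=> t; exact: (measurable_Loss (ax n0) (fun U _ => measurable_preimage_cst th U)
  (fun _ => t)).
Qed.

End measurability.

Lemma bigmax_ratio_le n (f : {set 'I_(nvar (M n))} -> R) dl : (0 < n)%N ->
  ~ dl < `|\big[Order.max/0]_(a in inc n) `|f a / exc n a| | ->
  forall a, a \in inc n -> `|f a| <= dl * exc n a.
Proof.
move=> n0 /negP; rewrite -leNgt => h a ai; have x0 := exc_gt0 n0 ai.
have : `|f a / exc n a| <= dl.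
  apply: le_trans (le_trans (ler_norm _) h).
  exact: (le_bigmax_cond _ (fun a => `|f a / exc n a|) ai).
by rewrite normrM normfV (gtr0_norm x0) ler_pdivrMr.
Qed.

Definition incorrect_regular dl n w := forall a, a \in inc n ->
  `|GG n a w - LL n a w| <= dl * exc n a /\
  `|LL n a w - L0 (M n) (theta0 n) - exc n a| <= dl * exc n a.

(** Five events of vanishing probability are excluded, for the two errors of
    estimation, the covariance term, the bias term and the fit; the mean of the
    fit and the penalty are negligible because the dimension is. *)
Lemma incorrect_regular_whp dl : 0 < dl ->
  vanishing P (fun n => [set w | ~ incorrect_regular dl n w]).
Proof.
(* incorrect_criterion multiplies the common error by 6 *)
move=> dl0; pose d6 := dl / 6; have d60 : 0 < d6 by rewrite divr_gt0.
have npos : \forall n \near \oo, (0 < n)%N by exact: nbhs_infty_gt.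
have v1 := o_p_vanishing C2_loglik d60.
have v2 := o_p_vanishing C2_Loss d60.
have v3 := o_p_vanishing C5 d60.
have m1 : \forall n \near \oo, measurable_fun setT (fun w =>
  \big[Order.max/0]_(a in inc n)
    `|(loglik a (thetahat a w) w - loglik a (tha a) w) / exc n a|).
  near=> n; have n0 : (0 < n)%N by near: n.
  apply: measurable_bigmax => a ai; apply: measurableT_comp => //.
  apply: measurable_funM => //; apply: measurable_funB.
    exact: (measurable_loglik_hat n0 (inc_candidate ai)).
  exact: (measurable_loglik_fixed n0 _ (C2_theta n0 ai)).
have m2 : \forall n \near \oo, measurable_fun setT (fun w =>
  \big[Order.max/0]_(a in inc n)
    `|(Loss a (thetahat a w) w - Loss a (tha a) w) / exc n a|).
  near=> n; have n0 : (0 < n)%N by near: n.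
  apply: measurable_bigmax => a ai; apply: measurableT_comp => //.
  apply: measurable_funM => //; apply: measurable_funB.
    exact: (measurable_Loss_hat n0 (inc_candidate ai)).
  exact: (measurable_Loss_fixed n0 _ (C2_theta n0 ai)).
have m3 : \forall n \near \oo, measurable_fun setT (fun w =>
  \big[Order.max/0]_(a in inc n)
    `|\tr ((e n w *m (e n w)^T - Sigma0 (M n)) *m (W n (tha a) - W n (theta0 n)))
      / exc n a|).
  apply: nearW => n.
  apply: measurable_bigmax => a ai; apply: measurableT_comp => //.
  apply: measurable_funM => //; apply: measurable_trace.
  apply: measurable_mxM => //; apply: measurable_mxB => //.
  have me : measurable_mx (e n) by move=> i j; rewrite ord1; exact: measurable_err.
  by apply: measurable_mxM => //; exact: measurable_mxT.
apply: (vanishing_sub (vanishingU (vanishingU (vanishingU (v1 m1) (v2 m2)) (v3 m3))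
  (vanishingU (bias_vanishing d60) (fit_vanishing d60)))).
(* the divisor makes both the mean of the fit, at most c * dim, and the
   penalty, at most dim, smaller than d6 times the excess risk *)
have d6c : 0 < d6 / (c + 1) by rewrite divr_gt0 // ltr_pwDr // ltW.
near=> n => w bad.
have n0 : (0 < n)%N by near: n.
have dimn : forall a, a \in inc n -> dim n <= d6 / (c + 1) * exc n a.
  by near: n; exact: dim_small.
have domn : forall th, Theta th -> forall u : 'cV[R]_n,
   qform (Sigma0 (M n)) u <= c * qform (Sigma (M n) th) u by near: n.
apply: contrapT => good; apply: bad => a ai.
have x0 := exc_gt0 n0 ai; have tth := C2_theta n0 ai.
have dx := dimn a ai.
have dx1 : (c + 1) * dim n <= d6 * exc n a.
  have c1 : 0 < c + 1 by rewrite ltr_pwDr // ltW.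
  rewrite -(ler_pM2l c1) in dx; apply: le_trans dx _.
  by rewrite le_eqVlt; apply/orP; left; apply/eqP; field; rewrite gt_eqF.
have dim0 : 0 <= dim n by rewrite ler0n.
have [] := @incorrect_criterion _ _ _ P d k n (M n) Theta (ax n0) (theta0 n)
  a (tha a) (loglik a (thetahat a w) w) (LL n a w) d6 w tth; rewrite -?/(exc n a).
- apply: (@bigmax_ratio_le n (fun a => loglik a (thetahat a w) w - loglik a (tha a) w)) => //.
  by move=> h; apply: good; left; left; left.
- apply: (@bigmax_ratio_le n (fun a => LL n a w - Loss a (tha a) w)) => //.
  by move=> h; apply: good; left; left; right.
- rewrite leNgt; apply/negP => /ltW h; apply: good; right; left; by exists a.
- rewrite leNgt; apply/negP => /ltW h; apply: good; right; right; by exists a.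
- apply: (@bigmax_ratio_le n (fun a => \tr ((e n w *m (e n w)^T - Sigma0 (M n)) *m
    (W n (tha a) - W n (theta0 n))))) => //.
  by move=> h; apply: good; left; right.
- apply: le_trans (trace_fit_le (ax n0) n0 a tth (domn _ tth)) _.
  by apply: le_trans dx1; rewrite ler_wpM2r // lerDl.
- apply: le_trans (_ : dim n <= _).
    by rewrite ler_nat (leq_trans (max_card _)) // card_ord leq_addl.
  by apply: le_trans dx1; rewrite ler_peMl // lerDr ltW.
have -> : 6 * d6 = dl by rewrite /d6; field.
move=> h1 h2; split=> //; apply: le_trans h2 _; rewrite ler_wpM2r ?ltW //.
by rewrite /d6; lra.
Unshelve. all: by end_near. Qed.

Definition correct_regular K n w := forall a, a \in cor n ->
  `|GG n a w - LL n a w| <= K * dim n /\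
  `|LL n a w - L0 (M n) (theta0 n)| <= K * dim n.

Lemma bigmax_norm_le n (A : {set {set 'I_(nvar (M n))}})
    (f : {set 'I_(nvar (M n))} -> R) K :
  ~ K < `|\big[Order.max/0]_(a in A) `|f a| | -> forall a, a \in A -> `|f a| <= K.
Proof.
move=> /negP; rewrite -leNgt => h a aA; apply: le_trans (le_trans (ler_norm _) h).
exact: (le_bigmax_cond _ (fun a => `|f a|) aA).
Qed.

Lemma measurable_gt (f : T -> R) K : measurable_fun setT f ->
  measurable [set w | K < `|f w|].
Proof.
move=> mf; have -> : [set w | K < `|f w|] = setT `&` (fun w => `|f w|) @^-1` `]K, +oo[%classic.
  by rewrite setTI; apply/seteqP; split=> x /=; rewrite in_itv /= andbT.
have mN : measurable_fun setT (fun w => `|f w|) by exact: measurableT_comp.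
exact: mN.
Qed.

(** All the correct models are fitted at the same parameter, up to errors that
    are bounded in probability, so that one application of [full_fit_tail]
    bounds all of them at once, however many there are. *)
Lemma correct_regular_whp ep : 0 < ep -> exists2 K, 0 < K &
  \forall n \near \oo, exists B, [/\ measurable B, (P B <= ep%:E)%E &
    forall w, ~ B w -> correct_regular K n w].
Proof.
move=> ep0; pose e3 := ep / 3; have e30 : 0 < e3 by rewrite divr_gt0.
have [K1 hK1] := C2_loglik_correct e30; have [K2 hK2] := C2_Loss_correct e30.
pose K3 := c / e3; have K30 : 0 < K3 by rewrite divr_gt0.
pose K := `|K1| + `|K2| + K3.
have K0 : 0 < K by rewrite ltr_wpDl // addr_ge0.
have npos : \forall n \near \oo, (0 < n)%N by exact: nbhs_infty_gt.
exists (3 * K + 1); first by rewrite addr_gt0 // mulr_gt0.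
near=> n.
have n0 : (0 < n)%N by near: n.
have domn : forall th, Theta th -> forall u : 'cV[R]_n,
   qform (Sigma0 (M n)) u <= c * qform (Sigma (M n) th) u by near: n.
have tth := (Htheta0 n0).1.
have [B3 [mB3 PB3 hB3]] := full_fit_tail (ax n0) tth (domn _ tth) K30.
set B1 := [set w | K1 < `|\big[Order.max/0]_(a in cor n)
    `|loglik a (thetahat a w) w - loglik a (theta0 n) w| |].
set B2 := [set w | K2 < `|\big[Order.max/0]_(a in cor n)
    `|Loss a (thetahat a w) w - Loss a (theta0 n) w| |].
have mB1 : measurable B1.
  apply: measurable_gt; apply: measurable_bigmax => a /cor_candidate[ac _].
  apply: measurableT_comp => //; apply: measurable_funB.
    exact: (measurable_loglik_hat n0 ac).
  exact: (measurable_loglik_fixed n0 _ tth).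
have mB2 : measurable B2.
  apply: measurable_gt; apply: measurable_bigmax => a /cor_candidate[ac _].
  apply: measurableT_comp => //; apply: measurable_funB.
    exact: (measurable_Loss_hat n0 ac).
  exact: (measurable_Loss_fixed n0 _ tth).
have PB1 : (P B1 <= e3%:E)%E by rewrite /B1; near: n; exact: hK1.
have PB2 : (P B2 <= e3%:E)%E by rewrite /B2; near: n; exact: hK2.
exists (B1 `|` B2 `|` B3); split.
- by apply: measurableU => //; exact: measurableU.
- apply: le_trans (measureU2 _ (measurableU _ _ mB1 mB2) mB3) _.
  have h := measureU2 P mB1 mB2.
  apply: le_trans (leeD (le_trans h (leeD PB1 PB2)) PB3) _.
  rewrite -!EFinD lee_fin /K3.
  have -> : c / (c / e3) = e3 by field; rewrite !gt_eqF.
  by rewrite /e3; lra.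
move=> w good a ac; have [acand aco] := cor_candidate ac.
have K1K : K1 <= K.
  by apply: le_trans (ler_norm _) _; rewrite /K -addrA lerDl addr_ge0 // ltW.
have K2K : K2 <= K.
  apply: le_trans (ler_norm _) _; rewrite /K -addrA addrCA lerDl addr_ge0 //.
  exact: ltW.
have K3K : K3 <= K by rewrite /K lerDr addr_ge0.
apply: (@correct_criterion _ _ _ P d k n (M n) Theta (ax n0) (theta0 n)
  (Htheta0 n0) a (loglik a (thetahat a w) w) (LL n a w) K w aco (ltW K0)).
- apply: le_trans K1K.
  apply: (@bigmax_norm_le n (cor n)
    (fun a => loglik a (thetahat a w) w - loglik a (theta0 n) w)) => //.
  by move=> h; apply: good; left; left.
- apply: le_trans K2K.
  apply: (@bigmax_norm_le n (cor n)
    (fun a => LL n a w - Loss a (theta0 n) w)) => //.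
  by move=> h; apply: good; left; right.
have wB3 : ~ B3 w by move=> h; apply: good; right.
by apply: le_trans (hB3 w wB3 a) _; rewrite ler_wpM2r ?ler0n.
Unshelve. all: by end_near. Qed.

Lemma regular_whp ep dl : 0 < ep -> 0 < dl -> exists2 K, 0 < K &
  \forall n \near \oo, exists B, [/\ measurable B, (P B <= ep%:E)%E &
    forall w, ~ B w -> incorrect_regular dl n w /\ correct_regular K n w].
Proof.
move=> ep0 dl0; have e20 : 0 < ep / 2 by rewrite divr_gt0.
have [K K0 hK] := correct_regular_whp e20; exists K => //; near=> n.
have [B1 [mB1 PB1 h1]] : exists B, [/\ measurable B, (P B <= (ep / 2)%:E)%E &
    forall w, ~ B w -> correct_regular K n w] by near: n.
have [B2 [mB2 h2 PB2]] : exists B, [/\ measurable B,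
    [set w | ~ incorrect_regular dl n w] `<=` B & (P B <= (ep / 2)%:E)%E].
  by near: n; exact: incorrect_regular_whp.
exists (B1 `|` B2); split; first exact: measurableU.
  apply: le_trans (measureU2 _ mB1 mB2) _; apply: le_trans (leeD PB1 PB2) _.
  by rewrite -EFinD lee_fin -splitr.
move=> w good; split; last by apply: h1 => h; apply: good; left.
by apply: contrapT => h; apply: good; right; exact: h2.
Unshelve. all: by end_near. Qed.

Lemma L0_theta0_gt0 n : (0 < n)%N -> 0 < L0 (M n) (theta0 n).
Proof. by move=> n0; apply: (L0_gt0 (ax n0) (Htheta0 n0).1); exact: Hmis. Qed.

Lemma L0_le_Loss_hat n a w : (0 < n)%N -> a \in candidates (M n) ->
  L0 (M n) (theta0 n) <= LL n a w.
Proof.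
move=> n0 ac; have [_ tth _] := HMLE n0 ac.
by apply: le_trans (L0_le_Loss (ax n0) a (tth w) w); exact: (Htheta0 n0).2.
Qed.

Lemma GIC_minimal n w a : (0 < n)%N -> a \in candidates (M n) ->
  GG n (ahat n w) w <= GG n a w.
Proof.
move=> n0 ac; have [_ _ /(_ w a ac)] := HGIC n0; rewrite /GIC.
move: (loglik _ _ _) (loglik _ _ _) (#|ahat n w|%:R : R) (#|a|%:R : R) => l1 l2 p1 p2.
move: (common_deviance _ _ _) => k1; lra.
Qed.

Lemma gic_loss_ratio n w eta : (0 < n)%N -> 0 <= eta -> eta <= 2^-1 ->
  (forall a, a \in candidates (M n) -> `|GG n a w - LL n a w| <= eta * LL n a w) ->
  `|LL n (ahat n w) w / min_loss (@thetahat n) w - 1| <= 4 * eta.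
Proof.
move=> n0 e0 e1 h; have [_ hc _] := HGIC n0.
apply: (@criterion_loss_ratio _ _ (candidates (M n)) (ahat n w)
  (fun a => GG n a w) (fun a => LL n a w)) => //.
- by move=> a ac; apply: lt_le_trans (L0_le_Loss_hat w n0 ac); exact: L0_theta0_gt0.
- by move=> a ac; exact: GIC_minimal.
Qed.

Lemma loss_minimal_ratio n w : (0 < n)%N ->
  (forall a, a \in candidates (M n) -> LL n (ahat n w) w <= LL n a w) ->
  `|LL n (ahat n w) w / min_loss (@thetahat n) w - 1| <= 0.
Proof.
move=> n0 h; have [_ hc _] := HGIC n0.
rewrite -[leRHS](mulr0 4).
apply: (@criterion_loss_ratio _ _ (candidates (M n)) (ahat n w)
  (fun a => LL n a w) (fun a => LL n a w)) => //.
- by move=> a ac; apply: lt_le_trans (L0_le_Loss_hat w n0 ac); exact: L0_theta0_gt0.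
- by move=> a _; rewrite subrr normr0 mul0r.
Qed.

Lemma measurable_loss_ratio n : (0 < n)%N -> measurable_fun setT
  (fun w => LL n (ahat n w) w / min_loss (@thetahat n) w - 1).
Proof.
move=> n0; have [ma hc _] := HGIC n0.
have [w0|w0] := pselect (exists w : T, True); last first.
  by move=> _ B mB; rewrite (_ : _ `&` _ = set0) //; apply/seteqP; split=> w //; case: w0; exists w.
have [w1 _] := w0.
have LE : (fun w => LL n (ahat n w) w) = fun w =>
    \sum_(a in candidates (M n)) \1_(ahat n @^-1` [set a]) w * LL n a w.
  apply/funext => w; rewrite (bigD1 (ahat n w)) //= indicE mem_set // mul1r.
  rewrite big1 ?addr0 // => a /andP[_ aw]; rewrite indicE memNset ?mul0r //=.
  by move=> h; move: aw; rewrite h eqxx.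
have mE : min_loss (@thetahat n) = fun w =>
    \big[Order.min/LL n (ahat n w1) w]_(a in candidates (M n)) LL n a w.
  apply/funext => w; apply/eqP; rewrite eq_le; apply/andP; split.
    have lb a : a \in candidates (M n) -> min_loss (@thetahat n) w <= LL n a w.
      move=> ac; apply: ge_inf; last by exists a.
      by exists (L0 (M n) (theta0 n)) => _ [b bc <-]; exact: L0_le_Loss_hat.
    by apply/bigmin_geP; split=> [|a ac]; exact: lb.
  apply: lb_le_inf; first by exists (LL n (ahat n w1) w), (ahat n w1) => //; exact: hc.
  by move=> _ [b bc <-]; exact: bigmin_le_cond.
apply: measurable_funB => //; apply: measurable_funM.
  rewrite LE; under eq_fun do rewrite big_mkcond.
  apply: measurable_sum => a; case: (boolP (a \in candidates (M n))) => // ac.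
  apply: measurable_funM; last exact: (measurable_Loss_hat n0 ac).
  by apply: measurable_indic; exact: ma.
apply: measurable_funV; rewrite mE; apply: measurable_bigmin.
  exact: (measurable_Loss_hat n0 (hc w1)).
by move=> a ac; exact: (measurable_Loss_hat n0 ac).
Qed.

Lemma loss_efficient_of_vanishing :
  (forall ep, 0 < ep -> vanishing P (fun n => [set w |
    ep < `|LL n (ahat n w) w / min_loss (@thetahat n) w - 1|])) ->
  asymptotically_loss_efficient thetahat ahat.
Proof.
move=> h ep ep0; apply: vanishing_cvg0; first exact: h.
near=> n; apply: measurable_gt; apply: measurable_loss_ratio.
by near: n; exact: nbhs_infty_gt.
Unshelve. all: by end_near. Qed.

(** With a single correct model, the excess risks of the incorrect ones
    dominate its own fluctuations: it wins, and it has the least loss. *)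
Lemma unique_correct_selected dl K n w a : (0 < n)%N -> dl < 4^-1 ->
  incorrect_regular dl n w -> correct_regular K n w ->
  (forall b, b \in inc n -> K * dim n <= dl * exc n b) ->
  cor n = [set a]%SET -> ahat n w = a /\
  forall b, b \in candidates (M n) -> LL n a w <= LL n b w.
Proof.
move=> n0 dl4 hi hc Kd cE; have [_ hcand _] := HGIC n0.
have ac : a \in cor n by rewrite cE finset.set11.
have [aC _] := cor_candidate ac.
have [] := hc a ac; rewrite !ler_norml => /andP[g1 g2] /andP[l1 l2].
split.
  have [|h] := candidateP (hcand w); first by rewrite cE => /finset.set1P.
  have x0 := exc_gt0 n0 h; have d0 := Kd _ h.
  have [] := hi _ h; rewrite !ler_norml => /andP[g3 g4] /andP[l3 l4].
  have gm := GIC_minimal w n0 aC.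
  have : exc n (ahat n w) <= 4 * dl * exc n (ahat n w).
    move: g1 g2 l1 l2 g3 g4 l3 l4 gm d0.
    move: (GG n (ahat n w) w) (GG n a w) (LL n (ahat n w) w) (LL n a w) => ? ? ? ?.
    move: (K * dim n) (exc n (ahat n w)) (L0 _ _) => ? x ?.
    lra.
  by rewrite leNgt gtr_pMl // -ltr_pdivlMl // mulr1 dl4.
move=> b bC; have [|h] := candidateP bC; first by rewrite cE => /finset.set1P ->.
have x0 := exc_gt0 n0 h; have d0 := Kd _ h.
have [] := hi _ h; rewrite !ler_norml => _ /andP[l3 l4].
have d4 : dl * exc n b <= 4^-1 * exc n b by rewrite ler_wpM2r // ltW.
move: l1 l2 l3 l4 d0 d4 x0.
move: (LL n a w) (LL n b w) (K * dim n) (dl * exc n b) (exc n b) (L0 _ _) => ? ? ? ? ? ?.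
lra.
Qed.

Lemma dim_negligible K dl : 0 < K -> 0 < dl ->
  \forall n \near \oo, forall b, b \in inc n -> K * dim n <= dl * exc n b.
Proof.
move=> K0 dl0; near=> n => b bi.
have h : dim n <= dl / K * exc n b.
  by move: b bi; near: n; apply: dim_small; rewrite divr_gt0.
have -> : dl * exc n b = K * (dl / K * exc n b) by field; rewrite gt_eqF.
by rewrite ler_pM2l.
Unshelve. all: by end_near. Qed.

(** The loss of a regular incorrect model is at least half of its excess
    risk. *)
Lemma incorrect_ratio dl n w a : (0 < n)%N -> 0 < dl -> dl <= 2^-1 ->
  incorrect_regular dl n w -> a \in inc n ->
  `|GG n a w - LL n a w| <= 2 * dl * LL n a w.
Proof.
move=> n0 dl0 dl2 hi ai; have x0 := exc_gt0 n0 ai; have [h1] := hi a ai.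
rewrite ler_norml => /andP[h2 h3]; apply: le_trans h1 _.
have L00 := L0_theta0_gt0 n0.
rewrite [2 * dl]mulrC -mulrA ler_pM2l //.
have : dl * exc n a <= 2^-1 * exc n a by rewrite ler_wpM2r // ltW.
move: h2 h3 L00; move: (LL n a w) (L0 (M n) (theta0 n)) => ? ?.
move: (dl * exc n a) => ?; move: (exc n a) => ?; lra.
Qed.

(** With no correct model, the criterion is the loss up to a small factor for
    all candidates. With exactly one, its own loss may be of the order of the
    fluctuations, but it is selected and has the least loss. *)
Theorem efficient_at_most_one_correct :
  (\forall n \near \oo, (#|cor n| <= 1)%N) ->
  asymptotically_loss_efficient thetahat ahat.
Proof.
move=> cor1; apply: loss_efficient_of_vanishing => e0 e00 ep ep0.
(* the relative error 2 * dl becomes 4 * (2 * dl) <= e0 in the loss ratio, and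
   must be at most 1 / 2 *)
pose dl := Num.min (8^-1) (e0 / 8).
have dl0 : 0 < dl by rewrite lt_min invr_gt0 ltr0n divr_gt0.
have dl8 : dl <= 8^-1 by rewrite ge_min lexx.
have dle : dl <= e0 / 8 by rewrite ge_min lexx orbT.
have [K K0 hK] := regular_whp ep0 dl0.
near=> n.
have n0 : (0 < n)%N by near: n; exact: nbhs_infty_gt.
have Kd : forall b, b \in inc n -> K * dim n <= dl * exc n b.
  by near: n; exact: dim_negligible.
have [B [mB PB hB]] : exists B, [/\ measurable B, (P B <= ep%:E)%E &
    forall w, ~ B w -> incorrect_regular dl n w /\ correct_regular K n w].
  by near: n.
have c1 : (#|cor n| <= 1)%N by near: n.
exists B; split=> // w /= hw; apply: contrapT => /hB[hi hc].
move: hw; apply/negP; rewrite -leNgt.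
move: c1; rewrite leq_eqVlt ltnS leqn0 => /orP[/cards1P[a cE]|c0]; last first.
  apply: (@le_trans _ _ (4 * (2 * dl))); last by move: dle; lra.
  apply: gic_loss_ratio => //; [by rewrite mulr_ge0 // ltW|by move: dl8; lra|].
  move=> a /candidateP[|]; first by rewrite (cards0_eq (eqP c0)) finset.inE.
  by apply: incorrect_ratio => //; move: dl8; lra.
have dl4 : dl < 4^-1 by move: dl8; lra.
have [ha hmin] := unique_correct_selected n0 dl4 hi hc Kd cE.
apply: le_trans (ltW e00); apply: loss_minimal_ratio => // b bc.
by rewrite ha; exact: hmin.
Unshelve. all: by end_near. Qed.

Lemma smallest_correct_unique n a : cor n = [set a]%SET -> smallest_correct (M n) = a.
Proof.
move=> cE; rewrite /smallest_correct; case: pickP => [b /andP[]|/(_ a)].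
  by rewrite cE => /finset.set1P.
rewrite cE finset.set11 /= => /negP; case.
by apply/forall_inP => b /finset.set1P ->.
Qed.

Theorem consistent_one_correct :
  (\forall n \near \oo, #|cor n| = 1%N) -> consistent ahat.
Proof.
move=> cor1; pose dl : R := 8^-1.
have dl0 : 0 < dl by rewrite invr_gt0.
pose E n := [set w | ahat n w = smallest_correct (M n)].
have mE : \forall n \near \oo, measurable (E n).
  near=> n; have n0 : (0 < n)%N by near: n; exact: nbhs_infty_gt.
  by have [ma _ _] := HGIC n0; exact: ma.
have vE : vanishing P (fun n => ~` E n).
  move=> ep ep0; have [K K0 hK] := regular_whp ep0 dl0.
  near=> n.
  have n0 : (0 < n)%N by near: n; exact: nbhs_infty_gt.
  have Kd : forall b, b \in inc n -> K * dim n <= dl * exc n b.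
    by near: n; exact: dim_negligible.
  have [B [mB PB hB]] : exists B, [/\ measurable B, (P B <= ep%:E)%E &
      forall w, ~ B w -> incorrect_regular dl n w /\ correct_regular K n w].
    by near: n.
  have /eqP/cards1P[a cE] : #|cor n| = 1%N by near: n.
  exists B; split=> // w /= hw; apply: contrapT => /hB[hi hc]; apply: hw.
  rewrite /E /= (smallest_correct_unique cE).
  have dl4 : dl < 4^-1 by rewrite /dl ltf_pV2 ?posrE // ltr_nat.
  by have [] := unique_correct_selected n0 dl4 hi hc Kd cE.
have vE0 : P (~` E n) @[n --> \oo] --> 0%E.
  apply: vanishing_cvg0 => //; near=> n; apply: measurableC; near: n; exact: mE.
rewrite /consistent -/(E _); apply/fine_cvgP; split.
  by near=> n; apply: fin_num_measure; near: n; exact: mE.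
have /fine_cvgP[_ h] := vE0.
have : (fun n => 1 - fine (P (~` E n))) @ \oo --> (1 - 0 : R).
  by apply: cvgB; [exact: cvg_cst|exact: h].
rewrite subr0; apply: cvg_trans; apply: near_eq_cvg; near=> n.
have mEn : measurable (E n) by near: n; exact: mE.
rewrite /= probability_setC // fineB //; last exact: fin_num_measure.
by rewrite /= opprB addrCA subrr addr0.
Unshelve. all: by end_near. Qed.

(** The fluctuations of the correct models are bounded by a multiple of the
    dimension, which is negligible with respect to [L0 (theta0 n)], a lower
    bound of every loss. *)
Theorem efficient_many_correct :
  (\forall n \near \oo, (2 <= #|cor n|)%N) ->
  (exists2 r : R, 0 < r & (fun n => #|cor n|%:R `^ r : R^o) =o_\oo
     (fun n => L0 (M n) (theta0 n) : R^o)) ->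
  ((nvar (M n))%:R / L0 (M n) (theta0 n)) @[n --> \oo] --> (0 : R) ->
  asymptotically_loss_efficient thetahat ahat.
Proof.
move=> cor2 [r r0 /eqoP hr] hp; apply: loss_efficient_of_vanishing => e0 e00 ep ep0.
(* the relative error 2 * dl becomes 4 * (2 * dl) <= e0 in the loss ratio, and
   must be at most 1 / 2 *)
pose dl := Num.min (8^-1) (e0 / 8).
have dl0 : 0 < dl by rewrite lt_min invr_gt0 ltr0n divr_gt0.
have dl8 : dl <= 8^-1 by rewrite ge_min lexx.
have dle : dl <= e0 / 8 by rewrite ge_min lexx orbT.
have [K K0 hK] := regular_whp ep0 dl0.
have d2 : 0 < dl / (2 * K) by rewrite divr_gt0 // mulr_gt0.
near=> n.
have n0 : (0 < n)%N by near: n; exact: nbhs_infty_gt.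
have L00 := L0_theta0_gt0 n0.
have KL : K * dim n <= dl * L0 (M n) (theta0 n).
  (* L0 tends to infinity because the number of correct models is at least 1 *)
  have h1 : (1 : R) <= dl / (2 * K) * L0 (M n) (theta0 n).
    have hn : `|#|cor n|%:R `^ r| <= dl / (2 * K) * `|L0 (M n) (theta0 n)|.
      by near: n; exact: hr.
    rewrite (gtr0_norm L00) in hn; apply: le_trans hn.
    apply: le_trans (ler_norm _); rewrite -[leLHS](_ : 1 `^ r = 1); last by rewrite powR1.
    apply: ge0_ler_powR; rewrite ?nnegrE //; first exact: ltW.
    by rewrite ler1n ltnW //; near: n.
  have h2 : (nvar (M n))%:R / L0 (M n) (theta0 n) <= dl / (2 * K).
    apply: le_trans (ler_norm _) _; near: n.
    by move/cvgr0Pnorm_le : hp; apply.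
  rewrite ler_pdivrMr // in h2.
  rewrite natrD mulrDr mulr1.
  have -> : dl * L0 (M n) (theta0 n) = K * (dl / (2 * K) * L0 (M n) (theta0 n))
     + K * (dl / (2 * K) * L0 (M n) (theta0 n)) by field; rewrite gt_eqF.
  by rewrite lerD // ?ler_pM2l // -[leLHS]mulr1 ler_pM2l.
have [B [mB PB hB]] : exists B, [/\ measurable B, (P B <= ep%:E)%E &
    forall w, ~ B w -> incorrect_regular dl n w /\ correct_regular K n w].
  by near: n.
exists B; split=> // w /= hw; apply: contrapT => /hB[hi hc].
move: hw; apply/negP; rewrite -leNgt.
apply: (@le_trans _ _ (4 * (2 * dl))); last by move: dle; lra.
apply: gic_loss_ratio => //; [by rewrite mulr_ge0 // ltW|by move: dl8; lra|].
move=> a ac; have [aco|ai] := candidateP ac; last first.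
  by apply: incorrect_ratio => //; move: dl8; lra.
have [h _] := hc a aco; apply: le_trans h _; apply: le_trans KL _.
have LL0 := L0_le_Loss_hat w n0 ac.
rewrite (_ : 2 * dl * LL n a w = dl * (2 * LL n a w)); last by ring.
rewrite ler_pM2l //; apply: le_trans LL0 _.
by rewrite ler_peMl ?ler1n // (le_trans (ltW L00) (L0_le_Loss_hat w n0 ac)).
Unshelve. all: by end_near. Qed.

End gic_selection.

Theorem theorem4p1
  (disp : measure_display) (T : measurableType disp) (R : realType)
  (P : probability T R) (d k : nat)
  (Theta : set 'rV[R]_k)
  (M : forall n : nat, georeg P d k n)
  (thetahat : forall n : nat, {set 'I_(nvar (M n))} -> T -> 'rV[R]_k)
  (ahat : forall n : nat, T -> {set 'I_(nvar (M n))})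
  (theta0 : nat -> 'rV[R]_k)
  (theta_ : set nat -> 'rV[R]_k)
  (Hsetting : forall n, (0 < n)%N -> georeg_axioms (M n) Theta)
  (HMLE : forall n, (0 < n)%N -> forall a, a \in candidates (M n) ->
     is_MLE Theta a (thetahat n a))
  (HGIC : forall n, (0 < n)%N -> is_GIC_selection 2 (thetahat n) (ahat n))
  (Htheta0 : forall n, (0 < n)%N -> is_theta0 (M n) Theta (theta0 n))
  (Hmisspecified : forall n, (0 < n)%N ->
     Sigma0 (M n) <> Sigma (M n) (theta0 n))
  (* C1 *)
  (C1_min : forall n, (0 < n)%N -> forall th, Theta th ->
     0 < lambda_min (Sigma (M n) th))
  (C1_max : (limn_esup (fun n => ereal_sup
     [set (lambda_max (psd_sqrt (invmx (Sigma (M n) th)) *m Sigma0 (M n)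
             *m psd_sqrt (invmx (Sigma (M n) th))))%:E | th in Theta])
     < +oo)%E)
  (* C2 *)
  (C2_theta : forall n, (0 < n)%N -> forall a, a \in incorrect_models (M n) ->
     Theta (theta_ (labels a)))
  (C2_loglik : o_p P (fun n w =>
     \big[Order.max/0]_(a in incorrect_models (M n))
       `|(loglik a (thetahat n a w) w - loglik a (theta_ (labels a)) w)
         / excess theta_ (theta0 n) a|))
  (C2_Loss : o_p P (fun n w =>
     \big[Order.max/0]_(a in incorrect_models (M n))
       `|(Loss a (thetahat n a w) w - Loss a (theta_ (labels a)) w)
         / excess theta_ (theta0 n) a|))
  (C2_loglik_correct : O_p P (fun n w =>
     \big[Order.max/0]_(a in correct_models (M n))
       `|loglik a (thetahat n a w) w - loglik a (theta0 n) w|))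
  (C2_Loss_correct : O_p P (fun n w =>
     \big[Order.max/0]_(a in correct_models (M n))
       `|Loss a (thetahat n a w) w - Loss a (theta0 n) w|))
  (* C3 *)
  (C3 : exists2 q : R, 0 < q &
     (\sum_(a in incorrect_models (M n)) (excess theta_ (theta0 n) a `^ q)^-1)
       @[n --> \oo] --> (0 : R))
  (* C4' *)
  (C4' : (\big[Order.max/0]_(a in incorrect_models (M n))
            ((nvar (M n))%:R / excess theta_ (theta0 n) a)) @[n --> \oo] --> (0 : R))
  (* C5 *)
  (C5 : o_p P (fun n w =>
     \big[Order.max/0]_(a in incorrect_models (M n))
       `|\tr ((errvec (M n) w *m (errvec (M n) w)^T - Sigma0 (M n))
              *m (invmx (Sigma (M n) (theta_ (labels a)))
                  - invmx (Sigma (M n) (theta0 n))))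
         / excess theta_ (theta0 n) a|)) :
  [/\ (\forall n \near \oo, (#|correct_models (M n)| <= 1)%N) ->
        asymptotically_loss_efficient thetahat ahat,
      (\forall n \near \oo, #|correct_models (M n)| = 1%N) ->
        consistent ahat &
      (\forall n \near \oo, (2 <= #|correct_models (M n)|)%N) ->
      (exists2 q : R, 0 < q &
         (fun n => #|correct_models (M n)|%:R `^ q : R^o) =o_\oo
           (fun n => L0 (M n) (theta0 n) : R^o)) ->
      ((nvar (M n))%:R / L0 (M n) (theta0 n)) @[n --> \oo] --> (0 : R) ->
        asymptotically_loss_efficient thetahat ahat ].
Proof.
have [c c0 dom] := covariance_dominated Hsetting C1_max.
have [q q0 C3q] := C3.
split=> [h|h|h1 h2 h3].
- by apply: (efficient_at_most_one_correct Hsetting HMLE HGIC Htheta0 Hmisspecified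
    C2_theta c0 dom C2_loglik C2_Loss C2_loglik_correct C2_Loss_correct q0 C3q C4' C5).
- by apply: (consistent_one_correct Hsetting HMLE HGIC Htheta0
    C2_theta c0 dom C2_loglik C2_Loss C2_loglik_correct C2_Loss_correct q0 C3q C4' C5).
- by apply: (efficient_many_correct Hsetting HMLE HGIC Htheta0 Hmisspecified
    C2_theta c0 dom C2_loglik C2_Loss C2_loglik_correct C2_Loss_correct q0 C3q C4' C5).
Qed.
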